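(* Let $1\le p\le\infty$. Let $(\Omega,\mu)$ and $(\Omega',\mu')$ be arbitrary measure spaces and let $S\subset L_p(\mu)$ be any closed subspace. Then every regular operator $u:S\to L_p(\mu')$ admits a regular extension $\tilde u:L_p(\mu)\to L_p(\mu')$ such that $\|\tilde u\|_r=\|u\|_r$.
   Context: Let $S$ be a linear subspace (possibly all) of a Banach lattice $E$ and let $F$ be a Banach lattice. A linear operator $u:S\to F$ is called regular if there is a constant $C$ such that $$\Big\|\sup_{i\le m}|u(x_i)|\,\Big\|_F\le C\,\Big\|\sup_{i\le m}|x_i|\,\Big\|_E$$ for all finite sequences $x_1,\dots,x_m$ in $S$; $\|u\|_r$ denotes the smallest such constant $C$. The lattices are real or complex (same scalar field throughout). For a non-$\sigma$-finite measure, $L_\infty$ is understood in the usual sense making it the dual of $L_1$. *)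

(* Defs.v *)
From HB Require Import structures.
From mathcomp Require Import all_boot all_order all_algebra.
From mathcomp Require Import generic_quotient ring_quotient complex.
From mathcomp Require Import all_classical all_reals all_analysis.
From mathcomp Require Import ess_sup_inf measurable_realfun.

Set Implicit Arguments.
Unset Strict Implicit.
Unset Printing Implicit Defensive.
Import Order.TTheory GRing.Theory Num.Def Num.Theory.
Import numFieldNormedType.Exports.

Local Open Scope classical_set_scope.
Local Open Scope ring_scope.
Local Open Scope quotient_scope.

(* The scalar field of all spaces is R or R[i], selected by a scalar_kind. *)
Inductive scalar_kind := RealScalars | ComplexScalars.

Section Scalars.
Variables (R : realType).
Implicit Types k : scalar_kind.

Definition scalar k : numFieldType :=
  match k with RealScalars => R | ComplexScalars => R[i] end.

Definition of_real k : R -> scalar k :=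
  match k with RealScalars => id | ComplexScalars => fun x => x%:C%C end.

Definition re_part k : scalar k -> R :=
  match k with RealScalars => id | ComplexScalars => fun z => complex.Re z end.

Definition im_part k : scalar k -> R :=
  match k with RealScalars => fun=> 0 | ComplexScalars => fun z => complex.Im z end.

Definition modulus k (z : scalar k) : R :=
  Num.sqrt (re_part z ^+ 2 + im_part z ^+ 2).

Lemma of_real_modulus k (z : scalar k) : of_real k (modulus z) = `|z|.
Proof.
case: k z => z; rewrite /modulus /=; last by rewrite normc_def.
by rewrite expr0n addr0 sqrtr_sqr.
Qed.

Lemma of_real_le k (x y : R) : (of_real k x <= of_real k y) = (x <= y).
Proof. by case: k => //=; rewrite lecR. Qed.

Lemma of_realD k : {morph of_real k : x y / x + y}.
Proof. by case: k => // x y /=; rewrite rmorphD. Qed.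

Lemma of_realM k : {morph of_real k : x y / x * y}.
Proof. by case: k => // x y /=; rewrite rmorphM. Qed.

Lemma of_real0 k : of_real k 0 = 0.
Proof. by case: k. Qed.

Lemma of_real_inj k : injective (of_real k).
Proof. by case: k => // x y /= []. Qed.

Lemma modulus_ge0 k (z : scalar k) : 0 <= modulus z.
Proof. exact: sqrtr_ge0. Qed.

Lemma modulusD k (y z : scalar k) : modulus (y + z) <= modulus y + modulus z.
Proof. by rewrite -(of_real_le k) of_realD !of_real_modulus ler_normD. Qed.

Lemma modulusM k (y z : scalar k) : modulus (y * z) = modulus y * modulus z.
Proof. by apply: (@of_real_inj k); rewrite of_realM !of_real_modulus normrM. Qed.

Lemma modulus0 k : modulus (0 : scalar k) = 0.
Proof. by apply: (@of_real_inj k); rewrite of_real_modulus normr0 of_real0. Qed.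

Lemma modulus_eq0 k (z : scalar k) : modulus z = 0 -> z = 0.
Proof.
by move/(congr1 (of_real k)); rewrite of_real_modulus of_real0 => /normr0_eq0.
Qed.

Lemma re_partD k : {morph @re_part k : x y / x + y}.
Proof. by case: k => // -[a b] [c d]. Qed.

Lemma im_partD k : {morph @im_part k : x y / x + y}.
Proof. by case: k => [x y|[a b] [c d]] //=; rewrite addr0. Qed.

Lemma re_partM k (x y : scalar k) :
  re_part (x * y) = re_part x * re_part y - im_part x * im_part y.
Proof. by case: k x y => [x y|[a b] [c d]] //=; rewrite mulr0 subr0. Qed.

Lemma im_partM k (x y : scalar k) :
  im_part (x * y) = re_part x * im_part y + im_part x * re_part y.
Proof. by case: k x y => [x y|[a b] [c d]] //=; rewrite mulr0 mul0r addr0. Qed.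

Lemma modulus_real (x : scalar RealScalars) : modulus x = `|x|.
Proof. by rewrite -of_real_modulus. Qed.

End Scalars.

Arguments of_real {R} k x.

Section LnormLemmas.
Context d (T : measurableType d) (R : realType).
Variable mu : {measure set T -> \bar R}.
Local Open Scope ereal_scope.

Lemma le_Lnorm (p : \bar R) (f g : T -> R) : 1 <= p ->
  measurable_fun [set: T] f -> measurable_fun [set: T] g ->
  {ae mu, forall x, (`|f x| <= `|g x|)%R} ->
  'N[mu]_p[EFin \o f] <= 'N[mu]_p[EFin \o g].
Proof.
move=> p1 mf mg fg; rewrite unlock; case: p p1 => [r| |] r1 //; last first.
  by case: ifPn => // _; apply: le_ess_sup; apply: filterS fg => x /=;
    rewrite lee_fin.
have r0 : (0 < r)%R by rewrite (lt_le_trans ltr01).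
have mp (h : T -> R) : measurable_fun [set: T] h ->
    measurable_fun [set: T] (fun x : T => `|(h x)%:E| `^ r).
  move=> mh; apply: (@measurableT_comp _ _ _ _ _ _ (fun x => x `^ r)) => //=.
    exact: measurable_poweR.
  by apply: measurableT_comp => //; apply: measurableT_comp.
have ler0 s (x y : \bar R) : (0 <= s)%R -> 0 <= x -> x <= y ->
    x `^ s <= y `^ s.
  move=> s0 x0 xy; have y0 := le_trans x0 xy.
  by apply: gt0_ler_poweR => //; rewrite in_itv/= leey andbT.
apply/ler0; first by rewrite invr_ge0 ltW.
  by apply: integral_ge0 => x _; exact: poweR_ge0.
apply: ae_ge0_le_integral => //.
- by move=> x _; exact: poweR_ge0.
- exact: mp.
- by move=> x _; exact: poweR_ge0.
- exact: mp.
by apply: filterS fg => x fgx _; apply: ler0; rewrite ?(ltW r0)// lee_fin.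
Qed.

Lemma LnormZ_fun (p : \bar R) (f : T -> R) (a : R) : 1 <= p ->
  measurable_fun [set: T] f -> finite_norm mu p f ->
  'N[mu]_p[EFin \o (fun x => a * f x)%R] = `|a|%:E * 'N[mu]_p[EFin \o f].
Proof.
move=> p1 mf ff.
have fL : f \in Lfun mu p by apply/andP; split; rewrite inE.
exact: (LnormZ (Lfun_Sub p1 fL) a).
Qed.

End LnormLemmas.

Section Lpfun.
Context d (T : measurableType d) (R : realType).
Variables (k : scalar_kind) (mu : {measure set T -> \bar R}) (p : \bar R).
Hypothesis p1 : (1 <= p)%E.
Local Notation K := (scalar R k).

(* An element of L_p(mu) is given by a family (f_A) of functions indexed by
   "pieces" A, where only the values of f_A on A matter, any two f_A and f_B
   agreeing a.e. on the intersection of A and B; its norm is the supremum of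
   the L_p norms of the f_A restricted to A.
   - For p < +oo the only piece is the whole space, so that a family is just
     one p-integrable function (see eLpnorm_fin_exp).
   - For p = +oo the pieces are the measurable sets of finite measure. By
     Radon-Nikodym on each piece, a bounded functional on L_1(mu) is the same as
     such a family, f |-> \int f f_A for f supported in A, with the same norm, so
     that this space is the dual of L_1(mu) for every measure mu.  Families glue
     into one function when mu is sigma-finite (this is then the space of
     essentially bounded functions), but not in general. *)
Definition piece_pred (A : set T) : Prop :=
  if p is +oo%E then measurable A /\ (mu A < +oo)%E else A = [set: T].

Definition piece := {A : set T | piece_pred A}.

Implicit Types (f g : piece -> T -> K).

Definition cut (A : piece) f : T -> R := (@modulus R k \o f A) \_ (sval A).

Definition eLpnorm f : \bar R :=
  ereal_sup [set 'N[mu]_p[EFin \o cut A f]%E | A in [set: piece]].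

Definition piecewise_measurable f := forall A : piece,
  measurable_fun (sval A) (@re_part R k \o f A) /\
  measurable_fun (sval A) (@im_part R k \o f A).

Definition Lpfun_prop f : Prop :=
  [/\ piecewise_measurable f,
      forall A B : piece, {ae mu, forall x, sval A x -> sval B x -> f A x = f B x}
    & (eLpnorm f < +oo)%E].

Lemma measurable_piece (A : piece) : measurable (sval A).
Proof.
case: A => A /=; rewrite /piece_pred; case: p => [r ->|[]|->] //.
Qed.

Lemma piece_inhabited : inhabited piece.
Proof.
suff [A hA] : exists A, piece_pred A by constructor; exists A.
rewrite /piece_pred; case: p => [r||]; [by exists setT| |by exists setT].
by exists set0; rewrite measure0.
Qed.

Lemma eLpnorm_ge0 f : (0 <= eLpnorm f)%E.
Proof.
have [A] := piece_inhabited; apply: le_trans (Lnorm_ge0 mu p _) _.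
by apply: ereal_sup_ubound; exists A.
Qed.

Lemma measurable_modulus (A : piece) f : piecewise_measurable f ->
  measurable_fun (sval A) (@modulus R k \o f A).
Proof.
move=> /(_ A)[mre mim].
apply: (@measurableT_comp _ _ _ _ _ _ (@Num.sqrt R)).
  by apply: continuous_measurable_fun; exact: sqrt_continuous.
by apply: measurable_funD; exact: measurable_funX.
Qed.

Lemma measurable_cut (A : piece) f : piecewise_measurable f ->
  measurable_fun [set: T] (cut A f).
Proof.
move=> mf; apply/(measurable_restrictT _ (measurable_piece A)).
exact: measurable_modulus.
Qed.

Lemma piecewise_measurableD f g : piecewise_measurable f ->
  piecewise_measurable g -> piecewise_measurable (f + g).
Proof.
move=> mf mg A; have [[? ?] [? ?]] := (mf A, mg A).
split.
  rewrite (_ : _ \o _ = (@re_part R k \o f A) \+ (@re_part R k \o g A)).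
    exact: measurable_funD.
  by apply/funext => x; exact: re_partD.
rewrite (_ : _ \o _ = (@im_part R k \o f A) \+ (@im_part R k \o g A)).
  exact: measurable_funD.
by apply/funext => x; exact: im_partD.
Qed.

Lemma piecewise_measurableZ (a : K) f : piecewise_measurable f ->
  piecewise_measurable (a *: f).
Proof.
move=> mf A; have [? ?] := mf A; split.
  rewrite (_ : _ \o _ = (fun x => re_part a * re_part (f A x)
                              - im_part a * im_part (f A x))).
    by apply: measurable_funB; apply: measurable_funM.
  by apply/funext => x; exact: re_partM.
rewrite (_ : _ \o _ = (fun x => re_part a * im_part (f A x)
                            + im_part a * re_part (f A x))).
  by apply: measurable_funD; apply: measurable_funM.
by apply/funext => x; exact: im_partM.
Qed.

Lemma cut_ge0 (A : piece) f x : 0 <= cut A f x.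
Proof. by rewrite /cut /patch; case: ifP => // _; exact: modulus_ge0. Qed.

Lemma le_eLpnorm f g : piecewise_measurable f -> piecewise_measurable g ->
  (forall A : piece, {ae mu, forall x, sval A x -> modulus (f A x) <= modulus (g A x)}) ->
  (eLpnorm f <= eLpnorm g)%E.
Proof.
move=> mf mg fg; apply: ge_ereal_sup => _ [A _ <-].
apply: le_trans (ereal_sup_ubound _); last by exists A.
apply: le_Lnorm => //; [exact: measurable_cut|exact: measurable_cut|].
apply: filterS (fg A) => x xfg; rewrite !ger0_norm ?cut_ge0//.
by rewrite /cut /patch; case: ifP => // /set_mem /xfg.
Qed.

Lemma eLpnormD f g : piecewise_measurable f -> piecewise_measurable g ->
  (eLpnorm (f + g)%R <= eLpnorm f + eLpnorm g)%E.
Proof.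
move=> mf mg; apply: ge_ereal_sup => _ [A _ <-].
apply: (@le_trans _ _ ('N[mu]_p[EFin \o (cut A f \+ cut A g)%R])%E).
  apply: le_Lnorm => //.
  - by apply: measurable_cut; exact: piecewise_measurableD.
  - by apply: measurable_funD; exact: measurable_cut.
  - apply: nearW => x; rewrite !ger0_norm ?addr_ge0 ?cut_ge0//.
    by rewrite /cut /patch /=; case: ifP => // _; [exact: modulusD|rewrite addr0].
apply: le_trans (eminkowski _ _ _ p1) _; [exact: measurable_cut..|].
by apply: leeD; apply: ereal_sup_ubound; exists A.
Qed.

Lemma eLpnormZ_le (a : K) f : piecewise_measurable f -> (eLpnorm f < +oo)%E ->
  (eLpnorm (a *: f)%R <= (modulus a)%:E * eLpnorm f)%E.
Proof.
move=> mf ff; apply: ge_ereal_sup => _ [A _ <-].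
have -> : cut A (a *: f) = fun x => modulus a * cut A f x.
  apply/funext => x; rewrite /cut /patch /=; case: ifP => _; last by rewrite mulr0.
  exact: modulusM.
have leA : ('N[mu]_p[EFin \o cut A f] <= eLpnorm f)%E.
  by apply: ereal_sup_ubound; exists A.
rewrite LnormZ_fun//; last 2 first.
- exact: measurable_cut.
- exact: le_lt_trans ff.
by rewrite ger0_norm ?modulus_ge0// lee_wpmul2l// lee_fin modulus_ge0.
Qed.

Lemma eLpnorm0 : eLpnorm 0 = 0%E.
Proof.
apply/eqP; rewrite eq_le eLpnorm_ge0 andbT; apply: ge_ereal_sup => _ [A _ <-].
rewrite (_ : EFin \o cut A 0 = cst 0%E) ?Lnorm0// ?gt_eqF ?(lt_le_trans _ p1)//.
apply/funext => x /=; rewrite /cut /patch /=; case: ifP => // _.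
by rewrite /= modulus0.
Qed.

Definition Lpfun_pred of (1 <= p)%E : {pred (piece -> T -> K)} := fun f =>
  `[< Lpfun_prop f >].

Lemma Lpfun_submod_closed : submod_closed (Lpfun_pred p1).
Proof.
split.
  apply/asboolP; split; last by rewrite eLpnorm0.
    move=> A; split.
      rewrite (_ : _ \o _ = cst (re_part (0 : K)))//; exact: measurable_cst.
    rewrite (_ : _ \o _ = cst (im_part (0 : K)))//; exact: measurable_cst.
  by move=> A B; apply: nearW.
move=> a f g /asboolP[mf cf ff] /asboolP[mg cg fg]; apply/asboolP.
have maf : piecewise_measurable (a *: f) by exact: piecewise_measurableZ.
split; first exact: (piecewise_measurableD maf).
  move=> A B; apply: filterS2 (cf A B) (cg A B) => x fAB gAB xA xB.
  rewrite /GRing.add/= /GRing.add/= /GRing.scale/= /GRing.scale/=.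
  by rewrite fAB// gAB.
apply: le_lt_trans (eLpnormD maf mg) _; rewrite lte_add_pinfty//.
apply: le_lt_trans (eLpnormZ_le _ mf ff) _.
by rewrite lte_mul_pinfty// ?lee_fin ?modulus_ge0//.
Qed.

HB.instance Definition _ :=
  GRing.isSubmodClosed.Build K (piece -> T -> K) (Lpfun_pred p1)
    Lpfun_submod_closed.

Record Lpfun := MkLpfun {
  Lpfun_val :> piece -> T -> K;
  Lpfun_valP : Lpfun_val \in Lpfun_pred p1 }.

HB.instance Definition _ := [isSub for Lpfun_val].
HB.instance Definition _ := [Choice of Lpfun by <:].
HB.instance Definition _ := [SubChoice_isSubLmodule of Lpfun by <:].

Lemma LpfunP (f : Lpfun) : Lpfun_prop f.
Proof. exact/asboolP/Lpfun_valP. Qed.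

Definition null_pred : {pred Lpfun} := fun f : Lpfun =>
  `[< forall A : piece, {ae mu, forall x, sval A x -> f A x = 0} >].

Lemma null_submod_closed : submod_closed null_pred.
Proof.
split; first by apply/asboolP => A; exact: nearW.
move=> a f g /asboolP f0 /asboolP g0; apply/asboolP => A.
apply: filterS2 (f0 A) (g0 A) => x fx gx Ax.
rewrite /= /GRing.add/= /GRing.add/= /GRing.scale/= /GRing.scale/=.
by rewrite fx// gx// scaler0 addr0.
Qed.

HB.instance Definition _ :=
  GRing.isSubmodClosed.Build K Lpfun null_pred null_submod_closed.

Definition Lp := Quotient.quot null_pred.

HB.instance Definition _ := GRing.Zmodule.on Lp.
HB.instance Definition _ := EqQuotient.on Lp.

Definition Lp_scale (a : K) (x : Lp) : Lp := \pi_Lp (a *: repr x).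

Lemma Lp_eqP (f g : Lpfun) : reflect
  (forall A : piece, {ae mu, forall x, sval A x -> f A x = g A x})
  (\pi_Lp f == \pi_Lp g).
Proof.
rewrite -[_ == _]/(f == g %[mod Quotient.quot null_pred]) -Quotient.idealrBE.
apply: (iffP idP) => [/asboolP fg A|fg].
  by apply: filterS (fg A) => x fgx /fgx /eqP; rewrite subr_eq0 => /eqP.
apply/asboolP => A; apply: filterS (fg A) => x fgx /fgx fgxE.
by apply/eqP; rewrite subr_eq0; apply/eqP.
Qed.

Lemma Lp_reprE (f : Lpfun) (A : piece) :
  {ae mu, forall x, sval A x -> (repr (\pi_Lp f) : Lpfun) A x = f A x}.
Proof.
by move: A; apply/Lp_eqP; rewrite reprK.
Qed.

Lemma pi_scale (a : K) (f : Lpfun) : \pi_Lp (a *: f) = Lp_scale a (\pi_Lp f).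
Proof.
apply/eqP/Lp_eqP => A; apply: filterS (Lp_reprE f A) => x h /h hx.
by rewrite /= /GRing.scale/= /GRing.scale/= hx.
Qed.

Lemma pi_add (f g : Lpfun) : \pi_Lp (f + g) = \pi_Lp f + \pi_Lp g :> Lp.
Proof. exact: (Quotient.pi_add null_pred). Qed.

Lemma Lp_scaleA a b (x : Lp) : Lp_scale a (Lp_scale b x) = Lp_scale (a * b) x.
Proof.
by rewrite -[x]reprK -(pi_scale b) -(pi_scale a) -(pi_scale (a * b)) scalerA.
Qed.

Lemma Lp_scale1 : left_id 1 Lp_scale.
Proof. by move=> x; rewrite -[x]reprK -(pi_scale 1) scale1r. Qed.

Lemma Lp_scaleDr : right_distributive Lp_scale +%R.
Proof.
move=> a x y; rewrite -[x]reprK -[y]reprK -pi_add -(pi_scale a (_ + _)).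
by rewrite scalerDr pi_add !pi_scale.
Qed.

Lemma Lp_scaleDl x : {morph Lp_scale^~ x : a b / a + b}.
Proof.
by move=> a b; rewrite -[x]reprK -(pi_scale (a + b)) scalerDl pi_add !pi_scale.
Qed.

HB.instance Definition _ := GRing.Zmodule_isLmodule.Build K Lp
  Lp_scaleA Lp_scale1 Lp_scaleDr Lp_scaleDl.

Definition Lpnorm (x : Lp) : R := fine (eLpnorm (repr x : Lpfun)).

Lemma eLpnorm_fin (f : Lpfun) : (fine (eLpnorm f))%:E = eLpnorm f.
Proof. by have [_ _ h] := LpfunP f; rewrite fineK// ge0_fin_numE// eLpnorm_ge0. Qed.

Lemma eq_eLpnorm (f g : Lpfun) : \pi_Lp f = \pi_Lp g -> eLpnorm f = eLpnorm g.
Proof.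
have [mf _ _] := LpfunP f; have [mg _ _] := LpfunP g.
move=> /eqP/Lp_eqP fg; apply/eqP; rewrite eq_le; apply/andP; split;
  by apply: le_eLpnorm => // A; apply: filterS (fg A) => x h /h ->.
Qed.

Lemma Lpnorm_pi (f : Lpfun) : Lpnorm (\pi_Lp f) = fine (eLpnorm f).
Proof. by congr fine; apply: eq_eLpnorm; rewrite reprK. Qed.

Lemma Lpnorm_ge0 x : 0 <= Lpnorm x.
Proof. by rewrite fine_ge0// eLpnorm_ge0. Qed.

Lemma LpnormD x y : Lpnorm (x + y) <= Lpnorm x + Lpnorm y.
Proof.
rewrite -[x]reprK -[y]reprK -pi_add !Lpnorm_pi -lee_fin EFinD !eLpnorm_fin.
have [mf _ _] := LpfunP (repr x); have [mg _ _] := LpfunP (repr y).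
exact: eLpnormD.
Qed.

Lemma LpnormZ_le a x : Lpnorm (a *: x) <= modulus a * Lpnorm x.
Proof.
rewrite -[x]reprK -[a *: _]pi_scale !Lpnorm_pi -lee_fin EFinM !eLpnorm_fin.
have [mf _ h] := LpfunP (repr x).
rewrite (_ : Lpfun_val (a *: repr x) = a *: Lpfun_val (repr x)); last by [].
exact: (eLpnormZ_le a mf h).
Qed.

Lemma LpnormZ a x : Lpnorm (a *: x) = modulus a * Lpnorm x.
Proof.
apply/eqP; rewrite eq_le LpnormZ_le/=.
have [->|a0] := eqVneq a 0; first by rewrite modulus0 mul0r Lpnorm_ge0.
have ma0 : 0 < modulus a.
  rewrite lt_neqAle modulus_ge0 andbT eq_sym.
  by apply: contra_neq a0; exact: modulus_eq0.
rewrite -ler_pdivlMl//; apply: le_trans (_ : modulus (a^-1) * Lpnorm (a *: x) <= _).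
  by rewrite -[leLHS](_ : Lpnorm (a^-1 *: (a *: x)) = _) ?LpnormZ_le//
    scalerA mulVf// scale1r.
suff -> : modulus a^-1 = (modulus a)^-1 by [].
apply: (mulfI (lt0r_neq0 ma0)); rewrite -modulusM mulfV// mulfV ?lt0r_neq0//.
by apply: (@of_real_inj _ k); rewrite of_real_modulus normr1; case: (k).
Qed.

Lemma Lpnorm_eq0 x : Lpnorm x = 0 -> x = 0.
Proof.
rewrite -[x]reprK; move: (repr x) => f; rewrite Lpnorm_pi => h.
have h0 : eLpnorm f = 0%E by rewrite -eLpnorm_fin h.
have [mf _ _] := LpfunP f.
have -> : 0 = \pi_Lp (0 : Lpfun) by apply: (addrI (\pi_Lp 0)); rewrite -pi_add !addr0.
apply/eqP/Lp_eqP => A.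
have NA0 : ('N[mu]_p[EFin \o cut A f] = 0)%E.
  apply/eqP; rewrite eq_le Lnorm_ge0 andbT -h0.
  by apply: ereal_sup_ubound; exists A.
have mcut : measurable_fun [set: T] (EFin \o cut A f).
  by apply/measurable_EFinP; exact: measurable_cut.
apply: filterS (Lnorm_eq0_eq0 mcut (lt_le_trans lte01 p1) NA0) => y /(_ I).
by rewrite /= /cut /patch => + Ay; rewrite mem_set// => -[/modulus_eq0].
Qed.

Let nrm (x : Lp) : K := of_real k (Lpnorm x).

Let nrmD x y : nrm (x + y) <= nrm x + nrm y.
Proof. by rewrite /nrm -of_realD of_real_le LpnormD. Qed.

Let nrmZ a x : nrm (a *: x) = `|a| * nrm x.
Proof. by rewrite /nrm LpnormZ of_realM of_real_modulus. Qed.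

Let nrm0 x : nrm x = 0 -> x = 0.
Proof.
by rewrite /nrm -(@of_real0 R k) => /of_real_inj; exact: Lpnorm_eq0.
Qed.

HB.instance Definition _ := Lmodule_isNormed.Build K Lp nrmD nrmZ nrm0.

End Lpfun.

Arguments piece {d T R} mu p.
Arguments Lpfun_pred {d T R} k mu {p} p1 _.
Arguments Lpfun {d T R} k mu {p} p1.
Arguments Lp {d T R} k mu {p} p1.

Section LpLattice.
Context d (T : measurableType d) (R : realType).
Variables (mu : {measure set T -> \bar R}) (p : \bar R).
Hypothesis p1 : (1 <= p)%E.
Local Notation LR := (Lp RealScalars mu p1).
Local Notation LRfun := (Lpfun RealScalars mu p1).

(* The lattice operations: |x|, an element of the real L_p space, and the
   binary supremum of the real L_p space; both are pointwise. *)
Definition abs_fam (k : scalar_kind) (f : Lpfun k mu p1) :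
    piece mu p -> T -> scalar R RealScalars :=
  fun A x => modulus (f A x).

Lemma abs_famP (k : scalar_kind) (f : Lpfun k mu p1) : 
  abs_fam f \in Lpfun_pred RealScalars mu p1.
Proof.
have [mf cf ff] := LpfunP f; apply/asboolP; split.
- move=> A; split; first exact: (@measurable_modulus _ _ _ _ _ _ A _ mf).
  exact: measurable_cst.
- by move=> A B; apply: filterS (cf A B) => x h xA xB; rewrite /abs_fam h.
- apply: le_lt_trans ff; apply: ge_ereal_sup => _ [A _ <-].
  rewrite (_ : cut A (abs_fam f) = cut A f); last first.
    apply/funext => x; rewrite /cut /patch; case: ifP => // _ /=.
    by rewrite modulus_real ger0_norm// modulus_ge0.
  by apply: ereal_sup_ubound; exists A.
Qed.

Definition Lp_abs (k : scalar_kind) (x : Lp k mu p1) : LR := \pi_LR (MkLpfun (abs_famP (repr x))).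

Definition max_fam (f g : LRfun) : piece mu p -> T -> scalar R RealScalars :=
  fun A x => Num.max (f A x : R) (g A x : R).

Lemma max_famP f g : max_fam f g \in Lpfun_pred RealScalars mu p1.
Proof.
have [mf cf ff] := LpfunP f; have [mg cg fg] := LpfunP g.
have mm : piecewise_measurable (max_fam f g).
  move=> A; have [[mfA _] [mgA _]] := (mf A, mg A); split.
    exact: (measurable_maxr mfA mgA).
  exact: measurable_cst.
apply/asboolP; split => //.
  move=> A B; apply: filterS2 (cf A B) (cg A B) => x hf hg xA xB.
  by rewrite /max_fam hf// hg.
pose af := Lpfun_val (MkLpfun (abs_famP f)).
pose ag := Lpfun_val (MkLpfun (abs_famP g)).
have [maf _ faf] := LpfunP (MkLpfun (abs_famP f)).
have [mag _ fag] := LpfunP (MkLpfun (abs_famP g)).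
apply: (@le_lt_trans _ _ (eLpnorm (af + ag)%R)); last first.
  by apply: le_lt_trans (eLpnormD p1 maf mag) _; rewrite lte_add_pinfty.
apply: le_eLpnorm => //; first exact: piecewise_measurableD.
move=> A; apply: nearW => x _; rewrite !modulus_real /max_fam.
rewrite /af /ag /= /GRing.add/= /GRing.add/= /abs_fam !modulus_real.
rewrite [leRHS]ger0_norm ?addr_ge0//.
by rewrite /Num.max; case: ifP => _; rewrite ?lerDl ?lerDr.
Qed.

Definition Lp_max (x y : LR) : LR := \pi_LR (MkLpfun (max_famP (repr x) (repr y))).

Lemma Lp_abs_pi (k : scalar_kind) (f : Lpfun k mu p1) :
  Lp_abs (\pi_(Lp k mu p1) f) = \pi_LR (MkLpfun (abs_famP f)).
Proof.
apply/eqP/Lp_eqP => A; apply: filterS (Lp_reprE f A) => x h /h hx.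
by rewrite /= /abs_fam hx.
Qed.

Lemma Lp_max_pi (f g : LRfun) :
  Lp_max (\pi_LR f) (\pi_LR g) = \pi_LR (MkLpfun (max_famP f g)).
Proof.
apply/eqP/Lp_eqP => A; apply: filterS2 (Lp_reprE f A) (Lp_reprE g A).
by move=> x hf hg Ax; rewrite /= /max_fam hf// hg.
Qed.

Lemma eLpnorm_fin_exp (k : scalar_kind) (r : R) (A : piece mu r%:E)
    (f : piece mu r%:E -> T -> scalar R k) :
  eLpnorm f = 'N[mu]_(r%:E)[EFin \o (@modulus R k \o f A)]%E.
Proof.
have pieceE (B : piece mu r%:E) : B = A.
  by case: A B => [A hA] [B hB]; apply: eq_exist; rewrite hA hB.
have cutE : cut A f = @modulus R k \o f A.
  by rewrite /cut (_ : sval A = [set: T]) ?patch_setT//; case: (A).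
rewrite -cutE /eLpnorm (_ : [set _ | _ in _] = [set ('N[mu]_(r%:E)[EFin \o cut A f])%E]).
  exact: ereal_sup1.
by apply/seteqP; split => [_ [B _ <-]|_ ->]; [rewrite (pieceE B)|exists A].
Qed.

End LpLattice.

Section Regular.
Context d d' (T : measurableType d) (T' : measurableType d') (R : realType).
Variables (k : scalar_kind).
Variables (mu : {measure set T -> \bar R}) (mu' : {measure set T' -> \bar R}).
Variables (p : \bar R) (p1 : (1 <= p)%E).
Local Notation E := (Lp k mu p1).
Local Notation F := (Lp k mu' p1).
Implicit Types (S : set E) (u : E -> F).

(* An operator S -> F is represented by a function on E of which only the values
   on S are used. *)
Definition subspace_of S : Prop :=
  S 0 /\ forall (a : scalar R k) (x y : E), S x -> S y -> S (a *: x + y).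

Definition linear_on S u : Prop :=
  forall (a : scalar R k) (x y : E), S x -> S y ->
    u (a *: x + y) = a *: u x + u y.

(* The supremum of |x_0|, ..., |x_(m-1)| is an iterated Lp_max started at 0,
   which is harmless since the moduli are nonnegative. *)
Definition regular_bound S u (C : R) : Prop :=
  0 <= C /\ forall (m : nat) (x : 'I_m -> E), (forall i, S (x i)) ->
    Lpnorm (\big[@Lp_max _ _ _ mu' _ p1 / 0]_(i < m) Lp_abs (u (x i))) <=
    C * Lpnorm (\big[@Lp_max _ _ _ mu _ p1 / 0]_(i < m) Lp_abs (x i)).

Definition regular_on S u : Prop :=
  linear_on S u /\ exists C, regular_bound S u C.

Definition regular_norm S u : R := inf [set C | regular_bound S u C].

Lemma regular_normP S u : regular_on S u -> regular_bound S u (regular_norm S u).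
Proof.
move=> [_ [C0 C0P]].
have lb : has_lbound [set C | regular_bound S u C].
  by exists 0 => C [].
split; first by apply: lb_le_inf => [|C []//]; exists C0.
move=> m x Sx; set b := Lpnorm _; set c := Lpnorm _.
have c0 : 0 <= c by exact: Lpnorm_ge0.
have [cE|cN] := eqVneq c 0.
  by have [_ /(_ m x Sx)] := C0P; rewrite -/b -/c cE !mulr0.
have cp : 0 < c by rewrite lt_neqAle eq_sym cN.
rewrite -ler_pdivrMr//; apply: lb_le_inf; first by exists C0.
by move=> C [_ /(_ m x Sx)]; rewrite -/b -/c ler_pdivrMr.
Qed.

End Regular.

(* Main.v *)
Require Import Defs.
From HB Require Import structures.
From mathcomp Require Import all_boot all_order all_algebra.
From mathcomp Require Import complex.
From mathcomp Require Import all_classical all_reals all_analysis.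
From mathcomp Require Import ess_sup_inf measurable_realfun.
From mathcomp Require Import ring lra.
Import Order.TTheory GRing.Theory Num.Theory.
Import numFieldNormedType.Exports.
Local Open Scope classical_set_scope.
Local Open Scope ring_scope.

Set Implicit Arguments.
Unset Strict Implicit.
Unset Printing Implicit Defensive.

(* Put [th = 1 / p].  For [v : T' -> L_p(mu)] simple, consider the infimum of
     [th * \int F dmu + (1 - th) * \int G dmu']
   over the weights [F >= 0] on [T] and [G >= 0] on [T'] such that, for almost all [w'],
   [|v w'| <= F ^ th * (G w') ^ (1 - th)].
   By Hoelder's inequality for sums of two terms this is a sublinear function of [v].
   If [v] takes its values in [S], Young's inequality shows that it is at least
   [\int Re (u (v w')) (w') dw' / C] for every regular bound [C] of [u]: for each value
   [z] of [v] the weight [G] may be replaced by a constant on [v = z], and the bound is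
   applied to the finitely many vectors [z / G ^ (1 - th)] of [S].  Thus passing from [S]
   to [L_p(mu)] does not decrease the sublinear functional on [S]-valued functions, and
   Hahn-Banach gives a functional [L] on all simple functions [v].

   Taking limits of [v |-> L (v \1_C)] along a suitable ultrafilter of measurable sets [C]
   makes [L] countably additive (only needed when [p = 1], where it plays the role of the
   Yosida-Hewitt projection).  Radon-Nikodym on sets of finite measure, and an exhaustion
   argument when [p] is finite, represent [B |-> L (x \1_B)] by an element [ut x] of
   [L_p(mu')].  Finally the regular bound [C] of [ut] is recovered by testing [L] on the
   functions [G ^ (1 - th) * a * x_i], with [a] in a finite set of almost all phases and
   [i] chosen pointwise so as to maximise [Re (a * ut x_i)], where [G] increases to a
   multiple of [max_i |ut x_i| ^ p]. *)

(** * Scalars and the Hahn-Banach theorem *)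

Section ScalarLemmas.
Context {R : realType} {k : scalar_kind}.
Local Notation K := (Defs.scalar R k).
Local Notation "x %:K" := (of_real k x) (at level 2, format "x %:K").

(** The obstacle is that neither measure is sigma-finite and that [p] may be 1 or infinite, so that
    no single duality of L_p spaces is available. Norms are therefore replaced by weights: for
    [c > 0], [Lpnorm x <= c] means that |x| is at most [c * F ^ th] a.e. for some [F >= 0] of
    integral at most 1, and a finite supremum has norm at most [c] exactly when one [F] serves all
    its members. The convention [0 ^ 0 = 1] makes this valid for infinite [p]. Such a domination
    never mentions [S], which is why the same sublinear functional serves on [S]-valued functions
    and on all functions.

    For [0 < th < 1], optimising the scale of [F] against that of [G] turns the additive cost into
    [(\int F) ^ th * (\int G) ^ (1 - th)]; the additive form makes sums easy to handle and survives
    at the two end points.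

    Hahn-Banach is used over the reals, so that only real parts are controlled. Moduli are restored
    by finitely many phases, at the price of a factor [1 / (1 - e)] that disappears in the limit.
    The sharp constant is carried by [C] alone; the [+ 1] in [Lpnorm x + 1] only makes a constant
    positive. *)

Definition imag : K :=
  match k return Defs.scalar R k with RealScalars => 0 | ComplexScalars => 'i%C end.

Lemma of_real1 : (1 : R)%:K = 1. Proof. by rewrite /of_real; case: k. Qed.

Lemma of_realN (a : R) : (- a)%:K = - a%:K.
Proof. by apply/eqP; rewrite -addr_eq0 -of_realD addNr of_real0. Qed.

Lemma re_part_of_real (a : R) : re_part a%:K = a.
Proof. by rewrite /re_part /of_real; case: k. Qed.

Lemma im_part_of_real (a : R) : im_part a%:K = 0.
Proof. by rewrite /im_part /of_real; case: k. Qed.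

(** Over real scalars both [imag] and [im_part] are 0, so one decomposition covers both fields
    without a case distinction. *)
Lemma scalarE (z : K) : z = (re_part z)%:K + imag * (im_part z)%:K.
Proof.
rewrite /re_part /im_part /imag /of_real; case: k z => [z|[a b]] /=.
  by rewrite mul0r addr0.
by apply/eqP; rewrite eq_complex /= !mul0r !mul1r; apply/andP; split; apply/eqP; ring.
Qed.

Lemma scalar_eq (z w : K) : re_part z = re_part w -> im_part z = im_part w -> z = w.
Proof. by move=> zw1 zw2; rewrite (scalarE z) (scalarE w) zw1 zw2. Qed.

Lemma re_part_imag (z : K) : re_part (imag * z) = - im_part z.
Proof.
by rewrite /re_part /im_part /imag; case: k z => [z|[a b]] /=; ring.
Qed.

Lemma re_partMr (a : R) (z : K) : re_part (a%:K * z) = a * re_part z.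
Proof. by rewrite re_partM re_part_of_real im_part_of_real mul0r subr0. Qed.

Lemma re_part0 : re_part (0 : K) = 0.
Proof. by rewrite /re_part; case: k. Qed.

Lemma im_part0 : im_part (0 : K) = 0.
Proof. by rewrite /im_part; case: k. Qed.

Lemma modulus_of_real (a : R) : modulus a%:K = `|a|.
Proof. by rewrite /modulus re_part_of_real im_part_of_real expr0n addr0 sqrtr_sqr. Qed.

Lemma modulus_sqr (z : K) : modulus z ^+ 2 = re_part z ^+ 2 + im_part z ^+ 2.
Proof. by rewrite sqr_sqrtr// addr_ge0// sqr_ge0. Qed.

Lemma re_part_le (z : K) : `|re_part z| <= modulus z.
Proof. by rewrite -sqrtr_sqr ler_wsqrtr// lerDl sqr_ge0. Qed.

Lemma modulusN (z : K) : modulus (- z) = modulus z.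
Proof.
by rewrite -mulN1r modulusM -of_real1 -of_realN modulus_of_real normrN1 mul1r.
Qed.

Lemma modulus_imag : modulus imag <= 1.
Proof.
rewrite /modulus /re_part /im_part /imag; case: k => /=.
  by rewrite expr0n/= addr0 sqrtr0.
by rewrite expr0n/= add0r expr1n sqrtr1.
Qed.

End ScalarLemmas.
Arguments imag {R k}.

Section HahnBanach.
Context {R : realType} {k : scalar_kind} {V : lmodType (Defs.scalar R k)}.
Local Notation "x %:K" := (of_real k x) (at level 2, format "x %:K").

(** Real scalars are used even in a complex space: the functional stands for the real part of a
    pairing, and its imaginary part is found by multiplying the vector by [imag]. *)
Definition real_subspace (D : set V) : Prop :=
  D 0 /\ forall (a : R) (x y : V), D x -> D y -> D (a%:K *: x + y).

Definition real_linear_on (D : set V) (f : V -> R) : Prop :=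
  forall (a : R) (x y : V), D x -> D y -> f (a%:K *: x + y) = a * f x + f y.

(* [g v s] reads "the sublinear functional is at most s at v" *)
Definition bounded_by (D : set V) (g : V -> R -> Prop) (f : V -> R) : Prop :=
  forall v s, D v -> g v s -> f v <= s.

Lemma real_subspaceZ D (a : R) x : real_subspace D -> D x -> D (a%:K *: x).
Proof. by move=> [D0 DP] Dx; rewrite -[_ *: _]addr0; exact: DP. Qed.

Lemma real_subspaceD D x y : real_subspace D -> D x -> D y -> D (x + y).
Proof. by move=> [D0 DP] Dx Dy; rewrite -[x]scale1r -of_real1; exact: DP. Qed.

Lemma real_linear0 D f : real_subspace D -> real_linear_on D f -> f 0 = 0.
Proof.
move=> [D0 _] lf; have := lf 1 0 0 D0 D0.
by rewrite scaler0 addr0 mul1r => /eqP; rewrite -subr_eq0 opprD addrA subrr sub0r oppr_eq0 => /eqP.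
Qed.

Lemma real_linearZ {D f} (a : R) x :
  real_subspace D -> real_linear_on D f -> D x -> f (a%:K *: x) = a * f x.
Proof.
move=> sD lf Dx; have [D0 _] := sD.
by rewrite -[_ *: _]addr0 lf// (real_linear0 sD lf) addr0.
Qed.

Lemma real_linearD {D f} x y :
  real_linear_on D f -> D x -> D y -> f (x + y) = f x + f y.
Proof.
by move=> lf Dx Dy; rewrite -{1}[x]scale1r -{1}(@of_real1 R k) lf// mul1r.
Qed.

Variable g : V -> R -> Prop.
Hypothesis gD : forall v w s t, g v s -> g w t -> g (v + w) (s + t).
Hypothesis gZ : forall (a : R) v s, 0 < a -> g v s -> g (a%:K *: v) (a * s).

Section OneStep.
Variables (D : set V) (f : V -> R) (x0 : V).
Hypothesis sD : real_subspace D.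
Hypothesis lf : real_linear_on D f.
Hypothesis fg : bounded_by D g f.
Hypothesis Dx0 : ~ D x0.
Hypothesis gx0 : exists s, g x0 s.
Hypothesis gNx0 : exists s, g (- x0) s.

(** [c] is the value to be given to [x0]. A supremum of the lower constraints works, since
    subadditivity puts each lower constraint below each upper one ([Xub]). *)
Lemma one_step_value : exists c : R,
  (forall y s, D y -> g (y - x0) s -> f y - s <= c) /\
  (forall y s, D y -> g (y + x0) s -> c <= s - f y).
Proof.
have [D0 _] := sD; have [s1 gs1] := gx0; have [s2 gs2] := gNx0.
pose X := [set r | exists y s, [/\ D y, g (y - x0) s & r = f y - s]].
have Xub y s : D y -> g (y + x0) s -> ubound X (s - f y).
  move=> Dy gy _ [y' [s' [Dy' gy' ->]]].
  suff : f (y' + y) <= s' + s by rewrite (real_linearD lf)//; lra.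
  apply: fg; first exact: real_subspaceD.
  rewrite (_ : y' + y = (y' - x0) + (y + x0)); first exact: gD.
  by rewrite (addrC y x0) addrA subrK.
have X0 : X !=set0 by exists (f 0 - s2), 0, s2; split => //; rewrite add0r.
exists (sup X); split => [y s Dy gy|y s Dy gy].
  apply: ub_le_sup; last by exists y, s.
  by exists (s1 - f 0); apply: Xub => //; rewrite add0r.
by apply: ge_sup => //; exact: Xub.
Qed.

Lemma one_step : exists (D' : set V) (f' : V -> R),
  [/\ real_subspace D', D `<=` D', D' x0,
      real_linear_on D' f' & bounded_by D' g f' /\ {in D, f' =1 f}]
  /\ (forall x, D' x -> exists y (a : R), D y /\ x = a%:K *: x0 + y).
Proof.
have [D0 DP] := sD; have [c [c1 c2]] := one_step_value.
pose P x (ya : V * R) := D ya.1 /\ x = ya.2%:K *: x0 + ya.1.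
have Puniq x ya yb : P x ya -> P x yb -> ya = yb.
  case: ya yb => [y a] [z b] [/= Dy ->] [/= Dz E].
  have ab : a = b.
    apply/eqP; apply: contrapT => /negP; rewrite -subr_eq0 => ab; apply: Dx0.
    have E2 : (a - b)%:K *: x0 = z - y.
      by rewrite of_realD of_realN scalerBl; apply/eqP; rewrite subr_eq [eqbRHS]addrC addrA -E addrK.
    rewrite -[x0]scale1r -(@of_real1 R k) -(mulVf ab) of_realM -scalerA E2.
    apply: real_subspaceZ => //; rewrite addrC -scaleN1r -of_real1 -of_realN.
    exact: DP.
  by move: E; rewrite ab => /addrI ->.
pose D' : set V := [set x | exists ya, P x ya].
pose f' x := match pselect (D' x) with
  | left h => let ya := projT1 (cid h) in ya.2 * c + f ya.1
  | right _ => 0 end.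
have f'E y a : D y -> f' (a%:K *: x0 + y) = a * c + f y.
  move=> Dy; rewrite /f'; case: pselect => [h|[]]; last by exists (y, a).
  case: cid => ya /= hya.
  by rewrite (Puniq _ ya (y, a) hya).
exists D', f'; split; last by move=> x [[y a] [/= Dy ->]]; exists y, a.
have DD' : D `<=` D'.
  by move=> x Dx; exists (x, 0); split => //=; rewrite of_real0 scale0r add0r.
split => //.
- split; first exact: DD'.
  move=> a _ _ [[y b] [/= Dy ->]] [[z e] [/= Dz ->]].
  exists (a%:K *: y + z, a * b + e); split => /=; first exact: DP.
  by rewrite of_realD of_realM scalerDl scalerDr -scalerA addrACA.
- by exists (0, 1); split => //=; rewrite of_real1 scale1r addr0.
- move=> a _ _ [[y b] [/= Dy ->]] [[z e] [/= Dz ->]].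
  rewrite scalerDr scalerA addrACA -of_realM -scalerDl -of_realD.
  by rewrite !f'E ?lf//; [ring|exact: DP].
split.
- move=> _ s [[y a] [/= Dy ->]] gs; rewrite f'E//.
  (* Dividing by the absolute value of [a] brings the coefficient of [x0] to -1 or 1, where the two
     properties of [c] apply. *)
  have [a0|a0|a0] := ltrgtP a 0.
  + have na0 : 0 < - a^-1 by rewrite oppr_gt0 invr_lt0.
    have := gZ na0 gs; rewrite scalerDr scalerA -of_realM mulNr mulVf ?lt_eqF//.
    rewrite of_realN of_real1 scaleN1r addrC => /c1 => /(_ (real_subspaceZ _ sD Dy)).
    rewrite (real_linearZ _ sD lf)//.
    move=> h0; have h : - (a^-1 * (f y - s)) <= c by lra.
    have : a * c <= a * - (a^-1 * (f y - s)) by rewrite ler_nM2l.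
    by rewrite mulrN mulrA mulfV ?lt_eqF// mul1r; lra.
  + have a0' : 0 < a^-1 by rewrite invr_gt0.
    have := gZ a0' gs; rewrite scalerDr scalerA -of_realM mulVf ?gt_eqF//.
    rewrite of_real1 scale1r addrC => /c2 => /(_ (real_subspaceZ _ sD Dy)).
    rewrite (real_linearZ _ sD lf)// -mulrBr => h.
    have : a * c <= a * (a^-1 * (s - f y)) by rewrite ler_pM2l.
    by rewrite mulrA mulfV ?gt_eqF// mul1r; lra.
  + by move: gs; rewrite a0 of_real0 scale0r add0r mul0r add0r; exact: fg.
- move=> x /set_mem Dx.
  by have := f'E x 0 Dx; rewrite of_real0 scale0r mul0r !add0r.
Qed.

End OneStep.

(** The sublinear functional is given by the relation of its upper bounds. Its infimum is never
    formed, so only the existence of an upper bound at each point of [W] has to be provided. *)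
Lemma hahn_banach (W D : set V) (f : V -> R) :
  real_subspace W -> (forall v, W v -> exists s, g v s) ->
  real_subspace D -> D `<=` W -> real_linear_on D f -> bounded_by D g f ->
  exists F : V -> R,
    [/\ real_linear_on W F, bounded_by W g F & {in D, F =1 f}].
Proof.
move=> sW gW sD DW lf fg.
pose good (Df : set V * (V -> R)) := [/\ real_subspace Df.1, D `<=` Df.1,
  Df.1 `<=` W, real_linear_on Df.1 Df.2 & bounded_by Df.1 g Df.2 /\ {in D, Df.2 =1 f}].
pose le (a b : {Df | good Df}) :=
  `[< (sval a).1 `<=` (sval b).1 /\ {in (sval a).1, (sval b).2 =1 (sval a).2} >].
have g0 : good (D, f) by split.
(* [le] compares functions on their domains only. Since the values elsewhere are arbitrary it is
   merely a preorder, hence this form of Zorn's lemma. *)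
have [| |A tA|[[E e] gE] emax] := @ZL_preorder _ (exist _ _ g0) le.
- by move=> t; apply/asboolP; split.
- move=> r s t /asboolP[h1 h2] /asboolP[h3 h4]; apply/asboolP; split.
    exact: subset_trans h3.
  by move=> x /set_mem xr; rewrite h4 ?h2 ?inE//; exact: h1.
- have [[a0 Aa0]|A0] := pselect (exists a, A a); last first.
    by exists (exist _ _ g0) => s As; exfalso; apply: A0; exists s.
  pose U : set V := \bigcup_(a in A) (sval a).1.
  pose h x := match pselect (U x) with
    | left hx => (sval (projT1 (cid2 hx))).2 x | right _ => 0 end.
  have comp a b x : A a -> A b -> (sval a).1 x -> (sval b).1 x ->
      (sval a).2 x = (sval b).2 x.
    move=> Aa Ab ax bx; have [/asboolP[_ hh]|/asboolP[_ hh]] := tA _ _ Aa Ab.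
      by rewrite hh// inE.
    by rewrite hh// inE.
  have hE a x : A a -> (sval a).1 x -> h x = (sval a).2 x.
    move=> Aa ax; rewrite /h; case: pselect => [hx|[]]; last by exists a.
    by case: cid2 => b Ab bx /=; exact: comp.
  have U2 x y : U x -> U y -> exists2 a, A a & (sval a).1 x /\ (sval a).1 y.
    move=> [a Aa ax] [b Ab bx].
    have [/asboolP[hh _]|/asboolP[hh _]] := tA _ _ Aa Ab.
      by exists b => //; split => //; exact: hh.
    by exists a => //; split => //; exact: hh.
  have gUh : good (U, h).
    split => /=.
    + split; first by exists a0 => //; case: (svalP a0) => -[].
      move=> a x y Ux Uy; have [b Ab [bx by_]] := U2 _ _ Ux Uy.
      by exists b => //; case: (svalP b) => -[_ bP] _ _ _ _; exact: bP.
    + by move=> x Dx; exists a0 => //; case: (svalP a0) => _ ab _ _ _; exact: ab.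
    + by move=> x [a Aa ax]; case: (svalP a) => _ _ ab _ _; exact: ab.
    + move=> a x y Ux Uy; have [b Ab [bx by_]] := U2 _ _ Ux Uy.
      case: (svalP b) => -[_ bP] _ _ bl _.
      by rewrite !(hE b)// ?bl//; exact: bP.
    split.
      move=> v s [a Aa av] gv; rewrite (hE a)//.
      by case: (svalP a) => _ _ _ _ [ba _]; exact: ba.
    move=> x xD; have /set_mem Dx := xD.
    case: (svalP a0) => _ Da0 _ _ [_ a0f].
    by rewrite (hE a0)// ?a0f//; exact: Da0.
  exists (exist _ _ gUh) => s As; apply/asboolP; split.
    by move=> x sx; exists s.
  by move=> x /set_mem sx /=; exact: hE.
- have [/= sE DE EW le_ [be eE]] := gE; exists e; suff -> : W = E by split.
  apply/seteqP; split => // x0 Wx0; apply: contrapT => Ex0.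
  have WNx0 : W (- x0) by rewrite -scaleN1r -of_real1 -of_realN; exact: real_subspaceZ.
  have [D' [f' [[sD' ED' D'x0 lf' [bf' f'e]] D'P]]] :=
    one_step sE le_ be Ex0 (gW _ Wx0) (gW _ WNx0).
  have gD' : good (D', f').
    split => //=; first exact: subset_trans ED'.
      move=> x /D'P[y [a [Ey ->]]]; have [_ WP] := sW; apply: WP => //; exact: EW.
    split => // x xD; have /set_mem Dx := xD.
    by rewrite f'e ?eE// inE; exact: DE.
  have /asboolP[/= DE' _] : le (exist _ _ gD') (exist _ (E, e) gE).
    by apply: emax; apply/asboolP; split.
  exact/Ex0/DE'.
Qed.

End HahnBanach.

(** * Simple functions *)

Section PowerInequalities.
Context {R : realType}.
Implicit Types (t a b c d : R).

Lemma young_powR t a b : 0 <= t <= 1 -> 0 <= a -> 0 <= b ->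
  a `^ t * b `^ (1 - t) <= t * a + (1 - t) * b.
Proof.
move=> /andP[t0 t1] a0 b0.
have [->|tn0] := eqVneq t 0.
  by rewrite subr0 powRr0 powRr1// !mul1r mul0r add0r.
have [->|tn1] := eqVneq t 1.
  by rewrite subrr powRr0 powRr1// mulr1 mul1r mul0r addr0.
have t0' : 0 < t by rewrite lt_neqAle eq_sym tn0.
have t1' : 0 < 1 - t by rewrite subr_gt0 lt_neqAle tn1.
have := @conjugate_powR _ (a `^ t) (b `^ (1 - t)) t^-1 (1 - t)^-1
  (powR_ge0 _ _) (powR_ge0 _ _).
rewrite !invr_gt0 !invrK => /(_ t0' t1'); rewrite addrC subrK => /(_ erefl).
by rewrite -!powRrM !mulfV ?gt_eqF// !powRr1// (mulrC a) (mulrC b).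
Qed.

(** Dividing by the totals [a + b] and [c + d] reduces each term to Young's inequality, and the
    resulting factors add up to 1. Zero totals are treated apart because [0 ^ 0 = 1]. *)
Lemma hoelder_two_terms t a b c d : 0 <= t <= 1 ->
  0 <= a -> 0 <= b -> 0 <= c -> 0 <= d ->
  a `^ t * c `^ (1 - t) + b `^ t * d `^ (1 - t) <= (a + b) `^ t * (c + d) `^ (1 - t).
Proof.
move=> t01 a0 b0 c0 d0; have /andP[t0 t1] := t01.
have [ab0|abN0] := eqVneq (a + b) 0.
  have [-> ->] : a = 0 /\ b = 0 by split; lra.
  have [->|tn0] := eqVneq t 0; last by rewrite addr0 powR0// !mul0r addr0.
  by rewrite subr0 !powRr0 !mul1r !powRr1// addr_ge0.
have [cd0|cdN0] := eqVneq (c + d) 0.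
  have [-> ->] : c = 0 /\ d = 0 by split; lra.
  have [->|tn0] := eqVneq t 1.
    by rewrite subrr !powRr0 !mulr1 !powRr1// addr_ge0.
  by rewrite addr0 powR0 ?subr_eq0 1?eq_sym// !mulr0 addr0.
have ab : 0 < a + b by rewrite lt_neqAle eq_sym abN0 addr_ge0.
have cd : 0 < c + d by rewrite lt_neqAle eq_sym cdN0 addr_ge0.
have scale x y : 0 <= x -> 0 <= y -> x `^ t * y `^ (1 - t) <=
    (a + b) `^ t * (c + d) `^ (1 - t) * (t * (x / (a + b)) + (1 - t) * (y / (c + d))).
  move=> x0 y0.
  rewrite -{1}(divfK abN0 x) -{1}(divfK cdN0 y).
  have [ab' cd'] := (ltW ab, ltW cd).
  rewrite (powRM _ (divr_ge0 x0 ab') ab') (powRM _ (divr_ge0 y0 cd') cd').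
  rewrite mulrACA [leLHS]mulrC ler_pM2l ?mulr_gt0 ?powR_gt0//.
  by rewrite young_powR// divr_ge0.
apply: le_trans (lerD (scale a c a0 c0) (scale b d b0 d0)) _.
rewrite -mulrDr ler_piMr ?mulr_ge0 ?powR_ge0//.
rewrite [leLHS](_ : _ = t * ((a + b) / (a + b)) + (1 - t) * ((c + d) / (c + d))); last by ring.
by rewrite !divff// !mulr1 addrC subrK.
Qed.

End PowerInequalities.

Section SimpleFunctions.
Context {d} {T : measurableType d} {R : realType} (mu : {measure set T -> \bar R}).

Lemma measurable_cst_set (P : Prop) : measurable [set _ : T | P].
Proof.
have [p|p] := pselect P; first by rewrite (_ : mkset _ = setT)//; apply/seteqP; split.
by rewrite (_ : mkset _ = set0)//; apply/seteqP; split.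
Qed.

Definition fin_set (B : set T) : Prop := measurable B /\ (mu B < +oo)%E.

Lemma fin_set0 : fin_set set0. Proof. by split => //; rewrite measure0. Qed.

Lemma sub_fin_set A B : measurable A -> A `<=` B -> fin_set B -> fin_set A.
Proof.
move=> mA AB [mB Boo]; split => //; apply: le_lt_trans Boo.
by apply: le_measure => //; rewrite inE.
Qed.

Lemma fin_setU A B : fin_set A -> fin_set B -> fin_set (A `|` B).
Proof.
move=> [mA Aoo] [mB Boo]; split; first exact: measurableU.
by apply: le_lt_trans (measureU2 _ _ _) _ => //; rewrite lte_add_pinfty.
Qed.

Lemma fin_setIl A B : fin_set A -> measurable B -> fin_set (A `&` B).
Proof.
move=> fA mB; apply: sub_fin_set (fA); last exact: subIsetl.
by apply: measurableI => //; case: fA.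
Qed.

(** The values lie in a group without any sigma-algebra, so measurability is required of the level
    sets. The finite measure of the support makes pairings with L_p integrable. *)
Definition simple (V : zmodType) (v : T -> V) : Prop :=
  [/\ finite_set (range v), forall z, measurable (v @^-1` [set z])
    & fin_set (v @^-1` [set~ 0])].

Definition elem (V : zmodType) (B : set T) (z : V) : T -> V :=
  fun w => if w \in B then z else 0.

Lemma simple_map2 (V1 V2 V : zmodType) (phi : V1 -> V2 -> V) v1 v2 :
  phi 0 0 = 0 -> simple v1 -> simple v2 -> simple (fun w => phi (v1 w) (v2 w)).
Proof.
move=> phi0 s1 s2; have [f1 m1 o1] := s1; have [f2 m2 o2] := s2.
have mz (Y : set V) : measurable ((fun w => phi (v1 w) (v2 w)) @^-1` Y).
  rewrite (_ : _ @^-1` _ = \bigcup_(z in range v1) \bigcup_(z' in range v2 `&` [set z' | Y (phi z z')])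
      (v1 @^-1` [set z] `&` v2 @^-1` [set z'])).
    apply: fin_bigcup_measurable => // z _.
    apply: fin_bigcup_measurable => [|z' _]; first exact: finite_setIl.
    exact: measurableI.
  apply/seteqP; split => [w /= Yw|w [z _ [z' [_ /= Yz] [/= -> ->]]]//].
  by exists (v1 w); [exists w|exists (v2 w) => //; split => //; exists w].
split.
- apply: sub_finite_set (finite_image2 phi f1 f2).
  by move=> _ [w _ <-]; exists (v1 w); [exists w|exists (v2 w) => //; exists w].
- by move=> z; exact: mz.
apply: sub_fin_set (fin_setU o1 o2); first exact: mz.
move=> w /= hw; have [v10|] := eqVneq (v1 w) 0; last by move=> /eqP; left.
by right => /= v20; apply: hw; rewrite v10 v20 phi0.
Qed.

Lemma simple0 (V : zmodType) : simple (fun=> 0 : V).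
Proof.
split.
- by apply: sub_finite_set (finite_set1 0) => _ [w _ <-].
- by move=> z; exact: measurable_cst_set.
- suff -> : (fun _ : T => 0 : V) @^-1` [set~ 0] = set0 by exact: fin_set0.
  by apply/seteqP; split => w //=.
Qed.

Lemma simple_map (V1 V : zmodType) (phi : V1 -> V) v :
  phi 0 = 0 -> simple v -> simple (fun w => phi (v w)).
Proof. by move=> phi0 sv; apply: (simple_map2 (phi := fun x _ => phi x) phi0 sv sv). Qed.

Lemma simpleD (V : zmodType) (v w : T -> V) : simple v -> simple w -> simple (v + w).
Proof. by move=> sv sw; apply: (simple_map2 (phi := +%R)) => //; rewrite addr0. Qed.

Lemma simple_elem (V : zmodType) (B : set T) (z : V) : fin_set B -> simple (elem B z).
Proof.
move=> fB; have [mB Boo] := fB; rewrite /elem.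
have mpre (Y : set V) : measurable ((elem B z) @^-1` Y).
  rewrite (_ : _ @^-1` Y = (B `&` [set _ | Y z]) `|` (~` B `&` [set _ | Y 0])).
    by apply: measurableU; apply: measurableI => //;
      [exact: measurable_cst_set|exact: measurableC|exact: measurable_cst_set].
  apply/seteqP; split => w; rewrite /= /elem.
    by case: ifPn => [/set_mem|/negP Bw]; [left|right; split => //= Bw'; apply: Bw; rewrite inE].
  by move=> [[Bw]|[Bw]] h; [rewrite mem_set|rewrite memNset].
split.
- apply: sub_finite_set (finite_set2 z 0) => _ [w _ <-] /=.
  by case: ifP; [left|right].
- by move=> y; exact: mpre.
apply: sub_fin_set fB; first exact: mpre.
by move=> w /=; case: ifPn => // /set_mem.
Qed.

Lemma simple_ind (V : zmodType) (P : (T -> V) -> Prop) :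
  P 0 -> (forall v w, simple v -> simple w -> P v -> P w -> P (v + w)) ->
  (forall B z, fin_set B -> P (elem B z)) ->
  forall v, simple v -> P v.
Proof.
move=> P0 PD Pe v sv; have [/finite_seqP[s vs] _ _] := sv.
have {vs} : forall w, v w != 0 -> v w \in s.
  move=> w _; have : range v (v w) by exists w.
  by rewrite vs.
elim: s v sv => [|z s IH] v sv vs.
  rewrite (_ : v = 0)//; apply/funext => w.
  by apply/eqP; apply: contrapT => /negP /vs.
have [z0|z0] := eqVneq z 0.
  apply: IH => // w vw; have := vs _ vw; rewrite inE z0.
  by rewrite (negbTE vw).
have [_ mv fv] := sv.
have fB : fin_set (v @^-1` [set z]).
  apply: sub_fin_set fv => // w /= ->; exact/eqP.
(* One value is erased at a time; the induction runs over a list containing all nonzero values. *)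
pose v' w := if v w == z then 0 else v w.
have sv' : simple v' by apply: (simple_map (phi := fun x => if x == z then 0 else x)) => //; case: ifP.
rewrite (_ : v = elem (v @^-1` [set z]) z + v').
  apply: PD => //; [exact: simple_elem|exact: Pe|].
  apply: IH => // w; rewrite /v'; case: ifPn; rewrite ?eqxx// => vwz /vs.
  by rewrite inE (negbTE vwz).
apply/funext => w; rewrite /GRing.add/= /elem /v'.
have [vwz|vwz] := eqVneq (v w) z; first by rewrite mem_set ?addr0.
by rewrite memNset ?add0r//=; exact/eqP.
Qed.

End SimpleFunctions.

(** * L_p norms and weights *)

Section LpNorm.
Context {d} {T : measurableType d} {R : realType} {k : scalar_kind}.
Variables (mu : {measure set T -> \bar R}) (p : \bar R) (p1 : (1 <= p)%E).
Local Notation K := (Defs.scalar R k).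

(* [1 / p], with value [0] at [p = +oo]; the weight below is then irrelevant
   since [0 `^ 0 = 1] *)
Definition theta (p : \bar R) : R := if p is r%:E then r^-1 else 0.

Lemma theta_itv : 0 <= theta p <= 1.
Proof using p1.
move: p1; case: p => [r| |] //=; last by move=> _; rewrite lexx ler01.
by rewrite lee_fin => r1; rewrite invr_ge0 invf_le1 ?(lt_le_trans ltr01)// (le_trans ler01).
Qed.

Definition weight (F : T -> R) : Prop :=
  (forall w, 0 <= F w) /\ mu.-integrable [set: T] (EFin \o F).

Lemma measurable_weight F : weight F -> measurable_fun [set: T] F.
Proof. by move=> [_ /measurable_int /measurable_EFinP]. Qed.

Lemma measurable_weight_powR F t : weight F -> measurable_fun [set: T] (fun w => F w `^ t).
Proof.
by move=> wF; apply: (measurableT_comp (measurable_powR t)) => //; exact: measurable_weight.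
Qed.

Lemma weight_int F : weight F -> ((\int[mu]_w F w)%:E = \int[mu]_w (F w)%:E)%E.
Proof. by move=> [F0 iF]; rewrite fineK//; exact: integrable_fin_num. Qed.

Lemma weight0 : weight (fun=> 0).
Proof. by split => //; exact: integrable0. Qed.

Lemma weightD (F1 F2 : T -> R) : weight F1 -> weight F2 -> weight (F1 \+ F2).
Proof.
move=> [F10 i1] [F20 i2]; split=> [w|]; first exact: addr_ge0.
by rewrite (_ : EFin \o _ = (EFin \o F1) \+ (EFin \o F2))%E//; exact: integrableD.
Qed.

Lemma weightZ (c : R) (F : T -> R) : 0 <= c -> weight F -> weight (fun w => c * F w).
Proof.
move=> c0 [F0 iF]; split=> [w|]; first exact: mulr_ge0.
by rewrite (_ : EFin \o _ = (fun w => c%:E * (F w)%:E))%E//; exact: integrableZl.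
Qed.

Definition family_le (f : piece mu p -> T -> K) (F : T -> R) (c : R) : Prop :=
  forall A : piece mu p, {ae mu, forall w, sval A w -> modulus (f A w) <= c * F w `^ theta p}.

(** For finite [p] the weight is [(|f| / c) ^ p]. For infinite [p] the power of any weight is the
    constant 1, and the right side says that |f| is at most [c] a.e. on every piece. *)
Lemma eLpnorm_leP (f : piece mu p -> T -> K) (c : R) : 0 < c -> piecewise_measurable f ->
  (eLpnorm f <= c%:E)%E <->
  exists F, [/\ weight F, \int[mu]_w F w <= 1 & family_le f F c].
Proof using p1.
move=> c0 mf; rewrite /family_le /theta; have [A0] := piece_inhabited mu p.
case: p p1 f mf A0 => [r||]// + f mf A.
- rewrite lee_fin => r1.
  have r0 : 0 < r by exact: lt_le_trans r1.
  have cr0 : 0 < c `^ r by rewrite powR_gt0.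
  have At : sval A = [set: T] by case: (A).
  have mh : measurable_fun [set: T] (@modulus R k \o f A).
    by rewrite -At; exact: measurable_modulus.
  pose h := @modulus R k \o f A.
  have mhr : measurable_fun [set: T] (fun w => h w `^ r).
    by apply: (measurableT_comp (measurable_powR r)).
  rewrite (eLpnorm_fin_exp A).
  have NE : ('N[mu]_r%:E[EFin \o h] `^ r = \int[mu]_w (h w `^ r)%:E)%E.
    rewrite powR_Lnorm ?gt_eqF//; apply: eq_integral => w _ /=.
    by rewrite ger0_norm// modulus_ge0.
  split => [Nc|[F [wF F1 fF]]].
    have hr1 : (\int[mu]_w (h w `^ r)%:E <= (c `^ r)%:E)%E.
      rewrite -NE -poweR_EFin; by apply: gt0_ler_poweR => //;
        rewrite ?in_itv/= ?leey ?andbT ?Lnorm_ge0 ?lee_fin ?(ltW c0) ?(ltW r0).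
    pose F w := (c `^ r)^-1 * h w `^ r.
    have F0 w : 0 <= F w by rewrite mulr_ge0 ?invr_ge0 ?powR_ge0.
    have intF : (\int[mu]_w (F w)%:E <= 1)%E.
      under eq_integral do rewrite EFinM.
      rewrite ge0_integralZl ?lee_fin ?invr_ge0 ?powR_ge0//; last 2 first.
      - exact/measurable_EFinP.
      - by move=> w _; rewrite lee_fin powR_ge0.
      rewrite -[leRHS](_ : ((c `^ r)^-1)%:E * (c `^ r)%:E = 1)%E; last first.
        by rewrite -EFinM mulVf ?gt_eqF.
      by rewrite lee_wpmul2l// lee_fin invr_ge0 powR_ge0.
    have wF : weight F.
      split => //; apply/integrableP; split.
        by apply/measurable_EFinP; exact: measurable_funM.
      under eq_integral do rewrite gee0_abs ?lee_fin//.
      by apply: le_lt_trans intF _; rewrite ltry.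
    exists F; split => //; first by rewrite -lee_fin weight_int.
    move=> B; apply: nearW => w _.
    have -> : B = A by case: (A) (B) => [X hX] [Y hY]; apply: eq_exist; rewrite hX hY.
    rewrite /F powRM ?invr_ge0 ?powR_ge0//.
    rewrite -powRN -!powRrM mulNr mulfV ?gt_eqF// powRr1 ?modulus_ge0//.
    by rewrite powR_inv1 ?(ltW c0)// mulrA mulfV ?gt_eqF// mul1r.
  have F0 := wF.1.
  have mcF : measurable_fun [set: T] (fun w => c * F w `^ r^-1).
    by apply: measurable_funM => //; exact: measurable_weight_powR.
  apply: (@le_trans _ _ ('N[mu]_r%:E[EFin \o (fun w => c * F w `^ r^-1)%R])%E).
    apply: le_Lnorm => //; apply: filterS (fF A) => w.
    rewrite At => /(_ I) hw; rewrite !ger0_norm ?modulus_ge0//.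
    by rewrite mulr_ge0 ?powR_ge0// ltW.
  have poweRK (x : \bar R) : (0 <= x -> (x `^ r) `^ r^-1 = x)%E.
    by move=> x0; rewrite -poweRrM mulfV ?gt_eqF// poweRe1.
  rewrite -[leLHS]poweRK ?Lnorm_ge0// -[leRHS]poweRK ?lee_fin ?(ltW c0)//.
  apply: gt0_ler_poweR; rewrite ?in_itv/= ?leey ?andbT ?poweR_ge0 ?lee_fin ?powR_ge0 ?invr_ge0 ?(ltW r0)//.
  rewrite powR_Lnorm ?gt_eqF//.
  under eq_integral do rewrite /= ger0_norm ?mulr_ge0 ?powR_ge0 ?(ltW c0)//.
  under eq_integral => w _ do rewrite powRM ?powR_ge0 ?(ltW c0)// -powRrM mulVf ?gt_eqF// powRr1// EFinM.
  rewrite ge0_integralZl ?lee_fin ?powR_ge0//; last 2 first.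
  - by apply/measurable_EFinP; exact: measurable_weight.
  - by move=> w _; rewrite lee_fin.
  by rewrite -weight_int// -EFinM lee_fin ler_piMr ?powR_ge0.
- move=> _; split => [fc|[F [_ _ fF]]].
    exists (fun=> 0); split; first exact: weight0.
      by rewrite /Rintegral integral0.
    move=> B.
    have {}fc : ('N[mu]_+oo[EFin \o Defs.cut B f] <= c%:E)%E.
      by apply: le_trans fc; apply: ereal_sup_ubound; exists B.
    move: fc; rewrite unlock /Lnorm; case: ifPn => [_ /ess_supP|].
      apply: filterS => w /= + Bw.
      rewrite /Defs.cut /patch mem_set// lee_fin powRr0 mulr1; apply: le_trans.
      by rewrite ler_norm.
    (* Here [mu] is the zero measure: the norm is 0 by convention and every property holds almost
       everywhere. *)
    rewrite -leNgt => muT _; exists [set: T]; split => //.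
    by apply/eqP; rewrite eq_le muT/=.
  apply: ge_ereal_sup => _ [B _ <-].
  rewrite unlock /Lnorm; case: ifPn => [_|_]; last by rewrite lee_fin ltW.
  apply/ess_supP; apply: filterS (fF B) => w hw; rewrite /= lee_fin.
  rewrite ger0_norm ?cut_ge0// /Defs.cut /patch; case: ifPn => [/set_mem /hw|_]; last exact: ltW.
  by rewrite powRr0 mulr1.
Qed.

End LpNorm.

Section Representatives.
Context {d} {T : measurableType d} {R : realType} {k : scalar_kind}.
Context {mu : {measure set T -> \bar R}} {p : \bar R} {p1 : (1 <= p)%E}.
Local Notation K := (Defs.scalar R k).
Local Notation E := (Lp k mu p1).

Definition rep (x : E) (A : piece mu p) : T -> K := (repr x : Lpfun k mu p1) A.

Lemma rep_pi (f : Lpfun k mu p1) A :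
  {ae mu, forall w, sval A w -> rep (\pi_E f)%qT A w = f A w}.
Proof. exact: Lp_reprE. Qed.

Lemma rep_lin (a : K) (x y : E) A :
  {ae mu, forall w, sval A w -> rep (a *: x + y) A w = a * rep x A w + rep y A w}.
Proof.
have -> : a *: x + y = (\pi_E (a *: repr x + repr y))%qT.
  by rewrite Defs.pi_add Defs.pi_scale !reprK.
exact: rep_pi.
Qed.

Lemma rep0 A : {ae mu, forall w, sval A w -> rep 0 A w = 0}.
Proof.
apply: filterS (rep_lin 1 0 0 A) => w hw /hw; rewrite scaler0 addr0 mul1r.
by move/eqP; rewrite -subr_eq0 opprD addrA subrr sub0r oppr_eq0 => /eqP.
Qed.

Lemma repZ (a : K) (x : E) A :
  {ae mu, forall w, sval A w -> rep (a *: x) A w = a * rep x A w}.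
Proof.
apply: filterS2 (rep_lin a x 0 A) (rep0 A) => w h1 h2 Aw.
by have := h1 Aw; rewrite addr0 h2// addr0.
Qed.

Lemma rep_measurable (x : E) : piecewise_measurable (rep x).
Proof. by have [] := LpfunP (repr x). Qed.

Lemma rep_consistent (x : E) A B :
  {ae mu, forall w, sval A w -> sval B w -> rep x A w = rep x B w}.
Proof. by have [] := LpfunP (repr x). Qed.

Lemma rep_eq (x y : E) :
  (forall A, {ae mu, forall w, sval A w -> rep x A w = rep y A w}) -> x = y.
Proof.
by move=> xy; rewrite -[x]reprK -[y]reprK; apply/eqP/Lp_eqP.
Qed.

Lemma Lpnorm_leP (x : E) (c : R) : 0 < c ->
  Lpnorm x <= c <->
  exists F, [/\ weight mu F, \int[mu]_w F w <= 1 & family_le (rep x) F c].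
Proof.
move=> c0; rewrite -lee_fin eLpnorm_fin.
by apply: eLpnorm_leP => //; exact: rep_measurable.
Qed.

Lemma Lpnorm1_gt0 (x : E) : 0 < Lpnorm x + 1.
Proof. by rewrite ltr_wpDl// Lpnorm_ge0. Qed.

Lemma Lp_unit_weight (x : E) : exists F,
  [/\ weight mu F, \int[mu]_w F w <= 1 & family_le (rep x) F (Lpnorm x + 1)].
Proof. by apply/Lpnorm_leP; [exact: Lpnorm1_gt0|rewrite lerDl]. Qed.

End Representatives.

Section SupNorm.
Context {d} {T : measurableType d} {R : realType} {k : scalar_kind}.
Context {mu : {measure set T -> \bar R}} {p : \bar R} {p1 : (1 <= p)%E}.

Definition sup_abs m (x : 'I_m -> Lp k mu p1) : Lp RealScalars mu p1 :=
  \big[@Lp_max _ _ _ mu _ p1 / 0]_(i < m) Lp_abs (x i).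

Lemma rep_sup_abs m (x : 'I_m -> Lp k mu p1) A :
  {ae mu, forall w, sval A w ->
     rep (sup_abs x) A w = \big[Order.max/0]_(i < m) modulus (rep (x i) A w) :> R}.
Proof.
rewrite /sup_abs.
elim: (index_enum _) => [|i r IH].
  by apply: filterS (rep0 (k := RealScalars) A) => w h Aw; rewrite !big_nil h.
apply: filterS3 IH (rep_pi (MkLpfun (abs_famP (repr (x i)))) A)
  (rep_pi (MkLpfun (max_famP (repr (Lp_abs (x i))) (repr (\big[@Lp_max _ _ _ mu _ p1 / 0]_(j <- r) Lp_abs (x j))))) A).
move=> w h1 h2 h3 Aw.
rewrite !big_cons -(h1 Aw); apply: etrans (h3 Aw) _ => /=; rewrite /max_fam.
congr (Order.max _ _); exact: h2.
Qed.

(** The lattice supremum is traded for a weight shared by all [x i]; this is the form in which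
    regularity is used and proved. *)
Lemma sup_abs_leP m (x : 'I_m -> Lp k mu p1) (c : R) : 0 < c ->
  Lpnorm (sup_abs x) <= c <->
  exists F, [/\ weight mu F, \int[mu]_w F w <= 1
              & forall i, family_le (rep (x i)) F c].
Proof.
move=> c0; split=> [/Lpnorm_leP-/(_ c0)[F [wF F1 hF]]|[F [wF F1 hF]]].
  exists F; split => // i A; apply: filterS2 (hF A) (rep_sup_abs x A) => w h1 h2 Aw.
  apply: le_trans (h1 Aw); rewrite modulus_real; apply: le_trans (ler_norm _).
  by rewrite h2//; exact: le_bigmax.
apply/Lpnorm_leP => //; exists F; split => // A.
have : {ae mu, forall w, forall i, sval A w -> modulus (rep (x i) A w) <= c * F w `^ theta p}.
  by apply: filter_forall => i; exact: (hF i A).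
apply: filterS2 (rep_sup_abs x A) => w h2 h1 Aw.
have cF : 0 <= c * F w `^ theta p by rewrite mulr_ge0 ?powR_ge0// ltW.
rewrite modulus_real h2// ger0_norm; last first.
  by apply: bigmax_ge_id.
by apply/bigmax_leP; split => // i _; exact: h1.
Qed.

End SupNorm.

(** * The sublinear functional *)

Section Gauge.
Context {d d'} {T : measurableType d} {T' : measurableType d'} {R : realType} {k : scalar_kind}.
Context {mu : {measure set T -> \bar R}} {mu' : {measure set T' -> \bar R}}.
Context {p : \bar R} {p1 : (1 <= p)%E}.
Local Notation K := (Defs.scalar R k).
Local Notation E := (Lp k mu p1).
Local Notation th := (theta p).

Lemma dom_lin (x y : E) (a b : K) (F1 F2 F : T -> R) (c1 c2 c : R) :
  family_le (rep x) F1 c1 -> family_le (rep y) F2 c2 ->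
  (forall w, modulus a * (c1 * F1 w `^ th) + modulus b * (c2 * F2 w `^ th) <= c * F w `^ th) ->
  family_le (rep (a *: x + b *: y)) F c.
Proof.
move=> hx hy hF A.
apply: filterS2 (filterI (rep_lin a x (b *: y) A) (repZ b y A)) (filterI (hx A) (hy A)).
move=> w [h1 h2] [h3 h4] Aw; rewrite h1// h2//.
apply: le_trans (hF w); apply: le_trans (modulusD _ _) _.
by rewrite !modulusM lerD// ler_wpM2l ?modulus_ge0// ?h3 ?h4.
Qed.

Lemma dom_scale (x : E) (a : K) (F1 F : T -> R) (c1 c : R) :
  family_le (rep x) F1 c1 ->
  (forall w, modulus a * (c1 * F1 w `^ th) <= c * F w `^ th) ->
  family_le (rep (a *: x)) F c.
Proof.
move=> hx hF; rewrite -[_ *: _]addr0 -(scale0r x); apply: (dom_lin hx hx) => w.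
by rewrite modulus0 mul0r addr0.
Qed.

(** [F] does not depend on the point [w']: it dominates all values of [v] simultaneously, just as a
    finite supremum does in the definition of regularity, while [G] records their individual
    sizes. *)
Definition gauge (v : T' -> E) (s : R) : Prop := exists F G,
  [/\ weight mu F, weight mu' G,
      {ae mu', forall w', family_le (rep (v w')) F (G w' `^ (1 - th))}
    & th * (\int[mu]_w F w) + (1 - th) * (\int[mu']_w' G w') <= s].

Lemma gaugeD v w s t : gauge v s -> gauge w t -> gauge (v + w) (s + t).
Proof.
move=> [F1 [G1 [wF1 wG1 h1 s1]]] [F2 [G2 [wF2 wG2 h2 s2]]].
exists (F1 \+ F2), (G1 \+ G2); split; [exact: weightD|exact: weightD|..].
- apply: filterS2 h1 h2 => w' h1 h2.
  rewrite (_ : (v + w) w' = 1 *: v w' + 1 *: w w'); last by rewrite !scale1r.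
  apply: dom_lin h1 h2 _ => x.
  have -> : modulus (1 : K) = 1 by rewrite -of_real1 modulus_of_real normr1.
  rewrite !mul1r [G1 _ `^ _ * _]mulrC [G2 _ `^ _ * _]mulrC [_ `^ (1 - th) * _]mulrC.
  by apply: hoelder_two_terms; [exact: theta_itv|exact: wF1.1|exact: wF2.1|exact: wG1.1|exact: wG2.1].
- rewrite RintegralD//; [|by case: wF1|by case: wF2].
  rewrite RintegralD//; [|by case: wG1|by case: wG2].
  by apply: le_trans (lerD s1 s2); rewrite le_eqVlt; apply/orP; left; apply/eqP; ring.
Qed.

Lemma powR_theta_homog (c f g : R) : 0 < c -> 0 <= f -> 0 <= g ->
  (c * g) `^ (1 - th) * (c * f) `^ th = c * (g `^ (1 - th) * f `^ th).
Proof.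
move=> c0 f0 g0; have c0' := ltW c0; rewrite !powRM// mulrACA; congr (_ * _).
by rewrite -powRD ?subrK ?powRr1//; apply/implyP => _; rewrite gt_eqF.
Qed.

Lemma gaugeZ (a : R) v s : 0 < a -> gauge v s -> gauge (of_real k a *: v) (a * s).
Proof.
move=> a0 [F [G [wF wG h hs]]].
have wG' : weight mu' (fun w => a * G w) by apply: weightZ wG; exact: ltW.
exists (fun w => a * F w), (fun w => a * G w); split => //.
- by apply: weightZ => //; exact: ltW.
- apply: filterS h => w' h.
  apply: dom_scale h _ => w; rewrite modulus_of_real gtr0_norm//.
  by rewrite powR_theta_homog ?wF.1 ?wG.1.
- rewrite RintegralZl//; last by case: wF.
  rewrite RintegralZl//; last by case: wG.
  by rewrite !(mulrCA _ a) -mulrDr ler_pM2l.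
Qed.

(** The same two weights serve. This covers changes of sign and restrictions of [v] to a set. *)
Lemma gauge_shrink (v w : T' -> E) s : gauge v s ->
  (forall w', exists2 a : K, modulus a <= 1 & w w' = a *: v w') -> gauge w s.
Proof.
move=> [F [G [wF wG h hs]]] hw; exists F, G; split => //.
apply: filterS h => w' h; have [a a1 ->] := hw w'.
apply: dom_scale h _ => x; rewrite ler_piMl ?mulr_ge0 ?powR_ge0//.
Qed.

(** The exponents [th] and [1 - th] add up to 1, so the constant [c] can be absorbed by multiplying
    both weights by it. *)
Lemma gauge_test (v : T' -> E) F G (c : R) : 0 < c ->
  weight mu F -> \int[mu]_w F w <= 1 -> weight mu' G ->
  (forall w', family_le (rep (v w')) F (c * G w' `^ (1 - th))) ->
  gauge v (c * (th + (1 - th) * \int[mu']_w' G w')).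
Proof.
move=> c0 wF F1 wG h.
have /andP[t0 t1] := theta_itv p1.
have wG' : weight mu' (fun w => c * G w) by apply: weightZ wG; exact: ltW.
exists (fun w => c * F w), (fun w => c * G w); split => //.
- by apply: weightZ => //; exact: ltW.
- apply: nearW => w' A; apply: filterS (h w' A) => w {}h Aw.
  by rewrite powR_theta_homog ?wF.1 ?wG.1// mulrA h.
- rewrite RintegralZl//; last by case: wF.
  rewrite RintegralZl//; last by case: wG.
  by rewrite !(mulrCA _ c) -mulrDr ler_pM2l// lerD2r ler_piMr.
Qed.

End Gauge.

(** * Pairings of simple functions with L_p *)

Section SimpleFamilies.
Context {d} {T : measurableType d} {R : realType} (mu : {measure set T -> \bar R}).
Context {V : zmodType}.

Lemma ae_all_seq (I : eqType) (s : seq I) (Q : I -> T -> Prop) :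
  (forall i, i \in s -> {ae mu, forall w, Q i w}) ->
  {ae mu, forall w, forall i, i \in s -> Q i w}.
Proof.
elim: s => [|i s IH] hs; first exact: nearW.
have hi := hs i (mem_head _ _).
have ht : {ae mu, forall w, forall j, j \in s -> Q j w}.
  by apply: IH => j js; apply: hs; rewrite inE js orbT.
by apply: filterS2 hi ht => w h1 h2 j; rewrite inE => /predU1P[->//|]; exact: h2.
Qed.

(** The range is finite, so the exceptional null sets, one for each value, can be united. *)
Lemma simple_ae (v : T -> V) (P : V -> T -> Prop) : simple mu v ->
  (forall z, range v z -> {ae mu, forall w, P z w}) -> {ae mu, forall w, P (v w) w}.
Proof.
move=> [fv _ _] hP.
suff : {ae mu, forall w, forall z, range v z -> P z w}.
  by apply: filterS => w; apply; exists w.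
have [s sE] : exists s : seq V, range v = [set` s] by exact/finite_seqP.
have {hP} : forall z, z \in s -> {ae mu, forall w, P z w} by move=> z zs; apply: hP; rewrite sE.
by move=> hs; rewrite sE; exact: ae_all_seq.
Qed.

Lemma simple_family_measurable (v : T -> V) (f : V -> T -> R) : simple mu v ->
  (forall z, measurable_fun [set: T] (f z)) -> measurable_fun [set: T] (fun w => f (v w) w).
Proof.
move=> [fv mv _] mf _ Y mY; rewrite setTI.
rewrite (_ : _ @^-1` Y = \bigcup_(z in range v) (v @^-1` [set z] `&` f z @^-1` Y)).
  apply: fin_bigcup_measurable => // z _; apply: measurableI => //.
  by rewrite -[X in measurable X]setTI; exact: mf.
apply/seteqP; split => [w Yw|w [z _ [/= <-]]//].
by exists (v w) => //; exists w.
Qed.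

Lemma simple_family_integrable (v : T -> V) (f : V -> T -> R) : simple mu v ->
  (forall z, mu.-integrable [set: T] (EFin \o f z)) ->
  mu.-integrable [set: T] (EFin \o (fun w => f (v w) w)).
Proof.
move=> sv mf; have [fv mv _] := sv.
have [s sE] : exists s : seq V, range v = [set` s] by exact/finite_seqP.
apply: (@le_integrable _ _ _ _ _ _ _ (fun w => \sum_(z <- s) `|(f z w)%:E|)%E) => //.
- apply/measurable_EFinP; apply: simple_family_measurable => // z.
  by apply/measurable_EFinP; exact: measurable_int (mf z).
- move=> w _ /=; rewrite [leRHS]gee0_abs; last by apply: sume_ge0.
  have vs : v w \in s by have : range v (v w) by [exists w]; rewrite sE.
  by rewrite (perm_big _ (perm_to_rem vs))/= big_cons leeDl// sume_ge0.
- by apply: integrable_sum => [|z _]; [exact: measurableT|exact: (integrable_abse (mf z))].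
Qed.

Definition support_of (v : T -> V) : set T := v @^-1` [set~ 0].

Lemma elem_support B (z : V) : support_of (elem B z) `<=` B.
Proof. by move=> w; rewrite /support_of/= /elem; case: ifPn => // /set_mem. Qed.

End SimpleFamilies.

Section Pairing.
Context {d} {T : measurableType d} {R : realType} {k : scalar_kind}.
Context {mu : {measure set T -> \bar R}} {p : \bar R} {p1 : (1 <= p)%E}.
Local Notation K := (Defs.scalar R k).
Local Notation F := (Lp k mu p1).

Lemma piece_cover B : fin_set mu B -> exists A : piece mu p, B `<=` sval A.
Proof.
move=> [mB Boo]; have := p1; rewrite /piece /piece_pred; case: p => [r| |]// _.
  by exists (exist (fun A => A = [set: T]) _ erefl).
by exists (exist (fun A => measurable A /\ (mu A < +oo)%E) B (conj mB Boo)).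
Qed.

(** A total function representing [y] on a set of finite measure, for all [p] at once. Another
    choice of the covering piece changes it only on a null set, because representatives are
    consistent. *)
Definition rep_on (y : F) (B : set T) : T -> K :=
  match pselect (exists A : piece mu p, B `<=` sval A) with
  | left h => fun w => if w \in B then rep y (projT1 (cid h)) w else 0
  | right _ => fun=> 0
  end.

Lemma rep_onE (y : F) B (A : piece mu p) : B `<=` sval A ->
  {ae mu, forall w, rep_on y B w = if w \in B then rep y A w else 0}.
Proof.
move=> BA; rewrite /rep_on; case: pselect => [h|[]]; last by exists A.
case: cid => A' BA' /=; apply: filterS (rep_consistent y A A') => w hw.
by case: ifPn => // /set_mem Bw; rewrite hw//; [exact: BA|exact: BA'].
Qed.

Lemma rep_on_out (y : F) B w : ~ B w -> rep_on y B w = 0.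
Proof. by move=> Bw; rewrite /rep_on; case: pselect => // h; rewrite memNset. Qed.

Lemma rep_on_lin (a : K) (x y : F) B : fin_set mu B ->
  {ae mu, forall w, rep_on (a *: x + y) B w = a * rep_on x B w + rep_on y B w}.
Proof.
move=> /piece_cover[A BA].
apply: filterS2 (filterI (rep_onE (a *: x + y) BA) (rep_onE x BA))
  (filterI (rep_onE y BA) (rep_lin a x y A)) => w [-> ->] [-> h].
by case: ifPn => [/set_mem Bw|_]; [rewrite h//; exact: BA|rewrite mulr0 addr0].
Qed.

Lemma rep_on_sub (y : F) B B' : B `<=` B' -> fin_set mu B' ->
  {ae mu, forall w, B w -> rep_on y B w = rep_on y B' w}.
Proof.
move=> BB' /piece_cover[A BA].
apply: filterS2 (rep_onE y (subset_trans BB' BA)) (rep_onE y BA) => w -> -> Bw.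
by rewrite !mem_set//; exact: BB'.
Qed.

Lemma rep_on_measurable (y : F) B : fin_set mu B ->
  measurable_fun [set: T] (@re_part R k \o rep_on y B) /\
  measurable_fun [set: T] (@im_part R k \o rep_on y B).
Proof.
move=> fB; have [mB _] := fB; rewrite /rep_on; case: pselect => [h|_]; last first.
  split.
    by rewrite (_ : _ \o _ = cst (re_part (0 : K)))//; exact: measurable_cst.
  by rewrite (_ : _ \o _ = cst (im_part (0 : K)))//; exact: measurable_cst.
case: cid => A BA /=; have [mre mim] := rep_measurable y A.
have aux (g : K -> R) : g 0 = 0 -> measurable_fun (sval A) (g \o rep y A) ->
    measurable_fun [set: T] (g \o (fun w => if w \in B then rep y A w else 0)).
  move=> g0 mg; rewrite (_ : _ \o _ = (g \o rep y A) \_ B); last first.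
    by apply/funext => w; rewrite /patch /=; case: ifP.
  apply/(measurable_restrictT _ mB); apply: measurable_funS mg => //.
  exact: measurable_piece.
by split; apply: aux => //; [exact: re_part0|exact: im_part0].
Qed.

Lemma rep_on_family_le (y : F) B W c : fin_set mu B -> family_le (rep y) W c -> 0 <= c ->
  {ae mu, forall w, modulus (rep_on y B w) <= c * W w `^ theta p}.
Proof.
move=> /piece_cover[A BA] h c0; apply: filterS2 (rep_onE y BA) (h A) => w -> hw.
case: ifPn => [/set_mem/BA/hw//|_].
by rewrite modulus0 mulr_ge0 ?powR_ge0.
Qed.

(** On [B], Young's inequality with second factor 1 bounds [W ^ th] by [W + 1], and both [W] and the
    indicator of [B] are integrable. *)
Lemma rep_on_integrable (y : F) B : fin_set mu B ->
  mu.-integrable [set: T] (EFin \o (@re_part R k \o rep_on y B)).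
Proof.
move=> fB; have [mB Boo] := fB; have [mre _] := rep_on_measurable y fB.
have [W [wW _ hW]] := Lp_unit_weight y.
have c0 : 0 <= Lpnorm y + 1 by rewrite addr_ge0// Lpnorm_ge0.
pose g w := (Lpnorm y + 1) * (W w + \1_B w).
have ig : mu.-integrable [set: T] (EFin \o g).
  rewrite (_ : EFin \o _ = (fun w => (Lpnorm y + 1)%:E * ((EFin \o W) \+ (EFin \o \1_B)) w))%E//.
  apply: integrableZl => //; apply: integrableD => //; first by case: wW.
  apply/integrableP; split; first exact/measurable_EFinP.
  under eq_integral do rewrite /= ger0_norm//.
  by rewrite integral_indic// setIT.
have mg : measurable_fun [set: T] g by apply/measurable_EFinP; exact: measurable_int ig.
apply/integrableP; split; first exact/measurable_EFinP.
have /andP[t0 t1] := theta_itv p1.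
have /integrableP[_] := ig; apply: le_lt_trans.
apply: ae_ge0_le_integral => //.
- by do 2 apply: measurableT_comp => //.
- by do 2 apply: measurableT_comp => //.
apply: filterS (rep_on_family_le fB hW c0) => w hw _; rewrite /= lee_fin.
apply: le_trans (re_part_le _) _; apply: le_trans (ler_norm _).
have [Bw|Bw] := boolP (w \in B); last first.
  rewrite rep_on_out; last by move=> Bw'; move: Bw; rewrite mem_set.
  by rewrite modulus0 /g mulr_ge0 ?c0// addr_ge0 ?wW.1.
apply: le_trans hw _; rewrite /g indicE Bw ler_wpM2l//.
have := young_powR (theta_itv p1) (wW.1 w) (ler01 : 0 <= 1 :> R).
rewrite powR1 !mulr1 => /le_trans; apply; apply: lerD; first by rewrite ler_piMl ?wW.1.
by rewrite lerBlDr lerDl.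
Qed.

Definition pairing (y : F) (B : set T) : R := \int[mu]_w re_part (rep_on y B w).

Definition pairing_simple (V : zmodType) (u : V -> F) (v : T -> V) : R :=
  \int[mu]_w re_part (rep_on (u (v w)) (support_of v) w).

Lemma eq_ae_Rintegral (f g : T -> R) :
  mu.-integrable [set: T] (EFin \o f) -> mu.-integrable [set: T] (EFin \o g) ->
  {ae mu, forall w, f w = g w} -> \int[mu]_w f w = \int[mu]_w g w.
Proof.
move=> /measurable_int mf /measurable_int mg fg; rewrite /Rintegral; congr fine.
by apply: ae_eq_integral => //; apply: filterS fg => w -> _.
Qed.

(** Where [v] vanishes so does [u (v w)], hence the set may be enlarged. Two simple functions can
    then be integrated over a common set. *)
Lemma pairing_simple_sub (V : zmodType) (u : V -> F) (v : T -> V) B :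
  u 0 = 0 -> simple mu v -> fin_set mu B -> support_of v `<=` B ->
  pairing_simple u v = \int[mu]_w re_part (rep_on (u (v w)) B w).
Proof.
move=> u0 sv fB vB; have [_ _ fv] := sv.
apply: eq_ae_Rintegral.
- apply: (simple_family_integrable (f := fun z w => re_part (rep_on (u z) (support_of v) w)) sv) => z.
  exact: rep_on_integrable.
- apply: (simple_family_integrable (f := fun z w => re_part (rep_on (u z) B w)) sv) => z.
  exact: rep_on_integrable.
have [A BA] := piece_cover fB.
have h1 := simple_ae (P := fun z w => support_of v w -> rep_on (u z) (support_of v) w = rep_on (u z) B w)
   sv (fun z _ => rep_on_sub (u z) vB fB).
apply: filterS3 h1 (rep_onE 0 BA) (rep0 (k := k) (p1 := p1) A) => w h1 h2 h3.
have [vw|vw] := eqVneq (v w) 0; last by rewrite h1//; exact/eqP.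
rewrite vw u0 h2 rep_on_out//.
by case: ifPn => // /set_mem/BA/h3 ->.
Qed.

Lemma pairing_simple_lin (V : lmodType K) (S : set V) (u : V -> F) (a : R) (v w : T -> V) :
  u 0 = 0 ->
  (forall (a : K) x y, S x -> S y -> u (a *: x + y) = a *: u x + u y) ->
  simple mu v -> simple mu w -> (forall t, S (v t)) -> (forall t, S (w t)) ->
  pairing_simple u (of_real k a *: v + w) = a * pairing_simple u v + pairing_simple u w.
Proof.
move=> u0 lu sv sw Sv Sw.
have [_ _ fv] := sv; have [_ _ fw] := sw.
pose B := support_of v `|` support_of w.
have fB : fin_set mu B by exact: fin_setU.
have saw : simple mu (of_real k a *: v + w).
  by apply: simpleD => //; apply: (simple_map (phi := fun x => of_real k a *: x)) => //; rewrite scaler0.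
have int_ z : mu.-integrable [set: T] (EFin \o (fun x : T => re_part (rep_on (u z) B x))).
  exact: rep_on_integrable.
have iv := simple_family_integrable sv int_.
have iw := simple_family_integrable sw int_.
have iaw := simple_family_integrable saw int_.
rewrite (pairing_simple_sub u0 sv fB); last by move=> x; left.
rewrite (pairing_simple_sub u0 sw fB); last by move=> x; right.
rewrite (pairing_simple_sub u0 saw fB); last first.
  move=> x; rewrite /support_of/= => hx.
  have [vx|] := eqVneq (v x) 0; last by move=> /eqP; left.
  right => wx; apply: hx.
  by rewrite /GRing.add/= /GRing.scale/= vx wx scaler0 addr0.
rewrite -RintegralZl// -RintegralD//; last first.
  rewrite (_ : EFin \o _ = (fun w => a%:E * (EFin \o (fun w0 => re_part (rep_on (u (v w0)) B w0))) w))%E//.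
  exact: integrableZl.
apply: eq_ae_Rintegral => //.
  rewrite (_ : EFin \o _ = (fun w => a%:E * (EFin \o (fun w0 => re_part (rep_on (u (v w0)) B w0))) w)
     \+ (EFin \o (fun w0 => re_part (rep_on (u (w w0)) B w0))))%E//.
  by apply: integrableD => //; exact: integrableZl.
pose P y x t := rep_on (u (of_real k a *: y + x)) B t =
   of_real k a * rep_on (u y) B t + rep_on (u x) B t.
have h1 y : S y -> {ae mu, forall t, P y (w t) t}.
  move=> Sy; apply: (simple_ae (P := P y) sw) => x [t _ <-].
  by rewrite /P; apply: filterS (rep_on_lin (of_real k a) (u y) (u (w t)) fB) => t' <-; rewrite lu.
have : {ae mu, forall t, P (v t) (w t) t}.
  by apply: (simple_ae (P := fun y t => P y (w t) t) sv) => x [t _ <-]; exact: h1.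
apply: filterS => t; rewrite /P /GRing.add/= /GRing.scale/= => ->.
by rewrite re_partD re_partMr.
Qed.

Lemma pairing_simple_elem (V : zmodType) (u : V -> F) B z :
  u 0 = 0 -> fin_set mu B -> pairing_simple u (elem B z) = pairing (u z) B.
Proof.
move=> u0 fB; rewrite (pairing_simple_sub u0 (simple_elem z fB) fB); last exact: elem_support.
apply: eq_Rintegral => w _; rewrite /elem; case: ifPn => // Bw.
by rewrite !rep_on_out// => Bw'; move: Bw; rewrite mem_set.
Qed.

End Pairing.

(** * The upper bound for a regular operator *)

Lemma ae_le_Rintegral {d} {T : measurableType d} {R : realType}
    {mu : {measure set T -> \bar R}} (f g : T -> R) :
  mu.-integrable [set: T] (EFin \o f) -> mu.-integrable [set: T] (EFin \o g) ->
  {ae mu, forall w, f w <= g w} -> \int[mu]_w f w <= \int[mu]_w g w.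
Proof.
move=> fi gi fg; rewrite -subr_ge0 -RintegralB//.
have bi : mu.-integrable [set: T] (EFin \o (fun w => g w - f w)).
  by rewrite (_ : EFin \o _ = (EFin \o g) \- (EFin \o f))%E//; exact: integrableB.
rewrite (@eq_ae_Rintegral _ _ _ mu _ (fun w => `|g w - f w|))//.
- by apply: Rintegral_ge0.
- exact: (integrable_norm bi).
- by apply: filterS fg => w fgw; rewrite ger0_norm ?subr_ge0.
Qed.

Section RegularUpperBound.
Context {d d'} {T : measurableType d} {T' : measurableType d'} {R : realType} {k : scalar_kind}.
Context {mu : {measure set T -> \bar R}} {mu' : {measure set T' -> \bar R}}.
Context {p : \bar R} {p1 : (1 <= p)%E}.
Local Notation K := (Defs.scalar R k).
Local Notation E := (Lp k mu p1).
Local Notation F := (Lp k mu' p1).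
Local Notation th := (theta p).
Variables (S : set E) (u : E -> F) (C : R).
Hypothesis S_subspace : subspace_of S.
Hypothesis u_linear : linear_on S u.
Hypothesis C_gt0 : 0 < C.
Hypothesis uC : regular_bound S u C.

Lemma linear_on0 : u 0 = 0.
Proof using S_subspace u_linear.
have [S0 _] := S_subspace; have := u_linear 1 S0 S0.
rewrite !scale1r addr0 => /eqP; rewrite -subr_eq0 opprD addrA subrr sub0r oppr_eq0.
by move/eqP.
Qed.

Lemma linear_onZ a x : S x -> u (a *: x) = a *: u x.
Proof using S_subspace u_linear.
have [S0 _] := S_subspace; move=> Sx.
by rewrite -[a *: x]addr0 u_linear// linear_on0 addr0.
Qed.

Lemma regular_common_weight (s : seq E) (W : T -> R) (c : R) :
  0 < c -> (forall z, z \in s -> S z) ->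
  weight mu W -> \int[mu]_w W w <= 1 -> (forall z, z \in s -> family_le (rep z) W c) ->
  exists W', [/\ weight mu' W', \int[mu']_w W' w <= 1
               & forall z, z \in s -> family_le (rep (u z)) W' (C * c)].
Proof using C_gt0 uC.
move=> c0 Ss wW W1 hs; have [_ ub] := uC.
pose x (i : 'I_(size s)) := tnth (in_tuple s) i.
have xs i : x i \in s by exact: mem_tnth.
have xc : Lpnorm (sup_abs x) <= c.
  by apply/sup_abs_leP => //; exists W; split => // i; exact: hs.
have uxc : Lpnorm (sup_abs (u \o x)) <= C * c.
  apply: le_trans (ub _ x _) _; first by move=> i; exact: Ss.
  by rewrite ler_pM2l.
have /sup_abs_leP[|W' [wW' W'1 hW']] := uxc; first exact: mulr_gt0.
exists W'; split => // z zs.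
have zi : (index z s < size s)%N by rewrite index_mem.
have := hW' (Ordinal zi).
by rewrite /= /x (tnth_nth z)/= nth_index.
Qed.

Lemma pairing_simple_le (v : T' -> E) (s : R) :
  simple mu' v -> (forall t, S (v t)) -> gauge (mu' := mu') v s ->
  pairing_simple u v <= C * s.
Proof using C_gt0 uC S_subspace u_linear.
move=> sv Sv [W [G [wW wG hG hs]]].
have [fv mv fB] := sv.
have /andP[t0 t1] := theta_itv p1.
set B := support_of v in fB *.
pose M := fine (mu' B).
have M0 : 0 <= M by exact: fine_ge0.
(* [e] is added to the integral of [W] and, on the support [B], to the weight [G], so that one may
   divide by both. The total error is at most [C * (e + e * M)]. *)
suff main e : 0 < e -> pairing_simple u v <= C * (s + e * (1 + M)).
  apply/ler_addgt0Pr => e e0.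
  have c0 : 0 < C * (1 + M) by rewrite mulr_gt0// ltr_pwDl.
  apply: le_trans (main (e / (C * (1 + M))) _) _; first exact: divr_gt0.
  have M1 : 1 + M != 0 by rewrite gt_eqF// ltr_pwDl.
  have C1 : C != 0 by rewrite gt_eqF.
  rewrite (_ : C * (s + e / (C * (1 + M)) * (1 + M)) = C * s + e)//.
  by field; rewrite M1 C1.
move=> e0.
have [r rE] : exists r : seq E, range v = [set` r] by exact/finite_seqP.
pose good t := family_le (rep (v t)) W (G t `^ (1 - th)).
pose Gz z := [set g | exists t, [/\ good t, v t = z & g = G t]].
pose g z := inf (Gz z).
have Gz_lb z : has_lbound (Gz z) by exists 0 => _ [t [_ _ ->]]; exact: wG.1.
have g0 z : 0 <= g z.
  have [[g1 hg1]|hn] := pselect (Gz z !=set0).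
    by apply: lb_le_inf; [exists g1|move=> _ [t [_ _ ->]]; exact: wG.1].
  rewrite /g (_ : Gz z = set0) ?inf0//.
  by apply/seteqP; split => // x hx; apply: hn; exists x.
pose r' := [seq z <- r | `[< Gz z !=set0 >]].
(* Some admissible point has [G t < g z + e], so [z] is dominated by [a z * W ^ th], and [a z] is
   invertible thanks to [e]. *)
pose a z := (g z + e) `^ (1 - th).
have a0 z : 0 < a z by rewrite powR_gt0// ltr_wpDl.
pose y z : E := of_real k (a z)^-1 *: z.
have zy z : S z -> u z = of_real k (a z) *: u (y z).
  move=> Sz; rewrite /y linear_onZ// scalerA -of_realM mulfV ?gt_eqF//.
  by rewrite of_real1 scale1r.
pose ka := \int[mu]_w W w + e.
have ka0 : 0 < ka by rewrite ltr_wpDl// Rintegral_ge0// => w _; exact: wW.1.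
have kV0 : 0 <= ka^-1 by rewrite invr_ge0 ltW.
pose W1 w := ka^-1 * W w.
have wW1 : weight mu W1 by exact: weightZ.
have W11 : \int[mu]_w W1 w <= 1.
  rewrite RintegralZl//; last by case: wW.
  by rewrite mulrC ler_pdivrMr// mul1r lerDl ltW.
have Sr z : z \in r -> S z.
  move=> zr; have : range v z by rewrite rE.
  by move=> [t _ <-].
have Sy z : S z -> S (y z).
  by move=> Sz; have [S0 SP] := S_subspace; rewrite /y -[_ *: _]addr0; exact: SP.
have yW z : z \in r' -> family_le (rep (y z)) W1 (ka `^ th).
  rewrite mem_filter => /andP[/asboolP Gz0 _].
  have [_ [t [gt vt ->]] gte] : exists2 x, Gz z x & x < g z + e by exact: inf_adherent.
  rewrite -vt in gte *; apply: (dom_scale gt) => w.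
  rewrite modulus_of_real ger0_norm; last by rewrite invr_ge0 ltW.
  rewrite /W1 -[leRHS]powRM ?mulr_ge0 ?wW.1 ?(ltW ka0)// mulVKf ?gt_eqF//.
  rewrite mulrA ler_piMl ?powR_ge0// mulrC ler_pdivrMr// mul1r.
  by rewrite ge0_ler_powR ?subr_ge0// ?nnegrE ?wG.1 ?addr_ge0// ltW.
have [|||W' [wW' W'1 hW']] := @regular_common_weight (map y r') W1 (ka `^ th) _ _ wW1 W11.
- by rewrite powR_gt0.
- by move=> _ /mapP[z zr ->]; apply: Sy; apply: Sr; move: zr; rewrite mem_filter => /andP[].
- by move=> _ /mapP[z zr ->]; exact: yW.
have {}hW' z : z \in r' -> {ae mu', forall t, modulus (rep_on (u (y z)) B t) <= C * ka `^ th * W' t `^ th}.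
  move=> zr; apply: rep_on_family_le => //; last by rewrite mulr_ge0 ?powR_ge0 ?(ltW C_gt0).
  by apply: hW'; exact: map_f.
(* The outcome of Young's inequality for [ka * W'] and [g + e], after [g] has been raised to [G].
   The indicator of [B] keeps the term in [e] integrable. *)
pose h t := C * (th * (ka * W' t) + (1 - th) * (G t + e * \1_B t)).
have mB : measurable B by case: fB.
have i1 : mu'.-integrable [set: T'] (EFin \o (\1_B : T' -> R)).
  apply/integrableP; split; first exact/measurable_EFinP.
  under eq_integral do rewrite /= ger0_norm//.
  by rewrite integral_indic// setIT; case: fB.
have iZ c f : mu'.-integrable [set: T'] (EFin \o f) -> mu'.-integrable [set: T'] (EFin \o (fun t : T' => c * f t)).
  move=> fi; rewrite (_ : EFin \o _ = (fun w => c%:E * (f w)%:E))%E//; exact: integrableZl.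
have iD f1 f2 : mu'.-integrable [set: T'] (EFin \o f1) -> mu'.-integrable [set: T'] (EFin \o f2) ->
    mu'.-integrable [set: T'] (EFin \o (fun t : T' => f1 t + f2 t)).
  by move=> *; rewrite (_ : EFin \o _ = (EFin \o f1) \+ (EFin \o f2))%E//; exact: integrableD.
have [_ iW'] := wW'; have [_ iG] := wG.
have ie := iZ e _ i1.
have iGe := iD _ _ iG ie.
have ih : mu'.-integrable [set: T'] (EFin \o h).
  by apply: (iZ); apply: (iD); apply: (iZ) => //; exact: (iZ).
have -> : pairing_simple u v = \int[mu']_t re_part (rep_on (u (v t)) B t) by [].
apply: (@le_trans _ _ (\int[mu']_t h t)).
  apply: ae_le_Rintegral => //.
    by apply: (simple_family_integrable (f := fun z t => re_part (rep_on (u z) B t)) sv) => z; exact: rep_on_integrable.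
  pose P z t := z \in r' -> modulus (rep_on (u (y z)) B t) <= C * ka `^ th * W' t `^ th.
  have hP : {ae mu', forall t, P (v t) t}.
    apply: (simple_ae (P := P) sv) => z _; rewrite /P.
    have [zr|zr] := boolP (z \in r'); last by apply: nearW.
    by apply: filterS (hW' z zr) => t ht _.
  pose Q z t := S z -> rep_on (u z) B t = of_real k (a z) * rep_on (u (y z)) B t.
  have hQ : {ae mu', forall t, Q (v t) t}.
    apply: (simple_ae (P := Q) sv) => z [t' _ <-]; rewrite /Q.
    have l1 := rep_on_lin (of_real k (a (v t'))) (u (y (v t'))) 0 fB.
    have [A BA] := @piece_cover _ _ _ mu' _ p1 B fB.
    apply: filterS3 l1 (rep_onE (0 : F) BA) (rep0 (k := k) (p1 := p1) A) => t h1 h2 h3 Sz.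
    rewrite {1}zy// -[X in rep_on X B t]addr0 h1 h2.
    by case: ifPn => [/set_mem/BA/h3 ->|_]; rewrite addr0.
  apply: filterS3 hP hQ hG => t hPt hQt hGt.
  have [Bt|Bt] := boolP (t \in B); last first.
    rewrite rep_on_out; last by move=> Bt'; move: Bt; rewrite mem_set.
    rewrite re_part0 /h mulr_ge0 ?(ltW C_gt0)// addr_ge0//.
      by rewrite !mulr_ge0 ?(ltW ka0) ?wW'.1.
    by rewrite mulr_ge0 ?subr_ge0// addr_ge0 ?wG.1// mulr_ge0// ltW.
  have Gzt : Gz (v t) (G t) by exists t.
  have vr' : v t \in r'.
    rewrite mem_filter; apply/andP; split; first by apply/asboolP; exists (G t).
    have : range v (v t) by exists t.
    by rewrite rE.
  rewrite hQt// re_partMr.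
  apply: (@le_trans _ _ (a (v t) * (C * ka `^ th * W' t `^ th))).
    rewrite ler_wpM2l ?(ltW (a0 _))//; apply: le_trans (hPt vr').
    exact: le_trans (ler_norm _) (re_part_le _).
  have ge : 0 <= g (v t) + e by rewrite addr_ge0// ltW.
  rewrite -(mulrA C) -powRM ?wW'.1 ?(ltW ka0)// mulrCA /h ler_pM2l// mulrC.
  apply: le_trans (young_powR (theta_itv p1) _ ge) _; first by rewrite mulr_ge0 ?wW'.1 ?(ltW ka0).
  rewrite lerD2l ler_wpM2l ?subr_ge0// indicE Bt mulr1 lerD2r.
  exact: ge_inf.
rewrite /h RintegralZl//; last by apply: (iD); apply: (iZ) => //; exact: (iZ).
rewrite RintegralD//; [|by do 2 apply: (iZ)|exact: (iZ)].
rewrite !RintegralZl//; last exact: (iZ).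
rewrite RintegralD// RintegralZl//.
have -> : \int[mu']_t (\1_B t : R) = M by rewrite /Rintegral integral_indic// setIT.
rewrite ler_pM2l//.
apply: (@le_trans _ _ (th * ka + (1 - th) * (\int[mu']_t G t + e * M))).
  by rewrite lerD2r ler_wpM2l// ler_piMr// ltW.
have eM : 0 <= e * M by rewrite mulr_ge0// ltW.
rewrite /ka; move: hs; set X := \int[mu]_w W w; set Y := \int[mu']_w' G w'.
move=> hs.
have : th * e <= 1 * e by rewrite ler_wpM2r// ltW.
have : (1 - th) * (e * M) <= 1 * (e * M) by rewrite ler_wpM2r// lerBlDr lerDl.
lra.
Qed.

End RegularUpperBound.

(** * Countable additivity *)

Section UltrafilterLimit.
Context {d} {T : measurableType d} {R : realType} {k : scalar_kind}.
Context {mu : {measure set T -> \bar R}}.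
Context {V : lmodType (Defs.scalar R k)}.
Local Notation K := (Defs.scalar R k).

Definition cut_to (C : set T) (v : T -> V) : T -> V := fun t => if t \in C then v t else 0.

Definition vanishing (D : nat -> set T) : Prop :=
  [/\ forall n, measurable (D n), nonincreasing_seq D & \bigcap_n D n = set0].

Lemma vanishingU D1 D2 : vanishing D1 -> vanishing D2 ->
  vanishing (fun n => D1 n `|` D2 n).
Proof.
move=> [m1 d1 e1] [m2 d2 e2]; split.
- by move=> n; exact: measurableU.
- move=> i j ij; apply/subsetPset.
  by apply: setUSS; [exact/subsetPset/d1|exact/subsetPset/d2].
- apply/seteqP; split => // t ht.
  have h (D : nat -> set T) : nonincreasing_seq D -> \bigcap_n D n = set0 -> exists n, forall j, (n <= j)%N -> ~ D j t.
    move=> dD eD; apply: contrapT => hn.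
    suff : (\bigcap_n D n) t by rewrite eD.
    move=> n _; apply: contrapT => Dn; apply: hn; exists n => j nj Dj.
    by apply: Dn; have /subsetPset := dD _ _ nj; apply.
  have [n1 h1] := h _ d1 e1; have [n2 h2] := h _ d2 e2.
  have [] := ht (maxn n1 n2) I.
    by apply: h1; exact: leq_maxl.
  by apply: h2; exact: leq_maxr.
Qed.

(** Monotone convergence on the complements of the [D n]; the sets [D n] themselves may have
    infinite measure. *)
Lemma vanishing_integral D (f : T -> R) (e : R) : vanishing D -> weight mu f -> 0 < e ->
  exists n, \int[mu]_(t in D n) f t < e.
Proof.
move=> [mD dD eD] [f0 fi] e0.
have nnd : nondecreasing_seq (fun n => ~` D n).
  by move=> i j ij; apply/subsetPset; apply: subsetC; exact/subsetPset/dD.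
have mC n : measurable (~` D n) by exact: measurableC.
have mf : measurable_fun [set: T] (EFin \o f) by exact: measurable_int fi.
have h := ge0_nondecreasing_set_cvg_integral (f := EFin \o f) (mu := mu) nnd mC
  (fun i => measurable_funS measurableT (@subsetT _ _) mf) (fun i x _ => f0 x).
rewrite -setC_bigcap eD setC0 in h.
have iS A : measurable A -> mu.-integrable A (EFin \o f).
  by move=> mA; apply: integrableS fi.
have h' : (fun n => \int[mu]_(t in ~` D n) f t) @ \oo --> \int[mu]_t f t.
  apply: fine_cvg; rewrite /Rintegral fineK//.
  exact: integrable_fin_num.
have hn : \forall n \near \oo, \int[mu]_t f t - e < \int[mu]_(t in ~` D n) f t.
  by apply: (cvgr_gt _ h'); rewrite ltrBlDr ltrDl.
near \oo => n; exists n.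
have : \int[mu]_t f t - e < \int[mu]_(t in ~` D n) f t by near: n.
rewrite -[in X in X - e](setvU (D n)) Rintegral_setU//.
- by rewrite ltrBlDr ltrD2l.
- by rewrite setvU.
- by apply/disj_setPS => t [].
Unshelve. all: by end_near. Qed.

(* The index sets [C] of the ultrafilter omit a tail of any given sequence of sets
   decreasing to the empty set, which forces countable additivity of the limit, and
   their complements are small for any given finite measure of the form [f mu],
   which leaves such measures unchanged. *)
Definition cut_index : set ((nat -> set T) * (T -> R) * R) :=
  [set i | [/\ vanishing i.1.1, weight mu i.1.2 & 0 < i.2]].

Definition cut_base (i : (nat -> set T) * (T -> R) * R) : set (set T) :=
  [set C | [/\ measurable C, exists n, C `&` i.1.1 n = set0
             & \int[mu]_(t in ~` C) i.1.2 t < i.2]].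

(** The complement of [D n] for large [n] shows that each base set is inhabited. Two indices are
    refined by uniting the sequences, adding the weights and taking the smaller bound. *)
Lemma cut_filter : ProperFilter (filter_from cut_index cut_base).
Proof.
apply: filter_from_proper; last first.
  move=> [[D f] e] [/= vD wf e0].
  have [n hn] := vanishing_integral vD wf e0.
  exists (~` D n); split => /=.
  - by apply: measurableC; case: vD.
  - by exists n; rewrite setICl.
  - by rewrite setCK.
apply: filter_from_filter.
  exists ((fun=> set0), (fun=> 0), 1); split => //=; last exact: weight0.
  by split => //; apply/seteqP; split => // t /(_ 0%N I).
move=> [[D1 f1] e1] [[D2 f2] e2] [/= v1 w1 e10] [/= v2 w2 e20].
exists ((fun n => D1 n `|` D2 n), (f1 \+ f2), Num.min e1 e2).
  split => /=; [exact: vanishingU|exact: weightD|by rewrite lt_min e10].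
move=> C [/= mC [n hn] hC].
have mC' : measurable (~` C) by exact: measurableC.
have [f10 i1] := w1; have [f20 i2] := w2.
have i1' : mu.-integrable (~` C) (EFin \o f1) by exact: integrableS i1.
have i2' : mu.-integrable (~` C) (EFin \o f2) by exact: integrableS i2.
rewrite RintegralD// lt_min in hC; move/andP: hC => [h1 h2].
have p1 : 0 <= \int[mu]_(t in ~` C) f1 t by apply: Rintegral_ge0.
have p2 : 0 <= \int[mu]_(t in ~` C) f2 t by apply: Rintegral_ge0.
split; split => //=.
- by exists n; apply/seteqP; split => // t [Ct Dt]; rewrite -hn; split => //; left.
- by apply: le_lt_trans h1; rewrite lerDl.
- by exists n; apply/seteqP; split => // t [Ct Dt]; rewrite -hn; split => //; right.
- by apply: le_lt_trans h2; rewrite lerDr.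
Qed.

Lemma cut_to_simple C v : measurable C -> simple mu v -> simple mu (cut_to C v).
Proof.
move=> mC sv; have [fv mv fB] := sv.
rewrite (_ : cut_to C v = fun t => (fun (x : R) (y : V) => of_real k x *: y)
    (elem (C `&` support_of v) (1 : R) t) (v t)).
  apply: (simple_map2 (mu := mu) (phi := fun (x : R) (y : V) => of_real k x *: y)) => //.
    by rewrite scaler0.
  by apply: simple_elem; rewrite setIC; exact: fin_setIl.
apply/funext => t; rewrite /cut_to /elem in_setI.
have [Ct|Ct] := boolP (t \in C); last by rewrite of_real0 scale0r.
have [vt|vt] := eqVneq (v t) 0; first by rewrite vt scaler0.
by rewrite mem_set ?of_real1 ?scale1r//; exact/eqP.
Qed.

Variables (g : (T -> V) -> R -> Prop) (Psi : (T -> V) -> R).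
Hypothesis g_shrink : forall v w s, g v s ->
  (forall t, exists2 a : K, modulus a <= 1 & w t = a *: v t) -> g w s.
Hypothesis g_simple : forall v, simple mu v -> exists s, g v s.
Hypothesis Psi_lin : real_linear_on [set v | simple mu v] Psi.
Hypothesis Psi_g : bounded_by [set v | simple mu v] g Psi.

Lemma simple_subspace : real_subspace [set v : T -> V | simple mu v].
Proof.
split; first exact: simple0.
move=> a x y sx sy; apply: simpleD => //.
by apply: (simple_map (phi := fun z => of_real k a *: z)) => //; rewrite scaler0.
Qed.

Lemma g_cut_to C v s : g v s -> g (cut_to C v) s.
Proof using g_shrink.
move=> gv; apply: g_shrink gv _ => t; rewrite /cut_to.
case: ifP => _; first by exists 1; rewrite ?scale1r// -of_real1 modulus_of_real normr1.
by exists 0; rewrite ?modulus0 ?scale0r.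
Qed.

Lemma Psi_abs_le v s : simple mu v -> g v s -> `|Psi v| <= s.
Proof using Psi_lin Psi_g g_shrink.
move=> sv gv; rewrite ler_norml Psi_g// andbT lerNl.
have := real_linearZ (-1) simple_subspace Psi_lin sv.
rewrite mulN1r => <-; apply: Psi_g; first exact: (real_subspaceZ _ simple_subspace sv).
apply: g_shrink gv _ => t; exists (of_real k (-1)) => //.
by rewrite modulus_of_real normrN1.
Qed.

(** A gliding hump. Otherwise there are disjoint sets in successive differences of the [D n] on
    which [Psi] exceeds [e] in absolute value. With suitable signs their sum [w] is still a
    contraction of [elem (D 0) z], so [Psi w] stays bounded, although it is at least [j * e] after
    [j] steps. *)
Lemma small_variation (D : nat -> set T) z (e : R) : vanishing D -> fin_set mu (D 0%N) -> 0 < e ->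
  exists m, forall n G, (m <= n)%N -> measurable G -> G `<=` D m `\` D n ->
    `|Psi (elem G z)| <= e.
Proof using Psi_lin Psi_g g_shrink g_simple.
move=> [mD dD eD] fD e0; apply: contrapT => /forallNP hm.
have DS i j : (i <= j)%N -> D j `<=` D i by move=> ij; apply/subsetPset; exact: dD.
have [s gs] := g_simple (simple_elem z fD).
have step j : exists w n, [/\ simple mu w, forall t, D n t -> w t = 0,
   forall t, exists2 a : K, modulus a <= 1 & w t = a *: elem (D 0%N) z t
   & j%:R * e <= Psi w].
  elim: j => [|j [w [n [sw wD wz Psiw]]]].
    exists 0, 0%N; split => //; first exact: simple0.
      by move=> t; exists 0; rewrite ?modulus0 ?scale0r.
    by rewrite (real_linear0 simple_subspace Psi_lin) mul0r.
  have /existsNP[n' /existsNP[G /not_implyP[nn' /not_implyP[mG /not_implyP[GD /negP]]]]] := hm n.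
  rewrite -ltNge => eG.
  have GD0 : G `<=` D 0%N by move=> t /GD[Dt _]; exact: DS Dt.
  have fG : fin_set mu G by exact: sub_fin_set fD.
  have sG : simple mu (elem G z) by exact: simple_elem.
  pose sg : R := Num.sg (Psi (elem G z)).
  have sg1 : `|sg| <= 1 by rewrite normr_sg lern1 leq_b1.
  exists (of_real k sg *: elem G z + w), n'; split.
  - by case: simple_subspace => _; apply.
  - move=> t Dt; rewrite /GRing.add/= /GRing.scale/= wD ?addr0; last exact: DS Dt.
    by rewrite /elem memNset ?scaler0// => /GD[_]; apply.
  - move=> t; rewrite /GRing.add/= /GRing.scale/=.
    have [Gt|Gt] := boolP (t \in G).
      exists (of_real k sg); first by rewrite modulus_of_real.
      move/set_mem in Gt; have [Dt _] := GD _ Gt.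
      by rewrite wD// addr0 /elem !mem_set//; exact: GD0.
    have [a a1 ->] := wz t; exists a => //.
    by rewrite {1}/elem (negbTE Gt) scaler0 add0r.
  - rewrite Psi_lin//.
    rewrite /sg -normrEsg -addn1 natrD mulrDl mul1r addrC.
    by rewrite lerD// ltW.
have [j hj] : exists j : nat, s < j%:R * e.
  exists (Num.truncn (s / e)).+1.
  by rewrite -ltr_pdivrMr// truncnS_gt.
have [w [n [sw _ wz /(lt_le_trans hj)]]] := step j.
by apply/negP; rewrite -leNgt; apply: Psi_g => //; exact: g_shrink gs wz.
Qed.

(** The last clause says that [Psi] is left unchanged wherever it is already dominated by an
    integral; this preserves the prescribed values on [S]. *)
Lemma countably_additive_part : exists L : (T -> V) -> R,
  [/\ real_linear_on [set v | simple mu v] L,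
      bounded_by [set v | simple mu v] g L,
      forall D z, vanishing D -> fin_set mu (D 0%N) -> (fun n => L (elem (D n) z)) @ \oo --> (0 : R)
    & forall v f, simple mu v -> weight mu f ->
        (forall C, measurable C -> `|Psi (cut_to C v)| <= \int[mu]_(t in C) f t) ->
        L v = Psi v].
Proof using Psi_lin Psi_g g_shrink g_simple.
have [U [UU sU]] := ultraFilterLemma cut_filter.
pose f v C := Psi (cut_to C v).
have Ubase i : cut_index i -> U (cut_base i).
  by move=> hi; apply: sU; exists i.
have v0 : vanishing (fun=> set0).
  by split => //; apply/seteqP; split => // t /(_ 0%N I).
have Um : \forall C \near U, measurable C.
  have := Ubase ((fun=> set0), (fun=> 0), 1) (And3 v0 (weight0 mu) ltr01).
  by apply: filterS => C [].
have cvf v : simple mu v -> exists l : R, f v @ U --> l.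
  move=> sv; have [s gs] := g_simple sv.
  have Ff : (f v @ U) [set` `[- s, s]].
    apply: filterS Um => C mC /=; rewrite in_itv/= -ler_norml.
    by apply: Psi_abs_le; [exact: cut_to_simple|exact: g_cut_to].
  (* The values stay in a compact segment, and a cluster point of an ultrafilter is its limit. *)
  have [l [_ hl]] := @segment_compact R (- s) s (f v @ U) _ Ff.
  exists l => A Al; have [//|hA] := in_ultra_setVsetC (f v @^-1` A) UU.
  by have [x [/= nAx Ax]] := hl (~` A) A hA Al.
pose L v := get [set l : R | f v @ U --> l].
have LP v : simple mu v -> f v @ U --> L v.
  by move=> sv; have [l hl] := cvf v sv; apply: (@getPex _ [set l : R | f v @ U --> l]); exists l.
exists L; split.
- move=> a x y sx sy.
  have sxy : simple mu (of_real k a *: x + y) by case: simple_subspace => _; apply.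
  apply: (cvg_unique _ (LP _ sxy)) => //.
  have : (fun C => a * f x C + f y C) @ U --> a * L x + L y.
    by apply: cvgD; [apply: cvgMr|]; exact: LP.
  apply: cvg_trans; apply: near_eq_cvg.
  apply: filterS Um => C mC; rewrite /f -Psi_lin; [|exact: cut_to_simple..].
  congr Psi; apply/funext => t; rewrite /cut_to /GRing.add/= /GRing.scale/=.
  by case: ifP; rewrite // scaler0 addr0.
- move=> v s sv gv; apply: (cvgr_to_le (LP v sv)).
  apply: filterS Um => C mC; apply: Psi_g; [exact: cut_to_simple|exact: g_cut_to].
- move=> D z vD fD; have [mD dD _] := vD.
  have DS i j : (i <= j)%N -> D j `<=` D i by move=> ij; apply/subsetPset; exact: dD.
  apply/cvgrPdist_le => e e0; have [m hm] := small_variation z vD fD e0.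
  near=> j; have mj : (m <= j)%N by near: j; exact: nbhs_infty_ge.
  rewrite sub0r normrN.
  have sj : simple mu (elem (D j) z).
    by apply: simple_elem; apply: sub_fin_set fD => //; exact: DS.
  have hU : \forall C \near U, `|f (elem (D j) z) C| <= e.
    (* The chosen sets [C] miss [D n] for some [n] depending on [C], so [C] meets [D j] inside a
       difference of the sequence. The bound of [small_variation] is uniform in [n], hence passes to
       the limit. *)
    have := Ubase (D, (fun=> 0), 1) (And3 vD (weight0 mu) ltr01).
    apply: filterS => C [/= mC [n Cn] _].
    rewrite /f (_ : cut_to C _ = elem (C `&` D j) z); last first.
      by apply/funext => t; rewrite /cut_to /elem in_setI; case: (t \in C).
    apply: (hm (maxn n j)); first by rewrite (leq_trans mj)// leq_maxr.
      exact: measurableI.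
    move=> t [Ct Dt]; split; first exact: DS Dt.
    move=> Dn; suff : (C `&` D n) t by rewrite Cn.
    by split => //; apply: DS Dn; exact: leq_maxl.
  rewrite ler_norml; apply/andP; split.
    apply: (cvgr_to_ge (LP _ sj)); apply: filterS hU => C.
    by rewrite ler_norml => /andP[].
  apply: (cvgr_to_le (LP _ sj)); apply: filterS hU => C.
  by rewrite ler_norml => /andP[].
- move=> v h sv wh hC; apply: (cvg_unique _ (LP _ sv)) => //.
  apply/cvgrPdist_le => e e0.
  have := Ubase ((fun=> set0), h, e) (And3 v0 wh e0).
  apply: filterS => C [/= mC _ /ltW he]; apply: le_trans he.
  apply: le_trans (hC _ (measurableC mC)).
  (* The error is [Psi] on the part of [v] outside [C], which is dominated by the small integral of
     [h] there. *)
  have vE : v = cut_to (~` C) v + cut_to C v.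
    apply/funext => t; rewrite /GRing.add/= /cut_to in_setC.
    by case: (t \in C); rewrite /= ?add0r ?addr0.
  have s1 : simple mu (cut_to (~` C) v) by apply: cut_to_simple => //; exact: measurableC.
  have s2 : simple mu (cut_to C v) by exact: cut_to_simple.
  by rewrite /f {1}vE (real_linearD Psi_lin)// addrK.
Unshelve. all: by end_near. Qed.

End UltrafilterLimit.

(** * Norms from testing against simple functions *)

Section TestWeight.
Import HBNNSimple.
Context {d} {T : measurableType d} {R : realType}.
Context {mu : {measure set T -> \bar R}} {p : \bar R} (p1 : (1 <= p)%E).
Local Notation th := (theta p).

Lemma measurable_simple (h : T -> R) (B : set T) :
  measurable_fun [set: T] h -> finite_set (range h) -> fin_set mu B ->
  support_of h `<=` B -> simple mu h.
Proof.
move=> mh fh fB hB.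
have mpre (Y : set R) : measurable Y -> measurable (h @^-1` Y).
  by move=> mY; rewrite -[X in measurable X]setTI; exact: mh.
split => //; first by move=> z; exact: mpre.
by apply: sub_fin_set fB => //; apply: mpre; exact: measurableC.
Qed.

Lemma simple_integrable (h : T -> R) : simple mu h -> mu.-integrable [set: T] (EFin \o h).
Proof.
move: h; apply: simple_ind.
- by rewrite (_ : EFin \o _ = cst 0%E)//; exact: integrable0.
- move=> v w _ _ iv iw.
  by rewrite (_ : EFin \o _ = (EFin \o v) \+ (EFin \o w))%E//; exact: integrableD.
move=> B z [mB Boo].
rewrite (_ : EFin \o _ = (fun w => z%:E * (\1_B w)%:E))%E; last first.
  apply/funext => w; rewrite /= /elem indicE -EFinM.
  by case: (w \in B); rewrite ?mulr1 ?mulr0.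
apply: integrableZl => //; apply/integrableP; split; first exact/measurable_EFinP.
by under eq_integral do rewrite /= ger0_norm//; rewrite integral_indic// setIT.
Qed.

(* Vanishing at [0] also for [t = 1], so that [dual_powR t \o G] is supported where [G] is. *)
Definition dual_powR (t x : R) : R := if x == 0 then 0 else x `^ (1 - t).

Lemma dual_powR_ge0 t x : 0 <= dual_powR t x.
Proof. by rewrite /dual_powR; case: eqVneq => // _; exact: powR_ge0. Qed.

Lemma dual_powR_le t x : dual_powR t x <= x `^ (1 - t).
Proof. by rewrite /dual_powR; case: eqVneq => // _; exact: powR_ge0. Qed.

Lemma dual_powR0 t : dual_powR t 0 = 0. Proof. by rewrite /dual_powR eqxx. Qed.

Lemma dual_powR1 t : dual_powR t 1 = 1. Proof. by rewrite /dual_powR oner_eq0 powR1. Qed.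

Definition test_weight (b : R) (H : T -> R) : T -> R :=
  if p is r%:E then fun w => (H w / b) `^ r else fun=> 0.

(** A converse of Hoelder's inequality. For finite [p], simple [G] increasing to [f = (H / b) ^ p]
    satisfy [G ^ th * b <= H], so the test gives [J <= th + (1 - th) * J] for the finite number
    [J = \int G], hence [J <= 1]. *)
Lemma test_weightP (A : piece mu p) (b : R) (H : T -> R) :
  0 < b -> (forall w, 0 <= H w) -> measurable_fun [set: T] H ->
  (forall w, ~ sval A w -> H w = 0) ->
  (p != +oo%E -> forall e, 0 < e -> (mu [set w | (e < H w)%R] < +oo)%E) ->
  (forall G : T -> R, simple mu G -> (forall w, 0 <= G w) -> support_of G `<=` sval A ->
     (\int[mu]_w (H w * dual_powR th (G w))%:E <= (b * (th + (1 - th) * \int[mu]_w G w))%:E)%E) ->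
  [/\ weight mu (test_weight b H), \int[mu]_w (test_weight b H w) <= 1
    & {ae mu, forall w, H w <= b * test_weight b H w `^ th}].
Proof using p1.
move=> b0 H0 mH HA Hfin test.
rewrite /test_weight /theta; move: p1 A HA Hfin test.
rewrite /theta; case: p => [r| |]// r1 A HA Hfin test; last first.
  split; [exact: weight0|by rewrite /Rintegral integral0|].
  (* With [th = 0], testing the indicator of [B n] gives [(b + 1 / (n + 1)) * mu (B n) <= b * mu (B
     n)], and pieces have finite measure. *)
  pose B n := [set w | b + n.+1%:R^-1 <= H w].
  have mB n : measurable (B n).
    by rewrite -[B n]setTI; exact: measurable_fun_le.
  have BA n : B n `<=` sval A.
    move=> w; apply: contraPP => /HA; rewrite /B/= => ->; apply/negP; rewrite -ltNge.
    by rewrite addr_gt0// invr_gt0.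
  have B0 n : mu (B n) = 0%E.
    have fB : fin_set mu (B n).
      apply: sub_fin_set (BA n) _ => //.
      by case: (A) => X hX.
    pose G := elem (B n) (1 : R).
    have sG : simple mu G by exact: simple_elem.
    have GE w : G w = \1_(B n) w by rewrite /G /elem indicE; case: (w \in B n).
    have G0 w : 0 <= G w by rewrite GE.
    have := test G sG G0 (subset_trans (@elem_support _ _ _ (B n) 1) (BA n)).
    rewrite add0r subr0 mul1r.
    have -> : \int[mu]_w G w = fine (mu (B n)).
      under eq_Rintegral do rewrite GE.
      by rewrite /Rintegral integral_indic// setIT.
    have [_ Boo] := fB.
    have Bfin : mu (B n) \is a fin_num by rewrite ge0_fin_numE.
    rewrite EFinM fineK// => le1.
    have le2 : ((b + n.+1%:R^-1)%:E * mu (B n) <= b%:E * mu (B n))%E.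
      apply: le_trans le1.
      have -> : mu (B n) = (\int[mu]_w (\1_(B n) w)%:E)%E by rewrite integral_indic// setIT.
      have bn : 0 <= b + n.+1%:R^-1 by rewrite addr_ge0 ?(ltW b0).
      rewrite -ge0_integralZl ?lee_fin//; last exact/measurable_EFinP.
      apply: ge0_le_integral => //.
      - by move=> w _; rewrite -EFinM lee_fin; exact: mulr_ge0.
      - by apply/measurable_EFinP; exact: measurable_funM.
      - apply/measurable_EFinP; apply: measurable_funM => //.
        rewrite (_ : (fun x => _) = \1_(B n))//; apply/funext => w; rewrite GE.
        by rewrite indicE; case: (w \in B n); rewrite ?dual_powR0 ?dual_powR1.
      - move=> w _; rewrite -EFinM lee_fin GE indicE.
        case: (boolP (w \in B n)) => [/set_mem Bw|_]; last by rewrite dual_powR0 !mulr0.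
        by rewrite dual_powR1 !mulr1.
    apply/eqP; rewrite -(fineK Bfin) eqe; apply: contrapT => /negP Bn0.
    move: le2; rewrite -(fineK Bfin) -!EFinM lee_fin ler_pM2r; last first.
      by rewrite lt_neqAle eq_sym Bn0 fine_ge0.
    by apply/negP; rewrite -ltNge ltrDl invr_gt0.
  have : mu.-negligible (\bigcup_n B n).
    by apply: negligible_bigcup => n; exists (B n); split.
  apply: negligibleS => w /= /negP; rewrite powRr0 mulr1 -ltNge => bH.
  pose e := H w - b.
  have e0 : 0 < e by rewrite subr_gt0.
  exists (Num.truncn e^-1) => //=; rewrite /B/= addrC -lerBrDr -/e.
  rewrite -[leRHS]invrK lef_pV2 ?posrE ?invr_gt0//.
  by apply: ltW; rewrite truncnS_gt.
rewrite lee_fin in r1.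
have r0 : 0 < r by exact: lt_le_trans r1.
pose f w := (H w / b) `^ r.
have f0 w : 0 <= f w by exact: powR_ge0.
have fth w : b * f w `^ r^-1 = H w.
  rewrite /f -powRrM mulfV ?gt_eqF// powRr1 ?divr_ge0 ?(ltW b0)//.
  by rewrite mulrC divfK// gt_eqF.
have mf : measurable_fun [set: T] f.
  apply: (measurableT_comp (measurable_powR r)) => //; exact: measurable_funM.
suff intf : (\int[mu]_w (f w)%:E <= 1)%E.
  have wf : weight mu f.
    split => //; apply/integrableP; split; first exact/measurable_EFinP.
    under eq_integral do rewrite gee0_abs ?lee_fin//.
    by apply: le_lt_trans intf _; rewrite ltry.
  split => //; first by rewrite -lee_fin weight_int.
  by apply: nearW => w; rewrite fth.
have mEf : measurable_fun [set: T] (EFin \o f) by exact/measurable_EFinP.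
pose a n : {nnsfun T >-> R} := nnsfun_approx measurableT mEf n.
pose B n := [set w | n.+1%:R^-1 < H w].
have mB n : measurable (B n).
  rewrite (_ : B n = [set: T] `&` H @^-1` [set` `]n.+1%:R^-1, +oo[]); first exact: mH.
  by apply/seteqP; split => w; rewrite /B/= in_itv/= andbT => // -[].
have fB n : fin_set mu (B n) by split => //; apply: Hfin => //; rewrite invr_gt0.
(* The cut to [B n] gives the approximation a support of finite measure. Nothing is lost in the
   limit, since [f] vanishes where [H] does. *)
pose G n : {nnsfun T >-> R} := proj_nnsfun (a n) (mB n).
have GE n w : G n w = a n w * \1_(B n) w by [].
have G0 n w : 0 <= G n w by rewrite GE mulr_ge0.
have sG n : simple mu (G n).
  apply: measurable_simple (fB n) _ => //.
  move=> w; rewrite /support_of/=; apply: contra_notP => Bw.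
  by apply: etrans (GE n w) _; rewrite indicE memNset ?mulr0.
have af n w : a n w <= f w.
  have nda : nondecreasing_seq (a : (T -> R)^nat) by exact: nd_nnsfun_approx.
  have acv : (EFin \o (a^~ w)) @ \oo --> (f w)%:E.
    exact: (cvg_nnsfun_approx measurableT mEf (fun x _ => f0 x) I).
  have acv' : (a^~ w) @ \oo --> f w.
    by move/fine_cvgP : acv => [].
  rewrite -(cvg_lim _ acv')//; apply: nondecreasing_cvgn_le.
    by move=> i j ij; have /lefP := nda _ _ ij; apply.
  by apply/cvg_ex; exists (f w).
have Gf n w : G n w <= f w.
  rewrite GE indicE; case: (w \in B n); rewrite ?mulr1// mulr0//.
have intG n : (\int[mu]_w (G n w)%:E <= 1)%E.
  have iG := simple_integrable (sG n).
  have mG : measurable_fun [set: T] (G n) by [].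
  have At : sval A = [set: T] by case: (A).
  have sA : support_of (G n) `<=` sval A by rewrite At.
  have := test _ (sG n) (G0 n) sA.
  set J := \int[mu]_w G n w => hJ.
  have JE : J%:E = (\int[mu]_w (G n w)%:E)%E by rewrite fineK//; exact: integrable_fin_num.
  rewrite -JE lee_fin.
  have {}hJ : ((b * J)%:E <= (b * (r^-1 + (1 - r^-1) * J))%:E)%E.
    apply: le_trans hJ; rewrite EFinM JE -ge0_integralZl ?lee_fin ?(ltW b0)//; last 2 first.
    - exact/measurable_EFinP.
    - by move=> w _; rewrite lee_fin.
    apply: ge0_le_integral => //.
    - by move=> w _; rewrite -EFinM lee_fin mulr_ge0 ?(ltW b0).
    - by apply/measurable_EFinP; exact: measurable_funM.
    - apply/measurable_EFinP; apply: measurable_funM => //.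
      apply: (measurable_fun_ifT (f := fun w => G n w == 0)) => //=.
        exact: measurable_fun_eqr.
      by apply: (measurableT_comp (measurable_powR _)).
    move=> w _; rewrite -EFinM lee_fin /dual_powR.
    case: eqVneq => [->|Gn0]; first by rewrite !mulr0.
    rewrite -(fth w) -mulrA ler_pM2l//.
    have Gp : 0 < G n w by rewrite lt_neqAle eq_sym Gn0 G0.
    apply: (@le_trans _ _ (G n w `^ r^-1 * G n w `^ (1 - r^-1))).
      by rewrite -powRD ?subrKC ?powRr1//; apply/implyP.
    by rewrite ler_wpM2r ?powR_ge0// ge0_ler_powR ?invr_ge0 ?nnegrE ?(ltW r0).
  move: hJ; rewrite lee_fin ler_pM2l// => hJ.
  have : r^-1 * J <= r^-1 * 1 by lra.
  by rewrite ler_pM2l ?invr_gt0.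
have ndG w : nondecreasing_seq (fun n => (G n w)%:E).
  move=> i j ij; rewrite lee_fin !GE; apply: ler_pM => //.
    by have /lefP := nd_nnsfun_approx measurableT mEf ij; apply.
  rewrite !indicE; have [/set_mem iB|//] := boolP (w \in B i).
  rewrite mem_set//; apply: le_lt_trans iB.
  by rewrite lef_pV2 ?posrE ?ltr0n// ler_nat.
have cvG w : (fun n => (G n w)%:E) @ \oo --> (f w)%:E.
  have [Hw|Hw] := eqVneq (H w) 0.
    have f0w : f w = 0 by rewrite /f Hw mul0r powR0// gt_eqF.
    rewrite f0w; apply: cvg_near_cst; apply: nearW => n.
    by congr EFin; apply/eqP; rewrite eq_le G0 -f0w Gf.
  have acv : (fun n => (a n w)%:E) @ \oo --> (f w)%:E.
    exact: (cvg_nnsfun_approx measurableT mEf (fun x _ => f0 x) I).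
  apply: cvg_trans acv; apply: near_eq_cvg.
  have Hp : 0 < H w by rewrite lt_neqAle eq_sym Hw H0.
  near=> n; rewrite GE indicE mem_set ?mulr1//.
  have : n.+1%:R^-1 < H w by near: n; exact: near_infty_natSinv_lt (PosNum Hp).
  by [].
have mG n : measurable_fun [set: T] (fun w => (G n w)%:E).
  by apply/measurable_EFinP.
have := @cvg_monotone_convergence _ _ _ mu _ measurableT (fun n w => (G n w)%:E) mG
  (fun n w _ => G0 n w) (fun w _ => ndG w).
have -> : (fun w => limn (fun n => (G n w)%:E)) = EFin \o f.
  by apply/funext => w; apply/cvg_lim => //; exact: cvG.
move=> h; rewrite -(cvg_lim _ h)//; apply: lime_le; first by apply/cvg_ex; eexists; exact: h.
exact: nearW.
Unshelve. all: by end_near. Qed.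

End TestWeight.
Arguments test_weight {d T R} p b H _.

(** * Densities *)

Section Density.
Context {d} {T : measurableType d} {R : realType}.
Variables (mu : {measure set T -> \bar R}) (L : (T -> R) -> R).
Hypothesis L_lin : forall (a : R) s t, simple mu s -> simple mu t ->
  L (fun w => a * s w + t w) = a * L s + L t.
Hypothesis L_vanishing : forall D, vanishing D -> fin_set mu (D 0%N) ->
  (fun n => L (elem (D n) 1)) @ \oo --> (0 : R).
Hypothesis L_null : forall B, fin_set mu B -> mu B = 0%E -> L (elem B 1) = 0.

Lemma L0 : L (fun=> 0) = 0.
Proof using L_lin.
have := L_lin 1 (simple0 mu R) (simple0 mu R).
rewrite (_ : (fun w : T => _) = (fun=> 0)); last by apply/funext => w; rewrite mulr0 addr0.
by lra.
Qed.

Lemma L_setU B1 B2 : fin_set mu B1 -> fin_set mu B2 -> [disjoint B1 & B2] ->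
  L (elem (B1 `|` B2) 1) = L (elem B1 1) + L (elem B2 1).
Proof using L_lin.
move=> f1 f2 /disj_setPS dj.
have := L_lin 1 (simple_elem 1 f1) (simple_elem 1 f2).
rewrite mul1r => <-; congr L; apply/funext => w; rewrite /elem in_setU mul1r.
have [w1|w1] := boolP (w \in B1); have [w2|w2] := boolP (w \in B2);
  rewrite ?addr0 ?add0r//.
by exfalso; apply: (dj w); split; exact/set_mem.
Qed.

Variable A : set T.
Hypothesis fA : fin_set mu A.

Definition set_charge (B : set T) : \bar R := (L (elem (B `&` A) 1))%:E.

Let fI B : measurable B -> fin_set mu (B `&` A).
Proof. by move=> mB; rewrite setIC; exact: fin_setIl. Qed.

Let set_charge0 : set_charge set0 = 0%E.
Proof.
rewrite /set_charge set0I (_ : elem set0 _ = fun=> 0) ?L0//.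
by apply/funext => w; rewrite /elem in_set0.
Qed.

Let set_charge_fin B : measurable B -> set_charge B \is a fin_num.
Proof. by []. Qed.

Let set_charge_sigma_additive : semi_sigma_additive set_charge.
Proof.
move=> F mF tF mUF.
pose U n := \big[setU/set0]_(0 <= i < n) F i.
have mU n : measurable (U n) by exact: bigsetU_measurable.
have UE n : U n = \bigcup_(i < n) F i by rewrite /U big_mkord bigcup_mkord.
have sumE n : (\sum_(0 <= i < n) set_charge (F i))%E = set_charge (U n).
  elim: n => [|n IH]; first by rewrite big_geq// /U big_geq// set_charge0.
  rewrite big_nat_recr//= IH /U big_nat_recr//= -/(U n).
  rewrite /set_charge setIUl -EFinD L_setU//; [exact: fI|exact: fI|].
  apply/disj_setPS => w [[Uw _] [Fw _]]; move: Uw; rewrite UE => -[i /= ni Fi].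
  have := tF i n I I; move=> /(_ (ex_intro _ w (conj Fi Fw))) E.
  by move: ni; rewrite E ltnn.
(* The remainders of the union decrease to the empty set, so that sigma-additivity follows from
   [L_vanishing]. *)
pose D n := (\bigcup_n F n `\` U n) `&` A.
have vD : vanishing D.
  split.
  - by move=> n; apply: measurableI; [exact: measurableD|case: fA].
  - move=> i j ij; apply/subsetPset => w [[Fw Uw] Aw]; split => //; split => // Ui.
    apply: Uw; move: Ui; rewrite !UE => -[l /= li Fl]; exists l => //=.
    exact: leq_trans ij.
  - apply/seteqP; split => // w hw.
    have [[[i _ Fi] _] _] := hw 0%N I.
    by have [[_ Ui] _] := hw i.+1 I; apply: Ui; rewrite UE; exists i => /=.
have fD : fin_set mu (D 0%N).
  by apply: sub_fin_set fA; [case: vD|move=> w []].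
have DE n : L (elem (U n `&` A) 1) = L (elem (\bigcup_n F n `&` A) 1) - L (elem (D n) 1).
  apply/eqP; rewrite eq_sym subr_eq -L_setU//.
  - rewrite /D -setIUl; apply/eqP; congr (L (elem (_ `&` _) _)).
    rewrite setDUK// UE => w [i _ Fi]; by exists i.
  - exact: fI.
  - by apply: fI; exact: measurableD.
  - by apply/disj_setPS => w [[? _] [[_ ?] _]].
rewrite (_ : (fun n => _) = (fun n => (L (elem (\bigcup_n F n `&` A) 1) - L (elem (D n) 1))%:E)); last first.
  by apply/funext => n; rewrite sumE /set_charge DE.
rewrite /set_charge; apply: cvg_EFin; first exact: nearW.
rewrite -[X in _ --> X]subr0; apply: cvgB; first exact: cvg_cst.
exact: L_vanishing.
Qed.

HB.instance Definition _ := isCharge.Build _ _ _ set_charge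
  set_charge0 set_charge_fin set_charge_sigma_additive.

Lemma density : exists rho : T -> R,
  [/\ measurable_fun [set: T] rho, mu.-integrable [set: T] (EFin \o rho),
      forall w, ~ A w -> rho w = 0
    & forall B, measurable B -> B `<=` A -> L (elem B 1) = \int[mu]_(w in B) rho w].
Proof using L_lin L_vanishing L_null fA.
have [mA Aoo] := fA.
(* Restricted to [A], the arbitrary measure [mu] becomes finite, as Radon-Nikodym demands; [L_null]
   supplies the absolute continuity. *)
pose m : {finite_measure set T -> \bar R} := mfrestr mA Aoo.
pose nu : {charge set T -> \bar R} := set_charge.
have dom : nu `<< m.
  apply/null_content_dominatesP => B mB mB0.
  rewrite /nu/= /set_charge L_null//; exact: fI.
pose f := Radon_Nikodym nu m.
have mf : measurable_fun [set: T] f.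
  by apply: measurable_int; exact: (Radon_Nikodym_integrable dom).
have fE B : measurable B -> B `<=` A -> (L (elem B 1))%:E = (\int[mu]_(w in B) f w)%E.
  move=> mB BA; rewrite -(@eq_measure_integral _ _ _ B mu m); last first.
    by move=> X mX XB; rewrite /m/= /mfrestr /mrestr setIidl//; exact: subset_trans BA.
  by rewrite -(Radon_Nikodym_integral dom)// /nu/= /set_charge setIidl.
pose rho w := if w \in A then fine (f w) else 0.
have rhoE : rho = (fine \o f) \_ A by apply/funext => w; rewrite /rho /patch.
have mrho : measurable_fun [set: T] rho.
  rewrite rhoE; apply/(measurable_restrictT _ mA); apply: measurable_funTS.
  exact: measurableT_comp.
have ffin w : f w \is a fin_num by exact: (Radon_Nikodym_fin_num w dom).
have irho : mu.-integrable [set: T] (EFin \o rho).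
  have : m.-integrable [set: T] f by exact: (Radon_Nikodym_integrable dom).
  move=> /(integrableS measurableT mA (@subsetT _ _)) /integrableP[_ hf].
  apply/integrableP; split; first exact/measurable_EFinP.
  rewrite (_ : (fun x => _) = (fun x => `|f x|%E) \_ A)%E; last first.
    apply/funext => w; rewrite /rho /patch /=; case: ifP => _; last by rewrite normr0.
    by rewrite -[in RHS](fineK (ffin w)).
  rewrite -integral_mkcond (@eq_measure_integral _ _ _ A m mu)// => X mX XA.
  by rewrite /m/= /mfrestr /mrestr setIidl.
exists rho; split => //.
  by move=> w Aw; rewrite /rho memNset.
move=> B mB BA; rewrite /Rintegral (_ : (\int[mu]_(w in B) (rho w)%:E)%E = (\int[mu]_(w in B) f w)%E).
  by rewrite -fE.
apply: eq_integral => w /set_mem Bw; rewrite /rho mem_set ?fineK//.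
exact: BA.
Qed.

End Density.

(** * From local densities to an element of the real L_p space *)

Section RealRepresentation.
Context {d} {T : measurableType d} {R : realType}.
Variables (mu : {measure set T -> \bar R}) (p : \bar R) (p1 : (1 <= p)%E).
Variables (L : (T -> R) -> R) (b : R).
Local Notation th := (theta p).
Hypothesis L_lin : forall (a : R) s t, simple mu s -> simple mu t ->
  L (fun w => a * s w + t w) = a * L s + L t.
Hypothesis L_vanishing : forall D, vanishing D -> fin_set mu (D 0%N) ->
  (fun n => L (elem (D n) 1)) @ \oo --> (0 : R).
Hypothesis L_null : forall B, fin_set mu B -> mu B = 0%E -> L (elem B 1) = 0.
Hypothesis b_gt0 : 0 < b.
Hypothesis L_test : forall s G, simple mu s -> simple mu G -> (forall w, 0 <= G w) ->
  (forall w, `|s w| <= dual_powR th (G w)) ->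
  L s <= b * (th + (1 - th) * \int[mu]_w G w).

Let rho_ex (A : set T) : exists rho : T -> R,
  [/\ measurable_fun [set: T] rho, mu.-integrable [set: T] (EFin \o rho),
      forall w, ~ A w -> rho w = 0
    & fin_set mu A -> forall B, measurable B -> B `<=` A -> L (elem B 1) = \int[mu]_(w in B) rho w].
Proof.
have [fA|fA] := pselect (fin_set mu A).
  by have [rho [h1 h2 h3 h4]] := density L_lin L_vanishing L_null fA; exists rho.
by exists (fun=> 0); split => //; exact: integrable0.
Qed.

Let rho (A : set T) : T -> R := projT1 (cid (rho_ex A)).

Let rho_measurable A : measurable_fun [set: T] (rho A).
Proof. by rewrite /rho; case: cid => r []. Qed.

Let rho_integrable A : mu.-integrable [set: T] (EFin \o rho A).
Proof. by rewrite /rho; case: cid => r []. Qed.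

Let rho_out A w : ~ A w -> rho A w = 0.
Proof. by rewrite /rho; case: cid => r [? ? h ?]; exact: h. Qed.

Let rho_L A B : fin_set mu A -> measurable B -> B `<=` A ->
  L (elem B 1) = \int[mu]_(w in B) rho A w.
Proof. by rewrite /rho; case: cid => r [? ? ? h] fA; exact: h. Qed.

Let rho_sub A A' : fin_set mu A -> fin_set mu A' -> A `<=` A' ->
  {ae mu, forall w, A w -> rho A w = rho A' w}.
Proof.
move=> fA fA' AA'; have [mA _] := fA.
have iS X B : measurable B -> mu.-integrable B (EFin \o rho X).
  by move=> mB; apply: integrableS (rho_integrable X).
suff h : ae_eq mu A (EFin \o rho A) (EFin \o rho A') by apply: filterS h => w h /h [].
apply: integral_ae_eq => //; [exact: iS|exact: measurable_int (iS A' A mA)|].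
move=> B BA mB; have h1 := rho_L fA mB BA.
have h2 := rho_L fA' mB (subset_trans BA AA').
rewrite -(fineK (integrable_fin_num mB (iS A _ mB))) -(fineK (integrable_fin_num mB (iS A' _ mB))).
by congr EFin; rewrite -[LHS]h1 -[RHS]h2.
Qed.

Let L_rho A s : fin_set mu A -> simple mu s -> support_of s `<=` A ->
  L s = \int[mu]_w (s w * rho A w).
Proof.
move=> fA ss sA; have [mA _] := fA.
pose c (s : T -> R) w := s w * \1_A w.
have sc t : simple mu t -> simple mu (c t).
  move=> st; have -> : c t = fun w => t w * elem (A `&` support_of t) 1 w.
    apply/funext => w; rewrite /c /elem indicE in_setI.
    have [->|tw] := eqVneq (t w) 0; first by rewrite !mul0r.
    by rewrite [X in _ && X]mem_set ?andbT; [case: (w \in A)|exact/eqP].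
  apply: (simple_map2 (phi := *%R)) => //; first by rewrite mulr0.
  by apply: simple_elem; rewrite setIC; case: st => _ _ h; exact: (fin_setIl h mA).
have ir t : simple mu t -> mu.-integrable [set: T] (EFin \o (fun w => t w * rho A w)).
  move=> st; apply: (simple_family_integrable (f := fun z w => z * rho A w) st) => z.
  by rewrite (_ : EFin \o _ = (fun w => z%:E * (rho A w)%:E))%E//; apply: integrableZl => //; exact: rho_integrable.
suff h t : simple mu t -> L (c t) = \int[mu]_w (t w * rho A w).
  rewrite -h//; congr L; apply/funext => w; rewrite /c indicE.
  have [->|sw] := eqVneq (s w) 0; first by rewrite mul0r.
  by rewrite mem_set ?mulr1//; apply: sA; exact/eqP.
move: t; apply: simple_ind.
- rewrite (_ : c 0 = fun=> 0); last by apply/funext => w; rewrite /c mul0r.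
  rewrite (L0 L_lin) /Rintegral integral0_eq//= => w _.
  by rewrite mul0r.
- move=> v w sv sw hv hw.
  rewrite (_ : c (v + w) = fun x => 1 * c v x + c w x); last first.
    by apply/funext => x; rewrite mul1r /c -mulrDl.
  rewrite L_lin; [|exact: sc|exact: sc].
  rewrite mul1r hv hw -RintegralD//; [|exact: ir|exact: ir].
  by apply: eq_Rintegral => x _; rewrite -mulrDl.
move=> B z fB; have fBA : fin_set mu (B `&` A) by apply: fin_setIl.
have -> : c (elem B z) = fun w => z * elem (B `&` A) 1 w + 0.
  apply/funext => w; rewrite /c /elem addr0 indicE in_setI.
  by case: (w \in B); case: (w \in A); rewrite /= ?mulr1 ?mulr0 ?mul0r.
rewrite (L_lin z (simple_elem 1 fBA) (simple0 mu R)) (L0 L_lin) addr0.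
rewrite (rho_L fA); [|by case: fBA|by move=> w []].
rewrite -RintegralZl; [|by case: fBA|by apply: integrableS (rho_integrable A) => //; case: fBA].
rewrite Rintegral_mkcond; apply: eq_Rintegral => w _.
rewrite /patch /elem in_setI; case: (w \in B); rewrite /= ?mul0r//.
by case: ifPn => // wA; rewrite rho_out ?mulr0// => Aw; move: wA; rewrite mem_set.
Qed.

Let rho_weight A : fin_set mu A ->
  [/\ weight mu (test_weight p b (fun w => `|rho A w|)),
      \int[mu]_w (test_weight p b (fun w => `|rho A w|) w) <= 1
    & {ae mu, forall w, `|rho A w| <= b * test_weight p b (fun w => `|rho A w|) w `^ th}].
Proof.
move=> fA; have [mA Aoo] := fA; have [P AP] := piece_cover (p1 := p1) fA.
apply: (@test_weightP _ _ _ mu p p1 P) => //.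
- exact: measurableT_comp.
- by move=> w Pw; rewrite rho_out ?normr0// => /AP.
- move=> _ e e0; apply: le_lt_trans Aoo; apply: le_measure; rewrite ?inE//.
    rewrite (_ : [set w | _] = [set: T] `&` (fun w => `|rho A w|) @^-1` [set` `]e, +oo[]).
      by have mn : measurable_fun [set: T] (fun w => `|rho A w|) by [exact: measurableT_comp]; exact: mn.
    by apply/seteqP; split => w; rewrite /= in_itv/= andbT => // -[].
  move=> w /= ew; apply: contrapT => Aw.
  by move: ew; rewrite rho_out// normr0 ltNge (ltW e0).
move=> G sG G0 GP.
(* With this sign, [L] at [sg * G ^ (1 - th)] is the integral of [|rho A| * G ^ (1 - th)], so
   [L_test] becomes the hypothesis of [test_weightP]. *)
pose sg w := Num.sg (rho A w).
have ssg : simple mu sg.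
  apply: (measurable_simple _ _ fA).
  - rewrite (_ : sg = fun w => if 0 < rho A w then 1 else if rho A w < 0 then -1 else 0); last first.
      by apply/funext => w; rewrite /sg; case: sgrP.
    apply: measurable_fun_ifT => //; first exact: measurable_fun_ltr.
    apply: measurable_fun_ifT => //; exact: measurable_fun_ltr.
  - apply: (@sub_finite_set _ _ [set` [:: 1; -1; 0 : R]]); last exact: finite_seq.
    move=> _ [w _ <-] /=; rewrite /sg !inE.
    by case: sgrP => _; rewrite eqxx ?orbT.
  - move=> w; rewrite /support_of/= /sg => h; apply: contrapT => Aw; apply: h.
    by rewrite rho_out// sgr0.
pose s w := sg w * dual_powR th (G w).
have ss : simple mu s.
  by apply: (simple_map2 (phi := fun x y => x * dual_powR th y)) => //; rewrite mul0r.
have sA : support_of s `<=` A.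
  move=> w; rewrite /support_of/= /s /sg => h; apply: contrapT => Aw; apply: h.
  by rewrite rho_out// sgr0 mul0r.
have := L_test ss sG G0; rewrite (L_rho fA ss sA) => /(_ _) hL.
have {}hL : \int[mu]_w (s w * rho A w) <= b * (th + (1 - th) * \int[mu]_w G w).
  apply: hL => w; rewrite /s normrM (ger0_norm (dual_powR_ge0 _ _)).
  by rewrite ler_piMl ?dual_powR_ge0// /sg normr_sg lern1 leq_b1.
have i1 : mu.-integrable [set: T] (EFin \o (fun w => s w * rho A w)).
  apply: (simple_family_integrable (f := fun z w => z * rho A w) ss) => z.
  by rewrite (_ : EFin \o _ = (fun w => z%:E * (rho A w)%:E))%E//; apply: integrableZl => //; exact: rho_integrable.
apply: (@le_trans _ _ (\int[mu]_w (s w * rho A w))%:E); last by rewrite lee_fin.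
rewrite fineK; last exact: integrable_fin_num.
rewrite le_eqVlt; apply/orP; left; apply/eqP; apply: eq_integral => w _.
by rewrite /s mulrAC /sg -normrEsg.
Qed.

Let represented (f : piece mu p -> T -> R) (W : T -> R) :
  (forall A, measurable_fun (sval A) (f A)) ->
  (forall A B : piece mu p, {ae mu, forall w, sval A w -> sval B w -> f A w = f B w}) ->
  weight mu W -> \int[mu]_w W w <= 1 ->
  (forall A : piece mu p, {ae mu, forall w, sval A w -> `|f A w| <= b * W w `^ th}) ->
  (forall B (A : piece mu p), fin_set mu B -> B `<=` sval A -> {ae mu, forall w, B w -> f A w = rho B w}) ->
  exists y : Lp RealScalars mu p1, forall B, fin_set mu B -> pairing y B = L (elem B 1).
Proof.
move=> mf cf wW W1 fW frho.
have fP : (f : piece mu p -> T -> Defs.scalar R RealScalars) \in Lpfun_pred RealScalars mu p1.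
  have mf' : @piecewise_measurable _ _ _ RealScalars mu p f.
    by move=> A; split; [exact: mf|exact: measurable_cst].
  apply/asboolP; split => //.
  apply: (@le_lt_trans _ _ b%:E); last by rewrite ltry.
  apply/(eLpnorm_leP p1 b_gt0 mf'); exists W; split => // A.
  by apply: filterS (fW A) => w h /h; rewrite modulus_real.
exists (\pi_(Lp RealScalars mu p1) (MkLpfun fP))%qT => B fB.
have [A BA] := piece_cover (p1 := p1) fB; have [mB _] := fB.
rewrite (rho_L fB mB)// Rintegral_mkcond.
apply: eq_ae_Rintegral.
- exact: rep_on_integrable.
- by rewrite -(restrict_EFin); apply/integrable_restrict => //; rewrite ?setTI //; apply: integrableS (rho_integrable B).
apply: filterS3 (rep_onE (\pi_(Lp RealScalars mu p1) (MkLpfun fP))%qT BA) (rep_pi (MkLpfun fP) A) (frho B A fB BA).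
move=> w -> h1 h2; rewrite /patch; case: ifPn => // /set_mem Bw.
by have Aw := BA _ Bw; rewrite /= (h1 Aw) /= h2.
Qed.

Let m (A : set T) : R := \int[mu]_w test_weight p b (fun w => `|rho A w|) w.

Section Glue.
Variable r : R.
Hypothesis pE : p = r%:E.

Let r_gt0 : 0 < r.
Proof. by move: p1; rewrite pE lee_fin; exact: lt_le_trans. Qed.

Let twE (H : T -> R) : test_weight p b H = fun w => (H w / b) `^ r.
Proof. by rewrite /test_weight pE. Qed.

Let thE : th = r^-1. Proof. by rewrite /theta pE. Qed.

Let m_add A D : fin_set mu A -> fin_set mu D -> A `&` D = set0 -> m (A `|` D) = m A + m D.
Proof.
move=> fA fD AD0; have fAD := fin_setU fA fD.
have [[_ iA] _ _] := rho_weight fA; have [[_ iD] _ _] := rho_weight fD.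
have [[_ iAD] _ _] := rho_weight fAD.
rewrite /m -RintegralD//; apply: eq_ae_Rintegral => //.
  by rewrite (_ : EFin \o _ = ((EFin \o test_weight p b (fun w => `|rho A w|)%R) \+ (EFin \o test_weight p b (fun w => `|rho D w|)%R))%E)//; exact: integrableD.
apply: filterS2 (rho_sub fA fAD (@subsetUl _ _ _)) (rho_sub fD fAD (@subsetUr _ _ _)) => w hA hD.
have z0 : (`|0 : R| / b) `^ r = 0 by rewrite normr0 mul0r powR0// gt_eqF.
have [Aw|Aw] := pselect (A w).
  have Dw : ~ D w by move=> Dw; have : (A `&` D) w by []; rewrite AD0.
  by rewrite !twE -hA// [rho D w]rho_out// z0 addr0.
rewrite !twE [rho A w]rho_out// z0 add0r.
have [Dw|Dw] := pselect (D w); first by rewrite -hD.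
by rewrite !rho_out// => -[].
Qed.

Let m_eq0 D : fin_set mu D -> m D = 0 -> {ae mu, forall w, rho D w = 0}.
Proof.
move=> fD mD0; have [wD _ hD] := rho_weight fD; have [D0 iD] := wD.
have h : {ae mu, forall w, setT w -> (test_weight p b (fun w => `|rho D w|) w)%:E = 0%E}.
  apply/(ae_eq_integral_abs mu measurableT (measurable_int _ iD)).
  under eq_integral do rewrite gee0_abs ?lee_fin//.
  by rewrite -weight_int// -/(m D) mD0.
apply: filterS2 h hD => w /(_ I) [->].
by rewrite thE powR0 ?invr_neq0 ?gt_eqF// mulr0 normr_le0 => /eqP.
Qed.

Let m_le1 A : fin_set mu A -> m A <= 1.
Proof. by move=> fA; have [] := rho_weight fA. Qed.

(** For finite [p] the set function [m] is additive on disjoint sets and at most 1. Countably many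
    sets approaching its supremum exhaust the densities: outside their union each [rho D] vanishes
    a.e., so [h] is assembled from countably many pieces even if [mu] is not sigma-finite. *)
Lemma glued : exists h : T -> R,
  [/\ measurable_fun [set: T] h, weight mu (test_weight p b (fun w => `|h w|)),
      \int[mu]_w (test_weight p b (fun w => `|h w|) w) <= 1
    & forall A, fin_set mu A -> {ae mu, forall w, A w -> h w = rho A w}].
Proof using L_lin L_null L_test L_vanishing b_gt0 p1 pE.
pose M := [set m A | A in fin_set mu].
have M0 : has_sup M.
  split; first by exists (m set0), set0 => //; exact: fin_set0.
  by exists 1 => _ [A fA <-]; exact: m_le1.
have /choice[A hA] : forall n, exists A, fin_set mu A /\ sup M - n.+1%:R^-1 < m A.
  move=> n; have [_ [A fA <-] h] := @sup_adherent _ M n.+1%:R^-1 ltac:(by rewrite invr_gt0) M0.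
  by exists A.
have fA n := (hA n).1.
pose U n := \big[setU/set0]_(i < n) A i.
have fU n : fin_set mu (U n).
  elim: n => [|n IH]; first by rewrite /U big_ord0; exact: fin_set0.
  by rewrite /U big_ord_recr/=; exact: fin_setU.
pose B := seqDU A.
have tB : trivIset setT B := trivIset_seqDU A.
have BA n : B n `<=` A n by exact: subDsetl.
have mB n : measurable (B n).
  by apply: measurableD; [case: (fA n)|case: (fU n)].
have fB n : fin_set mu (B n) by exact: (sub_fin_set (mB n) (BA n) (fA n)).
have BU : \bigcup_n B n = \bigcup_n A n by rewrite /B -seqDU_bigcup_eq.
have mBU : measurable (\bigcup_n B n) by exact: bigcupT_measurable.
pose h w := match pselect (exists n, B n w) with
  | left e => rho (B (projT1 (cid e))) w | right _ => 0 end.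
have hB n w : B n w -> h w = rho (B n) w.
  move=> Bnw; rewrite /h; case: pselect => [e|[]]; last by exists n.
  case: cid => j /= Bjw; congr (rho (B _) w).
  by apply: tB => //; exists w.
have hout w : ~ (\bigcup_n B n) w -> h w = 0.
  by move=> Bw; rewrite /h; case: pselect => // -[n Bn]; exfalso; apply: Bw; exists n.
have mh : measurable_fun [set: T] h.
  move=> _ Y mY; rewrite setTI.
  rewrite (_ : h @^-1` Y = \bigcup_n (B n `&` rho (B n) @^-1` Y) `|` (~` (\bigcup_n B n) `&` [set _ | Y 0])).
    apply: measurableU.
      apply: bigcupT_measurable => n; apply: measurableI => //.
      by rewrite -[X in measurable X]setTI; exact: rho_measurable.
    by apply: measurableI; [exact: measurableC|exact: measurable_cst_set].
  apply/seteqP; split => w /=.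
    have [Bw|Bw] := pselect ((\bigcup_n B n) w).
      by have [n _ Bn] := Bw; rewrite (hB n)//; left; exists n.
    by rewrite hout//; right.
  by move=> [[n _ [Bn /=]]|[Bw]]; [rewrite (hB n)|rewrite hout].
have hrho D : fin_set mu D -> {ae mu, forall w, D w -> h w = rho D w}.
  move=> fD; have [mD _] := fD.
  pose E := D `\` \bigcup_n B n.
  have fE : fin_set mu E by apply: (sub_fin_set _ _ fD); [exact: measurableD|move=> w []].
  have mE0 : m E = 0.
    apply/eqP; rewrite eq_le; apply/andP; split; last first.
      by apply: Rintegral_ge0 => w _; have [[? _] _ _] := rho_weight fE.
    apply/ler_addgt0Pr => e e0; rewrite add0r.
    have [n] : exists n : nat, n.+1%:R^-1 < e.
      exists (Num.truncn e^-1).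
      by rewrite -[ltRHS]invrK ltf_pV2 ?posrE ?invr_gt0// truncnS_gt.
    move=> /ltW; apply: le_trans.
    (* [A n] comes within [1 / (n + 1)] of the supremum and is disjoint from [E], so additivity
       leaves at most that much for [m E]. *)
    have := m_add (fA n) fE.
    rewrite (_ : A n `&` E = set0); last first.
      apply/seteqP; split => // w [An [_]]; apply.
      by rewrite BU; exists n.
    move=> /(_ erefl) mAE; have := (hA n).2.
    have : m (A n `|` E) <= sup M.
      by apply: sup_ubound; [case: M0|exists (A n `|` E) => //; exact: fin_setU].
    rewrite mAE => le1 lt1; rewrite -(lerD2l (m (A n))); apply: le_trans le1 _.
    by rewrite -lerBlDr ltW.
  have h1 : {ae mu, forall w, forall n, B n w -> D w -> h w = rho D w}.
    apply/ae_foralln => n.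
    have fDB : fin_set mu (D `&` B n) by exact: fin_setIl.
    apply: filterS2 (rho_sub fDB fD (@subIsetl _ _ _)) (rho_sub fDB (fB n) (@subIsetr _ _ _)).
    by move=> w e1 e2 Bw Dw; rewrite (hB n)// -e1// -e2.
  have ED : E `<=` D by move=> w [].
  apply: filterS3 h1 (m_eq0 fE mE0) (rho_sub fE fD ED) => w e1 e2 e3 Dw.
  have [[n _ Bw]|Bw] := pselect ((\bigcup_n B n) w); first exact: (e1 n).
  by rewrite hout// -e3// e2.
pose W := test_weight p b (fun w => `|h w|).
have W0 w : 0 <= W w by rewrite /W twE powR_ge0.
have mW : measurable_fun [set: T] W.
  rewrite /W twE; apply: (measurableT_comp (measurable_powR r)) => //.
  by apply: measurable_funM => //; exact: measurableT_comp.
have intW : (\int[mu]_w (W w)%:E <= 1)%E.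
  have ndU : nondecreasing_seq U.
    by move=> i j ij; apply/subsetPset; exact: subset_bigsetU.
  have WU n : (\int[mu]_(w in U n) (W w)%:E <= 1)%E.
    have [[U0 iU] U1 _] := rho_weight (fU n).
    apply: (@le_trans _ _ (\int[mu]_w (test_weight p b (fun w => `|rho (U n) w|) w)%:E)%E); last first.
      by rewrite -weight_int// lee_fin.
    have mUn : measurable (U n) by case: (fU n).
    apply: (@le_trans _ _ (\int[mu]_(w in U n) (test_weight p b (fun w => `|rho (U n) w|) w)%:E)%E); last first.
      apply: ge0_subset_integral => //; first exact: measurable_int iU.
      by move=> w _; rewrite lee_fin.
    rewrite le_eqVlt; apply/orP; left; apply/eqP; apply: ae_eq_integral => //.
    - by apply/measurable_EFinP; exact: measurable_funTS.
    - by apply: measurable_funTS; exact: measurable_int iU.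
    by apply: filterS (hrho _ (fU n)) => w hw Uw; rewrite /W !twE hw.
  (* [h] vanishes off the union, so the integral of [W] is the limit of its integrals over the
     [U n], each of them at most [m (U n)]. *)
  have -> : (\int[mu]_w (W w)%:E = \int[mu]_(w in \bigcup_n U n) (W w)%:E)%E.
    rewrite [RHS]integral_mkcond; apply: eq_integral => w _; rewrite /patch.
    case: ifPn => // wU; rewrite /W twE hout ?normr0 ?mul0r ?powR0 ?gt_eqF//.
    rewrite BU => -[n _ An]; move: wU; rewrite mem_set//; exists n.+1 => //.
    by rewrite /U big_ord_recr/=; right.
  have mEW : measurable_fun [set: T] (EFin \o W) by exact/measurable_EFinP.
  have := @ge0_nondecreasing_set_cvg_integral _ _ _ U (EFin \o W) mu ndU
    (fun n => (fU n).1) (fun n => measurable_funTS mEW)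
    (fun n w _ => W0 w).
  move=> hc; rewrite -(cvg_lim _ hc)//; apply: lime_le; last exact: nearW.
  by apply/cvg_ex; eexists; exact: hc.
have wW : weight mu W.
  split => //; apply/integrableP; split; first exact/measurable_EFinP.
  under eq_integral do rewrite gee0_abs ?lee_fin//.
  by apply: le_lt_trans intW _; rewrite ltry.
by exists h; split => //; rewrite -lee_fin weight_int.
Qed.

End Glue.

Lemma real_representation :
  exists y : Lp RealScalars mu p1, forall B, fin_set mu B -> pairing y B = L (elem B 1).
Proof using L_lin L_null L_test L_vanishing b_gt0 p1.
have [[r pE]|pE] : (exists r, p = r%:E) \/ p = +oo%E.
  by move: p1; case: p => [r| |]// _; [left; exists r|right].
- have [h [mh wh h1 hrho]] := glued pE.
  have r0 : 0 < r by move: p1; rewrite pE lee_fin; exact: lt_le_trans.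
  apply: (@represented (fun=> h) (test_weight p b (fun w => `|h w|))) => //.
  + by move=> A; exact: measurable_funTS.
  + by move=> A B; exact: nearW.
  + move=> A; apply: nearW => w _; rewrite /test_weight /theta pE -powRrM mulfV ?gt_eqF//.
    by rewrite powRr1 ?divr_ge0 ?(ltW b_gt0)// mulrC divfK// gt_eqF.
  + by move=> B A fB _; exact: hrho.
have fP (A : piece mu p) : fin_set mu (sval A).
  by case: A => A /=; rewrite /piece_pred pE.
apply: (@represented (fun A => rho (sval A)) (fun=> 0)).
- by move=> A; exact: measurable_funTS.
- move=> A B; have fAB : fin_set mu (sval A `&` sval B).
    by apply: fin_setIl; [exact: fP|case: (fP B)].
  apply: filterS2 (rho_sub fAB (fP A) (@subIsetl _ _ _)) (rho_sub fAB (fP B) (@subIsetr _ _ _)).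
  by move=> w e1 e2 Aw Bw; rewrite -e1// -e2.
- exact: weight0.
- by rewrite /Rintegral integral0.
- move=> A; have [_ _] := rho_weight (fP A).
  have tw0 (H : T -> R) : test_weight p b H = fun=> 0 by rewrite /test_weight pE.
  by rewrite tw0; apply: filterS.
by move=> B A fB BA; apply: filterS (rho_sub fB (fP A) BA) => w h Bw; rewrite h.
Qed.

End RealRepresentation.

(** * Phases, and uniqueness of pairings *)

Section PhaseGrid.
Context {R : realType} {k : scalar_kind}.
Local Notation K := (Defs.scalar R k).

(** Grid points of the unit disc. The conjugate phase of [z] is rounded towards 0 in each
    coordinate, which keeps the modulus at most 1 and loses little of the real part. *)
Lemma phase_grid (e : R) : 0 < e -> exists Th : seq K,
  (forall a, a \in Th -> modulus a <= 1) /\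
  (forall z, exists2 a, a \in Th & (1 - e) * modulus z <= re_part (a * z)).
Proof.
(* Each of the two coordinates loses at most [1 / n]. *)
move=> e0; pose n := (Num.truncn (2 / e)).+1.
have n0 : 0 < n%:R :> R by rewrite ltr0n.
have n2 : 2 / n%:R <= e by rewrite ler_pdivrMr// mulrC -ler_pdivrMr// ltW// truncnS_gt.
pose val (sj : R * nat) : R := sj.1 * (sj.2%:R / n%:R).
pose vals : seq (R * nat) := [seq (s, j) | s <- [:: 1; -1], j <- iota 0 n.+1].
pose tr (x : R) : R * nat := (if x < 0 then -1 else 1, Num.truncn (n%:R * `|x|)).
have trP x : `|x| <= 1 -> [/\ tr x \in vals, `|val (tr x)| <= `|x|
    & x ^+ 2 - `|x| / n%:R <= val (tr x) * x].
  move=> x1; have nx0 : 0 <= n%:R * `|x| by rewrite mulr_ge0// ltW.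
  have /andP[t1 t2] := truncn_itv nx0.
  have tx : (Num.truncn (n%:R * `|x|))%:R / n%:R <= `|x| by rewrite ler_pdivrMr// [leRHS]mulrC.
  have xt : `|x| - n%:R^-1 <= (Num.truncn (n%:R * `|x|))%:R / n%:R.
    rewrite lerBlDr -[X in _ + X]mul1r -mulrDl ler_pdivlMr// [leLHS]mulrC.
    by apply: ltW; rewrite natr1.
  have valE : val (tr x) * x = (Num.truncn (n%:R * `|x|))%:R / n%:R * `|x|.
    rewrite /val /tr /=; case: ltrP => hx; [rewrite ltr0_norm//|rewrite ger0_norm//].
      by ring.
    by ring.
  split.
  - apply/allpairsP; exists (tr x); split => //.
      by rewrite /tr /=; case: ifP; rewrite !inE eqxx ?orbT.
    rewrite mem_iota /= add0n ltnS -(ler_nat R); apply: le_trans t1 _.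
    by rewrite ler_piMr// ltW.
  - rewrite /val /tr /= normrM [X in X * _](_ : _ = 1) ?mul1r; last first.
      by case: ifP; rewrite ?normrN1 ?normr1.
    by rewrite ger0_norm// divr_ge0// ltW.
  rewrite valE -real_normK ?num_real// expr2 -[`|x| / _]mulrC -mulrBl.
  by rewrite ler_wpM2r.
pose el (ab : (R * nat) * (R * nat)) : K := of_real k (val ab.1) + imag * of_real k (val ab.2).
exists [seq a <- [seq el (s, t) | s <- vals, t <- vals] | modulus a <= 1]; split.
  by move=> a; rewrite mem_filter => /andP[].
move=> z; have [z0|z0] := eqVneq (modulus z) 0.
  pose a := el (tr 0, tr 0).
  have v0 : val (tr 0) = 0.
    by rewrite /val /tr /= ltxx normr0 mulr0 truncn0 mul0r mulr0.
  exists a; last by rewrite z0 mulr0 (modulus_eq0 z0) mulr0 re_part0.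
  rewrite mem_filter; apply/andP; split.
    by rewrite /a /el /= v0 of_real0 mulr0 addr0 modulus0.
  have [t0 _ _] := trP 0 ltac:(by rewrite normr0).
  by apply/allpairsP; exists (tr 0, tr 0).
have zp : 0 < modulus z by rewrite lt_neqAle eq_sym z0 modulus_ge0.
have zp' := ltW zp.
(* [c + imag * s] is the conjugate of [z] divided by its modulus; over real scalars [s] is 0. *)
pose c := re_part z / modulus z; pose s := - im_part z / modulus z.
have cs : c ^+ 2 + s ^+ 2 = 1.
  by rewrite /c /s !expr_div_n sqrrN -mulrDl -modulus_sqr divff// expf_eq0.
have c1 : `|c| <= 1.
  by rewrite -(@ler_pXn2r _ 2) ?nnegrE// expr1n real_normK ?num_real// -cs lerDl sqr_ge0.
have s1 : `|s| <= 1.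
  by rewrite -(@ler_pXn2r _ 2) ?nnegrE// expr1n real_normK ?num_real// -cs lerDr sqr_ge0.
have [tc1 tc2 tc3] := trP c c1; have [ts1 ts2 ts3] := trP s s1.
exists (el (tr c, tr s)).
  rewrite mem_filter; apply/andP; split; last first.
    by apply/allpairsP; exists (tr c, tr s).
  rewrite /el /=.
  have bnd : val (tr c) ^+ 2 + val (tr s) ^+ 2 <= 1.
    rewrite -cs; apply: lerD; rewrite -[leLHS]real_normK ?num_real// -[leRHS]real_normK ?num_real//;
      by rewrite ler_pXn2r ?nnegrE.
  rewrite -(@ler_pXn2r _ 2) ?nnegrE ?modulus_ge0// expr1n modulus_sqr.
  rewrite re_partD im_partD re_part_imag re_part_of_real !im_part_of_real oppr0 addr0 add0r.
  rewrite im_partM im_part_of_real re_part_of_real mulr0 add0r.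
  apply: le_trans bnd; rewrite lerD2l.
  have : im_part (imag : K) ^+ 2 <= 1 by rewrite /im_part /imag; case: (k); rewrite /= ?expr0n ?expr1n.
  by move=> h; rewrite exprMn ler_piMl ?sqr_ge0.
have -> : re_part (el (tr c, tr s) * z) = val (tr c) * re_part z - val (tr s) * im_part z.
  rewrite /el /= mulrDl re_partD re_partMr -mulrA re_part_imag.
  rewrite im_partM im_part_of_real re_part_of_real mul0r addr0.
  by [].
have -> : re_part z = modulus z * c by rewrite /c mulrCA mulfV ?mulr1// gt_eqF.
have -> : im_part z = - (modulus z * s) by rewrite /s mulrCA mulfV ?mulr1 ?opprK// gt_eqF.
rewrite [leRHS](_ : _ = (val (tr c) * c + val (tr s) * s) * modulus z); last by ring.
rewrite ler_wpM2r//; apply: le_trans (lerD tc3 ts3).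
rewrite addrACA cs lerD2l -opprD lerN2 -mulrDl; apply: le_trans n2.
by rewrite ler_wpM2r ?invr_ge0 ?(ltW n0)//; lra.
Qed.

End PhaseGrid.

Section PairingFacts.
Context {d} {T : measurableType d} {R : realType} {k : scalar_kind}.
Context {mu : {measure set T -> \bar R}} {p : \bar R} {p1 : (1 <= p)%E}.
Local Notation K := (Defs.scalar R k).
Local Notation F := (Lp k mu p1).
Local Notation th := (theta p).

Lemma pairing_lin (a : R) (x y : F) B : fin_set mu B ->
  pairing (of_real k a *: x + y) B = a * pairing x B + pairing y B.
Proof.
move=> fB; rewrite /pairing.
have ix z := rep_on_integrable (z : F) fB.
have iax : mu.-integrable [set: T] (EFin \o (fun w => a * re_part (rep_on x B w))).
  rewrite (_ : EFin \o _ = (fun w => a%:E * (re_part (rep_on x B w))%:E))%E//.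
  by apply: integrableZl => //; exact: ix.
rewrite -RintegralZl//; last exact: ix.
rewrite -RintegralD//; last exact: ix.
apply: eq_ae_Rintegral; first exact: ix.
  rewrite (_ : EFin \o _ = (EFin \o (fun w => a * re_part (rep_on x B w))%R) \+ (EFin \o (fun w => re_part (rep_on y B w))))%E//.
  by apply: integrableD => //; exact: ix.
by apply: filterS (rep_on_lin (of_real k a) x y fB) => w ->; rewrite re_partD re_partMr.
Qed.

Lemma pairingZ (a : R) (x : F) B : fin_set mu B ->
  pairing (of_real k a *: x) B = a * pairing x B.
Proof.
move=> fB; have := pairing_lin a x 0 fB; have := pairing_lin 1 0 (0 : F) fB.
by rewrite scaler0 !addr0 mul1r => h ->; rewrite [pairing 0 B](_ : _ = 0) ?addr0//; lra.
Qed.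

Lemma pairingD (x y : F) B : fin_set mu B -> pairing (x + y) B = pairing x B + pairing y B.
Proof. by move=> fB; have := pairing_lin 1 x y fB; rewrite of_real1 scale1r mul1r. Qed.

Lemma weight_gt_fin (W : T -> R) (e : R) : weight mu W -> 0 < e ->
  fin_set mu [set w | e < W w].
Proof.
move=> wW e0; have mW := measurable_weight wW; have [W0 iW] := wW.
have mB : measurable [set w | e < W w].
  rewrite (_ : [set w | _] = [set: T] `&` W @^-1` [set` `]e, +oo[]); first exact: mW.
  by apply/seteqP; split => w; rewrite /= in_itv/= andbT => // -[].
split => //; have : (e%:E * mu [set w | (e < W w)%R] <= \int[mu]_w (W w)%:E)%E.
  rewrite -[X in (_ * mu X)%E]setIT -integral_indic// -ge0_integralZl ?lee_fin ?(ltW e0)//; last first.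
    exact/measurable_EFinP.
  apply: ge0_le_integral => //.
  - by move=> w _; rewrite -EFinM lee_fin mulr_ge0 ?(ltW e0).
  - by apply/measurable_EFinP; exact: measurable_funM.
  - exact/measurable_EFinP.
  move=> w _; rewrite -EFinM lee_fin indicE.
  by case: (boolP (w \in _)) => [/set_mem/= ew|_]; rewrite ?mulr1 ?mulr0//; exact: ltW.
move=> h; have : (e%:E * mu [set w | (e < W w)%R] < +oo)%E.
  by apply: le_lt_trans h _; exact: integrable_lty.
by case: (mu _) => [r| |]//; rewrite ?ltry// gt0_muley// lte_fin.
Qed.

Lemma Lp_family_le (y : F) : exists W c, [/\ 0 < c, weight mu W & family_le (rep y) W c].
Proof.
have c0 := Lpnorm1_gt0 y.
have [W [wW _ hW]] := Lp_unit_weight y.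
by exists W, (Lpnorm y + 1).
Qed.

(** For finite [p] the element [y] vanishes where its weight [W] does, and the rest is the countable
    union of the sets [W > 1 / (n + 1)], which have finite measure. For infinite [p] the pieces have
    finite measure themselves. *)
Lemma rep_on_eq0 (y : F) :
  (forall B, fin_set mu B -> {ae mu, forall w, rep_on y B w = 0}) -> y = 0.
Proof.
move=> hy; apply: rep_eq => A.
suff : {ae mu, forall w, sval A w -> rep y A w = 0}.
  by apply: filterS2 (rep0 (k := k) (p1 := p1) A) => w h1 h2 Aw; rewrite h1// h2.
have step B : fin_set mu B -> B `<=` sval A -> {ae mu, forall w, B w -> rep y A w = 0}.
  move=> fB BA; apply: filterS2 (hy B fB) (rep_onE y BA) => w -> h Bw.
  by rewrite h mem_set.
have [[r pE]|pE] : (exists r, p = r%:E) \/ p = +oo%E.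
  by move: p1; case: p => [r| |]// _; [left; exists r|right].
- have [W [c [c0 wW hW]]] := Lp_family_le y.
  pose B n := [set w | n.+1%:R^-1 < W w].
  have fB n : fin_set mu (B n) by apply: weight_gt_fin; rewrite // invr_gt0.
  have At : sval A = [set: T] by case: (A) => X /=; rewrite /piece_pred pE.
  have h n : {ae mu, forall w, B n w -> rep y A w = 0} by apply: step; rewrite // At.
  move/ae_foralln: h => h.
  apply: filterS2 h (hW A) => w h1 h2 Aw.
  have r0 : r != 0 by move: p1; rewrite pE lee_fin => /(lt_le_trans ltr01)/lt0r_neq0.
  have [W0|W0] := eqVneq (W w) 0.
    apply: modulus_eq0; apply/eqP; rewrite eq_le modulus_ge0 andbT.
    by apply: le_trans (h2 Aw) _; rewrite W0 /theta pE powR0 ?invr_neq0// mulr0.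
  have Wp : 0 < W w by rewrite lt_neqAle eq_sym W0 wW.1.
  apply: (h1 (Num.truncn (W w)^-1)); rewrite /B /=.
  by rewrite -[ltRHS]invrK ltf_pV2 ?posrE ?invr_gt0// truncnS_gt.
apply: step => //; by case: (A) => X /=; rewrite /piece_pred pE.
Qed.

Lemma pairing_setI (y : F) B C : fin_set mu B -> measurable C -> C `<=` B ->
  pairing y C = \int[mu]_(w in C) re_part (rep_on y B w).
Proof.
move=> fB mC CB; have fC := sub_fin_set mC CB fB.
rewrite /pairing [RHS]Rintegral_mkcond; apply: eq_ae_Rintegral.
- exact: rep_on_integrable.
- rewrite -restrict_EFin; apply/integrable_restrict => //; rewrite ?setTI//.
  by apply: integrableS (rep_on_integrable y fB).
apply: filterS (rep_on_sub y CB fB) => w h; rewrite /patch; case: ifPn => [/set_mem/h ->//|Cw].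
by rewrite rep_on_out ?re_part0// => Cw'; move: Cw; rewrite mem_set.
Qed.

(** A pairing sees only real parts, so the multiples by 1 and [imag] are both tested. *)
Lemma pairing_eq0 (y : F) :
  (forall (a : K) B, fin_set mu B -> pairing (a *: y) B = 0) -> y = 0.
Proof.
move=> hy; apply: rep_on_eq0 => B fB; have [mB _] := fB.
have re0 (z : F) : (forall C, fin_set mu C -> pairing z C = 0) ->
    {ae mu, forall w, re_part (rep_on z B w) = 0}.
  move=> hz; have iz := rep_on_integrable z fB.
  have izB : mu.-integrable B (EFin \o (@re_part R k \o rep_on z B)) by exact: integrableS iz.
  have : ae_eq mu B (EFin \o (@re_part R k \o rep_on z B)) (cst 0%E).
    apply: integral_ae_eq => // C CB mC; rewrite integral0.
    have iC : mu.-integrable C (EFin \o (@re_part R k \o rep_on z B)) by exact: integrableS iz.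
    rewrite -(fineK (integrable_fin_num mC iC)); congr EFin.
    by rewrite -[RHS](hz C (sub_fin_set mC CB fB)) (pairing_setI z fB).
  apply: filterS => w h; have [Bw|Bw] := pselect (B w); first by have [] := h Bw.
  by rewrite rep_on_out ?re_part0.
have h1 : {ae mu, forall w, re_part (rep_on y B w) = 0}.
  by apply: re0 => C fC; rewrite -[y]scale1r hy.
have h2 : {ae mu, forall w, re_part (rep_on (imag *: y) B w) = 0}.
  by apply: re0 => C fC; rewrite hy.
have h3 : {ae mu, forall w, rep_on (imag *: y) B w = imag * rep_on y B w}.
  have [A BA] := piece_cover (p1 := p1) fB.
  apply: filterS3 (rep_onE (imag *: y) BA) (rep_onE y BA) (repZ imag y A) => w -> -> h.
  by case: ifPn => [/set_mem/BA/h//|]; rewrite mulr0.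
apply: filterS3 h1 h2 h3 => w e1 + e3; rewrite e3 re_part_imag => /eqP.
by rewrite oppr_eq0 => /eqP e2; apply: scalar_eq; rewrite ?e1 ?e2 ?re_part0 ?im_part0.
Qed.

Lemma pairing_inj (y z : F) :
  (forall (a : K) B, fin_set mu B -> pairing (a *: y) B = pairing (a *: z) B) -> y = z.
Proof.
move=> h; apply/eqP; rewrite -subr_eq0; apply/eqP; apply: pairing_eq0 => a B fB.
rewrite scalerBr pairingD// h// -scaleN1r -of_real1 -of_realN pairingZ//.
by rewrite mulN1r subrr.
Qed.

(** [y] is [y1 - imag * y2]. The factor [- re_part (imag * imag)] is 1 over complex and 0 over real
    scalars, which gives one statement for both. *)
Lemma complexify (y1 y2 : Lp RealScalars mu p1) : exists y : F,
  forall B, fin_set mu B ->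
    pairing y B = pairing y1 B /\
    pairing (imag *: y) B = - re_part (imag * imag : K) * pairing y2 B.
Proof.
pose f (A : piece mu p) w : K :=
  of_real k (rep y1 A w : R) - imag * of_real k (rep y2 A w : R).
have i0 : re_part (imag : K) = 0 by rewrite /re_part /imag; case: (k).
have fre A w : re_part (f A w) = rep y1 A w.
  by rewrite /f re_partD re_part_of_real -mulrN -of_realN re_part_imag im_part_of_real oppr0 addr0.
have fim A w : im_part (f A w) = - (im_part (imag : K) * rep y2 A w).
  by rewrite /f im_partD im_part_of_real -mulrN -of_realN im_partM i0 mul0r add0r re_part_of_real add0r mulrN.
have mf : piecewise_measurable f.
  move=> A; have [m1 _] := rep_measurable y1 A; have [m2 _] := rep_measurable y2 A.
  split.
    by rewrite (_ : _ \o _ = fun w => rep y1 A w : R)//; apply/funext => w /=; rewrite fre.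
  rewrite (_ : _ \o _ = fun w => - im_part (imag : K) * (rep y2 A w : R)); last first.
    by apply/funext => w /=; rewrite fim mulNr.
  by apply: measurable_funM => //; exact: measurable_cst.
have fP : f \in Lpfun_pred k mu p1.
  apply/asboolP; split => //.
    move=> A B; apply: filterS2 (rep_consistent y1 A B) (rep_consistent y2 A B).
    by move=> w h1 h2 Aw Bw; rewrite /f h1// h2.
  have c1 := Lpnorm1_gt0 y1.
  have c2 := Lpnorm1_gt0 y2.
  have [W1 [wW1 W11 h1]] := Lp_unit_weight y1.
  have [W2 [wW2 W21 h2]] := Lp_unit_weight y2.
  pose W w := 2^-1 * (W1 w + W2 w).
  have h20 : 0 <= 2^-1 :> R by rewrite invr_ge0.
  have wW : weight mu W by apply: weightZ => //; exact: weightD.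
  (* The mean [W] keeps the integral at most 1; [2 ^ th] compensates for the half in it. *)
  pose c := (Lpnorm y1 + 1 + (Lpnorm y2 + 1)) * 2 `^ th.
  have c0 : 0 < c by apply: mulr_gt0; [exact: addr_gt0|exact: powR_gt0].
  apply: (@le_lt_trans _ _ c%:E); last by rewrite ltry.
  apply/(eLpnorm_leP p1 c0 mf); exists W; split => //.
    rewrite RintegralZl//; last by case: (weightD wW1 wW2).
    by rewrite RintegralD//; [lra|case: wW1|case: wW2].
  move=> A; apply: filterS2 (h1 A) (h2 A) => w e1 e2 Aw.
  have /andP[t0 t1] := theta_itv p1.
  have cmp X : 0 <= X -> X <= W1 w + W2 w -> X `^ th <= 2 `^ th * W w `^ th.
    move=> X0 XW; rewrite -powRM// ?wW.1// /W mulVKf//.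
    by rewrite ge0_ler_powR ?nnegrE//; exact: le_trans XW.
  apply: (@le_trans _ _ (modulus (rep y1 A w) + modulus (rep y2 A w))).
    apply: le_trans (modulusD _ _) _.
    rewrite modulusN modulusM !modulus_of_real ?modulus_real lerD2l.
    by rewrite ler_piMl// modulus_imag.
  rewrite /c mulrDl mulrDl; apply: lerD.
    apply: le_trans (e1 Aw) _; rewrite -mulrA ler_pM2l// cmp ?wW1.1//.
    by rewrite lerDl wW2.1.
  apply: le_trans (e2 Aw) _; rewrite -mulrA ler_pM2l// cmp ?wW2.1//.
  by rewrite lerDr wW1.1.
exists (\pi_F (MkLpfun fP))%qT => B fB; have [A BA] := piece_cover (p1 := p1) fB.
set y : F := (\pi_F (MkLpfun fP))%qT.
have ay : {ae mu, forall w, rep_on y B w = if w \in B then f A w else 0}.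
  apply: filterS2 (rep_onE y BA) (rep_pi (MkLpfun fP) A) => w -> h.
  by case: ifPn => // /set_mem/BA/h.
split.
  apply: eq_ae_Rintegral; [exact: rep_on_integrable|exact: rep_on_integrable|].
  apply: filterS2 ay (rep_onE y1 BA) => w -> ->.
  by case: ifP => _; [rewrite fre|rewrite re_part0].
rewrite /pairing -RintegralZl//; last exact: rep_on_integrable.
apply: eq_ae_Rintegral; first exact: rep_on_integrable.
  rewrite (_ : EFin \o _ = (fun w => (- re_part (imag * imag : K))%:E * (re_part (rep_on y2 B w))%:E))%E//.
  by apply: integrableZl => //; exact: (rep_on_integrable y2 fB).
have az : {ae mu, forall w, rep_on (imag *: y) B w = imag * rep_on y B w}.
  apply: filterS3 (rep_onE (imag *: y) BA) (rep_onE y BA) (repZ imag y A) => w -> -> h.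
  by case: ifPn => [/set_mem/BA/h//|]; rewrite mulr0.
apply: filterS3 az ay (rep_onE y2 BA) => w -> -> ->.
case: ifP => _; last by rewrite mulr0 !re_part0 mulr0.
by rewrite re_part_imag fim opprK re_part_imag opprK.
Qed.

End PairingFacts.

(** * The extension *)

Lemma imag_cases (R : realType) (k : scalar_kind) :
  (imag : Defs.scalar R k) = 0 \/ re_part (imag * imag : Defs.scalar R k) = -1.
Proof.
rewrite /imag /re_part; case: k => /=; first by left.
by right; rewrite mul0r mul1r sub0r.
Qed.

Section Functional.
Context {d d'} {T : measurableType d} {T' : measurableType d'} {R : realType} {k : scalar_kind}.
Context {mu : {measure set T -> \bar R}} {mu' : {measure set T' -> \bar R}}.
Context {p : \bar R} {p1 : (1 <= p)%E}.
Local Notation K := (Defs.scalar R k).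
Local Notation E := (Lp k mu p1).
Local Notation F := (Lp k mu' p1).
Local Notation th := (theta p).

Lemma simple_weight (G : T' -> R) : simple mu' G -> (forall w, 0 <= G w) -> weight mu' G.
Proof. by move=> sG G0; split => //; exact: simple_integrable. Qed.

Lemma gauge_elem B (z : E) : fin_set mu' B -> exists s, gauge (mu' := mu') (elem B z) s.
Proof.
move=> fB; have c0 := Lpnorm1_gt0 z.
have [W [wW W1 hW]] := Lp_unit_weight z.
have wG : weight mu' (elem B (1 : R)).
  by apply: simple_weight; [exact: simple_elem|move=> w; rewrite /elem; case: ifP].
eexists; apply: (gauge_test c0 wW W1 wG) => t; rewrite /elem.
case: ifP => _; first by rewrite powR1 mulr1.
move=> A; apply: filterS (rep0 (k := k) (p1 := p1) A) => w h /h ->.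
by rewrite modulus0 !mulr_ge0 ?powR_ge0 ?(ltW c0).
Qed.

Lemma gauge_simple (v : T' -> E) : simple mu' v -> exists s, gauge (mu' := mu') v s.
Proof.
move: v; apply: simple_ind.
- have [s hs] := gauge_elem 0 (fin_set0 mu'); exists s.
  rewrite (_ : 0 = elem set0 0)//; apply/funext => w; rewrite /elem.
  by case: ifP.
- by move=> v w _ _ [s gs] [t gt]; exists (s + t); exact: gaugeD.
- by move=> B z; exact: gauge_elem.
Qed.

Lemma gauge_null B (z : E) : mu' B = 0%E -> measurable B -> gauge (mu' := mu') (elem B z) 0.
Proof.
move=> B0 mB; exists (fun=> 0), (fun=> 0); split; [exact: weight0|exact: weight0| |].
  exists B; split => // t /= ht; apply: contrapT => Bt; apply: ht.
  rewrite /elem memNset// => A; apply: filterS (rep0 (k := k) (p1 := p1) A) => w h /h ->.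
  by rewrite modulus0 mulr_ge0 ?powR_ge0.
by rewrite /Rintegral !integral0 !mulr0 addr0.
Qed.

Variables (S : set E) (u : E -> F) (C : R).
Hypothesis S_subspace : subspace_of S.
Hypothesis u_linear : linear_on S u.
Hypothesis C_gt0 : 0 < C.
Hypothesis uC : regular_bound S u C.

Let u0 : u 0 = 0. Proof. exact: (linear_on0 S_subspace u_linear). Qed.

Definition scaled_gauge (v : T' -> E) (s : R) : Prop :=
  exists2 t, gauge (mu' := mu') v t & C * t <= s.

Lemma extension_functional : exists L : (T' -> E) -> R,
  [/\ real_linear_on [set v | simple mu' v] L,
      bounded_by [set v | simple mu' v] scaled_gauge L,
      forall D z, vanishing D -> fin_set mu' (D 0%N) ->
        (fun n => L (elem (D n) z)) @ \oo --> (0 : R)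
    & forall B z, S z -> fin_set mu' B -> L (elem B z) = pairing (u z) B].
Proof using S_subspace u_linear C_gt0 uC.
have [S0 SP] := S_subspace.
have gD v w s t : scaled_gauge v s -> scaled_gauge w t -> scaled_gauge (v + w) (s + t).
  move=> [s' gs hs] [t' gt ht]; exists (s' + t'); first exact: gaugeD.
  by rewrite mulrDr lerD.
have gZ (a : R) v s : 0 < a -> scaled_gauge v s -> scaled_gauge (of_real k a *: v) (a * s).
  move=> a0 [s' gs hs]; exists (a * s'); first exact: gaugeZ.
  by rewrite mulrCA ler_pM2l.
have gS (v w : T' -> E) s : scaled_gauge v s ->
    (forall t, exists2 a : K, modulus a <= 1 & w t = a *: v t) -> scaled_gauge w s.
  by move=> [s' gs hs] vw; exists s' => //; exact: gauge_shrink gs vw.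
have gW (v : T' -> E) : simple mu' v -> exists s, scaled_gauge v s.
  by move=> /gauge_simple[s gs]; exists (C * s), s.
pose D : set (T' -> E) := [set v | simple mu' v /\ forall t, S (v t)].
have sD : real_subspace D.
  split; first by split; [exact: simple0|].
  move=> a x y [sx Sx] [sy Sy]; split; first by case: (@simple_subspace _ _ _ k mu' E) => _; apply.
  by move=> t; exact: SP.
have lD : real_linear_on D (pairing_simple u).
  by move=> a x y [sx Sx] [sy Sy]; exact: (pairing_simple_lin a u0 u_linear).
have gDu : bounded_by D scaled_gauge (pairing_simple u).
  move=> v s [sv Sv] [s' gs hs]; apply: le_trans hs.
  exact: (pairing_simple_le S_subspace u_linear).
have DW : D `<=` [set v | simple mu' v] by move=> v [].
have [Psi [lP bP eP]] := hahn_banach gD gZ (@simple_subspace _ _ _ k mu' E) gW sD DW lD gDu.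
have [L [lL bL vL aL]] := countably_additive_part gS gW lP bP.
exists L; split => // B z Sz fB.
have [mB _] := fB.
have De X : fin_set mu' X -> D (elem X z).
  by move=> fX; split; [exact: simple_elem|move=> t; rewrite /elem; case: ifP].
(* On [elem B z] with [z] in [S] the functional is an integral, hence dominated by the weight
   [|Re (u z)|] and untouched by the passage to the countably additive part. *)
rewrite (aL _ (fun w => `|re_part (rep_on (u z) B w)|)).
- by rewrite eP ?inE; [exact: pairing_simple_elem|exact: De].
- exact: simple_elem.
- by split => //; apply: (integrable_norm (rep_on_integrable (u z) fB)).
move=> X mX; rewrite (_ : cut_to X _ = elem (B `&` X) z); last first.
  apply/funext => t; rewrite /cut_to /elem in_setI.
  by case: (t \in X); rewrite ?andbT ?andbF.
have fBX : fin_set mu' (B `&` X) by exact: fin_setIl.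
have mBX : measurable (B `&` X) by case: fBX.
rewrite eP ?inE; last exact: De.
rewrite pairing_simple_elem// (pairing_setI _ fB mBX); last by move=> t [].
have i1 Y : measurable Y -> mu'.-integrable Y (EFin \o (fun w => re_part (rep_on (u z) B w))).
  by move=> mY; apply: integrableS (rep_on_integrable (u z) fB).
apply: le_trans (le_normr_Rintegral mBX (i1 _ mBX)) _.
have i2 := integrable_norm (rep_on_integrable (u z) fB).
have mi2 := measurable_int _ i2.
rewrite /Rintegral; apply: fine_le.
- by apply: integrable_fin_num => //; exact: (integrable_norm (i1 _ mBX)).
- by apply: integrable_fin_num => //; exact: (integrable_norm (i1 _ mX)).
apply: ge0_subset_integral => //; exact: measurable_funTS.
Qed.

Variable L : (T' -> E) -> R.
Hypothesis L_lin : real_linear_on [set v | simple mu' v] L.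
Hypothesis L_le : bounded_by [set v | simple mu' v] scaled_gauge L.
Hypothesis L_vanishing : forall D z, vanishing D -> fin_set mu' (D 0%N) ->
  (fun n => L (elem (D n) z)) @ \oo --> (0 : R).

Lemma elem_lin (a : K) (x y : E) (B : set T') :
  elem B (a *: x + y) = a *: elem B x + elem B y.
Proof.
apply/funext => w; rewrite /elem /GRing.add/= /GRing.scale/=.
by case: ifP; rewrite // scaler0 addr0.
Qed.

Lemma L_elem_lin (a : R) (x y : E) B : fin_set mu' B ->
  L (elem B (of_real k a *: x + y)) = a * L (elem B x) + L (elem B y).
Proof using L_lin.
by move=> fB; rewrite elem_lin L_lin//; exact: simple_elem.
Qed.

Lemma L_elem0 B : fin_set mu' B -> L (elem B 0) = 0.
Proof using L_lin.
move=> fB; have := L_elem_lin 1 0 0 fB.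
by rewrite scaler0 addr0; lra.
Qed.

Lemma represent_real (x : E) : exists y : Lp RealScalars mu' p1,
  forall B, fin_set mu' B -> pairing y B = L (elem B x).
Proof using L_lin L_le L_vanishing C_gt0.
have c0 := Lpnorm1_gt0 x.
have [W [wW W1 hW]] := Lp_unit_weight x.
pose sc (s : T' -> R) : T' -> E := fun t => of_real k (s t) *: x.
have ssc s : simple mu' s -> simple mu' (sc s).
  by move=> ss; apply: (simple_map (phi := fun r => of_real k r *: x)) => //; rewrite of_real0 scale0r.
have sce B : sc (elem B 1) = elem B x.
  by apply/funext => t; rewrite /sc /elem; case: ifP; rewrite ?of_real1 ?scale1r ?of_real0 ?scale0r.
(* For fixed [x] the real functional [s |-> L (s x)] is represented. Its constant involves
   [Lpnorm x + 1], which suffices here: the sharp bound is derived later from [L] itself. *)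
have [|||||y hy] := @real_representation _ _ _ mu' p p1 (fun s => L (sc s)) (C * (Lpnorm x + 1)).
- move=> a s t ss st; rewrite -L_lin; [|exact: ssc|exact: ssc].
  congr L; apply/funext => w.
  by rewrite /sc of_realD of_realM scalerDl -scalerA.
- move=> D vD fD; under eq_fun do rewrite sce.
  exact: L_vanishing.
- move=> B fB B0; rewrite sce; have [mB _] := fB.
  have sB : simple mu' (elem B x) by exact: simple_elem.
  have h z : L (elem B z) <= 0.
    apply: L_le; first exact: simple_elem.
    by exists 0; rewrite ?mulr0//; exact: gauge_null.
  apply/eqP; rewrite eq_le h/=.
  have := h (- x); rewrite -scaleN1r -of_real1 -of_realN -[_ *: x]addr0 L_elem_lin// L_elem0// .
  by lra.
- exact: mulr_gt0.
- move=> s G ss sG G0 sG'; rewrite -mulrA.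
  apply: L_le; first exact: ssc.
  eexists; last exact: lexx.
  apply: (gauge_test c0 wW W1 (simple_weight sG G0)) => t.
  apply: (dom_scale hW) => w; rewrite modulus_of_real.
  rewrite mulrCA mulrA [leRHS]mulrAC -!mulrA ler_pM2l// [leRHS]mulrC ler_wpM2r ?powR_ge0//.
  by apply: le_trans (sG' t) _; exact: dual_powR_le.
by exists y => B fB; rewrite hy// sce.
Qed.

(** Over complex scalars the real part of [ut x] represents [L] along [x], and that of
    [imag *: ut x] represents it along [imag *: x]. Real linearity of [L] then gives all multiples
    [a]. *)
Lemma extension_operator : exists ut : E -> F,
  forall (a : K) x B, fin_set mu' B -> pairing (a *: ut x) B = L (elem B (a *: x)).
Proof using L_lin L_le L_vanishing C_gt0.
have /choice[Y hY] := represent_real.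
have /choice[ut hut] : forall x, exists y : F, forall B, fin_set mu' B ->
    pairing y B = pairing (Y x) B /\
    pairing (imag *: y) B = - re_part (imag * imag : K) * pairing (Y (imag *: x)) B.
  by move=> x; exact: complexify.
exists ut => a x B fB; have [h1 h2] := hut x B fB.
have im : pairing (imag *: ut x) B = L (elem B (imag *: x)).
  rewrite h2 hY//; have [i0|->] := imag_cases R k; last by rewrite opprK mul1r.
  by rewrite i0 scale0r L_elem0// mulr0.
rewrite [in LHS](scalarE a) [in RHS](scalarE a) !(mulrC imag) !scalerDl -!scalerA.
rewrite addrC [in RHS]addrC pairing_lin// L_elem_lin// im pairingZ// h1 hY//.
by rewrite -[of_real k _ *: x]addr0 L_elem_lin// L_elem0// addr0.
Qed.

End Functional.

Lemma piece_eq {d} {T : measurableType d} {R : realType} {mu : {measure set T -> \bar R}}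
  {p : \bar R} (p1 : (1 <= p)%E) : p != +oo%E -> forall A B : piece mu p, A = B.
Proof.
by case: p p1 => [r| |]// _ _ [A hA] [B hB]; apply: eq_exist; rewrite hA hB.
Qed.

(** * Linearity and the regular bound of the extension *)

Section OperatorBound.
Context {d d'} {T : measurableType d} {T' : measurableType d'} {R : realType} {k : scalar_kind}.
Context {mu : {measure set T -> \bar R}} {mu' : {measure set T' -> \bar R}}.
Context {p : \bar R} {p1 : (1 <= p)%E}.
Local Notation K := (Defs.scalar R k).
Local Notation E := (Lp k mu p1).
Local Notation F := (Lp k mu' p1).
Local Notation th := (theta p).

(** A measurable choice of a maximiser, made by adding the candidates one by one; 0 is the starting
    value and the value off [B]. *)
Lemma simple_argmax (f : E -> T' -> R) (zs : seq E) (B : set T') :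
  fin_set mu' B -> (forall z, measurable_fun [set: T'] (f z)) ->
  exists s : T' -> E, [/\ simple mu' s, support_of s `<=` B, forall t, s t \in 0 :: zs
    & forall t z, B t -> z \in zs -> f z t <= f (s t) t].
Proof.
move=> fB mf; elim: zs => [|z zs [s [ss sB szs smax]]].
  exists (fun=> 0); split => //; first exact: simple0.
    by move=> t; rewrite /support_of/=.
  by move=> t; rewrite mem_head.
pose D := B `&` [set t | f (s t) t < f z t].
have [mB _] := fB.
have mD : measurable D.
  have mfs := simple_family_measurable ss mf.
  rewrite (_ : D = B `&` (fun t => f z t - f (s t) t) @^-1` [set` `]0, +oo[]); last first.
    by apply/seteqP; split => t /=; rewrite in_itv/= andbT subr_gt0.
  by apply: (measurable_funB (measurable_funTS (mf z)) (measurable_funTS mfs)).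
have fD : fin_set mu' D by apply: sub_fin_set fB => // t [].
pose s' t := if elem D (1 : R) t == 1 then z else s t.
have s'E t : s' t = if t \in D then z else s t.
  by rewrite /s' /elem; case: (t \in D); [rewrite eqxx|rewrite eq_sym oner_eq0].
exists s'; split.
- apply: (simple_map2 (phi := fun (a : R) x => if a == 1 then z else x)) => //.
    by rewrite eq_sym oner_eq0.
  exact: simple_elem.
- move=> t /=; rewrite /support_of/= s'E; case: ifPn => [/set_mem[]//|_].
  exact: sB.
- move=> t; rewrite s'E; case: ifP => _; first by rewrite !inE eqxx orbT.
  by have := szs t; rewrite !inE => /orP[->//|->]; rewrite !orbT.
move=> t y Bt; rewrite inE s'E => yz; case: ifPn => [/set_mem[_ /= lt]|tD].
  move: yz => /predU1P[->//|/(smax t y Bt)/le_trans]; apply; exact: ltW.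
have ge : f z t <= f (s t) t.
  by rewrite leNgt; apply/negP => lt; move: tD; rewrite mem_set.
by move: yz => /predU1P[->//|]; exact: smax.
Qed.

Lemma rep_gt_fin (y : F) (P : piece mu' p) (e : R) : p != +oo%E -> 0 < e ->
  fin_set mu' [set w | e < ((@re_part R k \o rep y P) \_ (sval P)) w].
Proof.
move=> pN e0; have [W [c [c0 wW hW]]] := Lp_family_le y.
have [r pE] : exists r, p = r%:E by move: p1 pN; case: (p) => [r| |]//; exists r.
have r0 : 0 < r by move: p1; rewrite pE lee_fin; exact: lt_le_trans.
have mg : measurable_fun [set: T'] ((@re_part R k \o rep y P) \_ (sval P)).
  apply/(measurable_restrictT _ (measurable_piece P)).
  by have [] := rep_measurable y P.
have ec0 : 0 < e / c by rewrite divr_gt0.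
have [N [mN N0 hN]] := hW P.
have fX : fin_set mu' [set w | (e / c) `^ r < W w] by apply: weight_gt_fin; rewrite // powR_gt0.
have fN : fin_set mu' N by split => //; rewrite N0.
apply: sub_fin_set (fin_setU fX fN).
  rewrite (_ : [set w | _] = [set: T'] `&` ((@re_part R k \o rep y P) \_ (sval P)) @^-1` [set` `]e, +oo[]); first exact: mg.
  by apply/seteqP; split => w; rewrite /= in_itv/= andbT => // -[].
move=> w /=; rewrite /patch; case: ifPn => [/set_mem Pw /= ew|_]; last by rewrite ltNge ltW.
have [Nw|Nw] := pselect (N w); [by right|left].
have hw : modulus (rep y P w) <= c * W w `^ th.
  by apply: contrapT => h; apply: Nw; apply: hN => /= h'; exact: h (h' Pw).
have : e < c * W w `^ th.
  by apply: lt_le_trans ew _; apply: le_trans hw; apply: le_trans (re_part_le _); exact: ler_norm.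
rewrite -ltr_pdivrMl// mulrC => lt.
have -> : W w = (W w `^ th) `^ r.
  by rewrite -powRrM /theta pE mulVf ?gt_eqF// powRr1// wW.1.
by rewrite /= gt0_ltr_powR// ?nnegrE ?powR_ge0// ltW.
Qed.

Variables (C : R) (L : (T' -> E) -> R) (ut : E -> F).
Hypothesis C_gt0 : 0 < C.
Hypothesis L_lin : real_linear_on [set v | simple mu' v] L.
Hypothesis L_le : bounded_by [set v | simple mu' v] (scaled_gauge (mu' := mu') C) L.
Hypothesis utL : forall (a : K) x B, fin_set mu' B ->
  pairing (a *: ut x) B = L (elem B (a *: x)).

Lemma ut_lin (a : K) x y : ut (a *: x + y) = a *: ut x + ut y.
Proof using L_lin utL.
apply: pairing_inj => c B fB.
rewrite utL// [in RHS]scalerDr [in RHS]scalerA pairingD// !utL// scalerDr scalerA.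
by rewrite -[X in elem B (X + _)]scale1r -of_real1 (L_elem_lin L_lin)// mul1r.
Qed.

Lemma ut0 : ut 0 = 0.
Proof using L_lin utL.
have := ut_lin 1 0 0; rewrite !scale1r addr0 => /eqP.
by rewrite -subr_eq0 opprD addrA subrr sub0r oppr_eq0 => /eqP.
Qed.

Lemma utZ (a : K) x : ut (a *: x) = a *: ut x.
Proof using L_lin utL. by rewrite -[a *: x]addr0 ut_lin ut0 addr0. Qed.

Lemma pairing_simple_ut (v : T' -> E) : simple mu' v -> pairing_simple ut v = L v.
Proof using L_lin utL.
have elemP B z : fin_set mu' B -> pairing_simple ut (elem B z) = L (elem B z).
  by move=> fB; rewrite pairing_simple_elem ?ut0// -[ut z]scale1r utL// scale1r.
move: v; apply: simple_ind.
- have -> : (0 : T' -> E) = elem set0 0.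
    by apply/funext => w; rewrite /elem; case: ifP.
  by apply: elemP; exact: fin_set0.
- move=> v w sv sw hv hw.
  have h1 := pairing_simple_lin (S := [set: E]) 1 ut0 (fun a x y _ _ => ut_lin a x y) sv sw
    (fun=> I) (fun=> I).
  move: h1; rewrite of_real1 scale1r mul1r => ->.
  by rewrite hv hw (real_linearD L_lin).
- by move=> B z fB; exact: elemP.
Qed.

(** [L] controls real parts only. Moduli are obtained afterwards by including rotated vectors in
    [zs]. *)
Lemma ut_family_bound (zs : seq E) (W : T -> R) (c : R) :
  0 < c -> weight mu W -> \int[mu]_w W w <= 1 -> (forall z, z \in zs -> family_le (rep z) W c) ->
  exists W', [/\ weight mu' W', \int[mu']_w W' w <= 1
    & forall P : piece mu' p, {ae mu', forall w, sval P w -> forall z, z \in zs ->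
        re_part (rep (ut z) P w) <= C * c * W' w `^ th}].
Proof using C_gt0 L_lin L_le utL.
move=> c0 wW W1 hW.
have b0 : 0 < C * c by exact: mulr_gt0.
pose g (P : piece mu' p) z : T' -> R := (@re_part R k \o rep (ut z) P) \_ (sval P).
pose H P w : R := \big[Order.max/0]_(z <- zs) g P z w.
have mg P z : measurable_fun [set: T'] (g P z).
  apply/(measurable_restrictT _ (measurable_piece P)).
  by have [] := rep_measurable (ut z) P.
have H0 P w : 0 <= H P w by exact: bigmax_ge_id.
have HP P : [/\ weight mu' (test_weight p (C * c) (H P)),
    \int[mu']_w (test_weight p (C * c) (H P) w) <= 1
  & {ae mu', forall w, H P w <= C * c * test_weight p (C * c) (H P) w `^ th}].
  apply: (@test_weightP _ _ _ mu' p p1 P) => //.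
  - rewrite /H; elim: zs {hW H H0} => [|z s IH].
      by under eq_fun do rewrite big_nil; exact: measurable_cst.
    by under eq_fun do rewrite big_cons; exact: measurable_maxr.
  - move=> w Pw; apply/eqP; rewrite eq_le H0 andbT.
    by apply: bigmax_le => // z _; rewrite /g /patch memNset.
  - move=> pN e e0; suff [] : fin_set mu' [set w | (e < H P w)%R] by [].
    rewrite /H; elim: zs {hW H H0} => [|z s IH].
      rewrite (_ : [set w | _] = set0); first exact: fin_set0.
      by apply/seteqP; split => // w /=; rewrite big_nil ltNge (ltW e0).
    rewrite (_ : [set w | _] = [set w | e < g P z w] `|` [set w | e < \big[Order.max/0]_(z <- s) g P z w]).
      by apply: fin_setU => //; exact: rep_gt_fin.
    apply/seteqP; split => w /=; rewrite big_cons lt_max; first by move/orP.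
    by move=> h; apply/orP.
  move=> G sG G0 GP.
  pose B := support_of G.
  have fB : fin_set mu' B by case: sG.
  pose f z t := re_part (rep_on (ut z) B t).
  have mf z : measurable_fun [set: T'] (f z) by have [] := rep_on_measurable (ut z) fB.
  (* The candidate 0 matches the initial value 0 of the maximum [H]: the value chosen is at least
     [f 0 t], which is 0 a.e. on [B]. *)
  have [s [ss sB szs smax]] := simple_argmax (0 :: zs) fB mf.
  pose v t := of_real k (dual_powR th (G t)) *: s t.
  have sv : simple mu' v.
    apply: (simple_map2 (phi := fun (x : R) (y : E) => of_real k (dual_powR th x) *: y)) => //.
    by rewrite dual_powR0 of_real0 scale0r.
  have vB : support_of v `<=` B.
    move=> t; rewrite /support_of/= => vt; apply: contrapT => Bt; apply: vt.
    rewrite /v (_ : G t = 0) ?dual_powR0 ?of_real0 ?scale0r//.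
    by apply: contrapT.
  have Lv : L v <= C * c * (th + (1 - th) * \int[mu']_w G w).
    rewrite -mulrA; apply: L_le => //; eexists; last exact: lexx.
    apply: (gauge_test c0 wW W1 (simple_weight sG G0)) => t.
    have hs : family_le (rep (s t)) W c.
      have := szs t; rewrite inE inE orbA orbb => /predU1P[->|/hW//].
      move=> A; apply: filterS (rep0 (k := k) (p1 := p1) A) => w h /h ->.
      by rewrite modulus0 mulr_ge0 ?powR_ge0 ?(ltW c0).
    apply: (dom_scale hs) => w; rewrite modulus_of_real ger0_norm ?dual_powR_ge0//.
    by rewrite mulrCA mulrA ler_wpM2r ?powR_ge0// ler_wpM2l ?(ltW c0)// dual_powR_le.
  rewrite -(pairing_simple_ut sv) in Lv.
  apply: (@le_trans _ _ (pairing_simple ut v)%:E); last by rewrite lee_fin.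
  have iv : mu'.-integrable [set: T'] (EFin \o (fun t => re_part (rep_on (ut (v t)) B t))).
    apply: (simple_family_integrable (f := fun z t => re_part (rep_on (ut z) B t)) sv) => z.
    exact: rep_on_integrable.
  rewrite (pairing_simple_sub ut0 sv fB vB) /Rintegral fineK; last exact: integrable_fin_num.
  have mdG : measurable_fun [set: T'] (fun w => dual_powR th (G w)).
    apply: (simple_family_measurable (f := fun z _ => dual_powR th z) sG) => z.
    exact: measurable_cst.
  have mH : measurable_fun [set: T'] (H P).
    rewrite /H; elim: zs {hW H H0 smax szs} => [|z s' IH].
      by under eq_fun do rewrite big_nil; exact: measurable_cst.
    by under eq_fun do rewrite big_cons; exact: measurable_maxr.
  have iH : mu'.-integrable [set: T'] (EFin \o (fun w => `|re_part (rep_on (ut (v w)) B w)|)).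
    exact: (integrable_norm iv).
  pose Q (z : E) t := re_part (rep_on (ut (of_real k (dual_powR th (G t)) *: z)) B t) =
     dual_powR th (G t) * f z t.
  have hQ : {ae mu', forall t, Q (s t) t}.
    have h0 : forall x z, {ae mu', forall t, re_part (rep_on (ut (of_real k x *: z)) B t) = x * f z t}.
      move=> x z; have [A BA] := piece_cover (p1 := p1) fB.
      apply: filterS3 (rep_on_lin (of_real k x) (ut z) 0 fB) (rep_onE (0 : F) BA)
        (rep0 (k := k) (p1 := p1) A) => t h1 h2 h3.
      rewrite utZ -[X in rep_on X B t]addr0 h1 h2.
      case: ifPn => [/set_mem/BA/h3 ->|_]; by rewrite addr0 re_partMr.
    apply: (simple_ae (P := Q) ss) => z _.
    apply: (simple_ae (P := fun x t => re_part (rep_on (ut (of_real k (dual_powR th x) *: z)) B t) = dual_powR th x * f z t) sG) => x _.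
    exact: h0.
  have hR : {ae mu', forall t, B t -> forall z, z \in zs -> f z t = g P z t}.
    have : {ae mu', forall t, forall z, z \in zs -> B t -> f z t = g P z t}.
      apply: ae_all_seq => z _; apply: filterS (rep_onE (ut z) GP) => t h Bt.
      by rewrite /f h mem_set// /g /patch mem_set//; exact: GP.
    by apply: filterS => t h Bt z zs'; exact: h.
  have h0 : {ae mu', forall t, B t -> f 0 t = 0}.
    apply: filterS2 (rep_onE (0 : F) GP) (rep0 (k := k) (p1 := p1) P) => t h1 h2 Bt.
    by rewrite /f ut0 h1; case: ifP => _; rewrite ?(h2 (GP _ Bt)) re_part0.
  pose h t := re_part (rep_on (ut (v t)) B t).
  have le1 : {ae mu', forall t, 0 <= H P t * dual_powR th (G t) <= h t}.
    apply: filterS3 hQ hR h0 => t h1 h2 h3.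
    rewrite mulr_ge0 ?dual_powR_ge0//= /h h1 mulrC.
    have [Bt|Bt] := pselect (B t); last first.
      by rewrite (_ : G t = 0) ?dual_powR0 ?mul0r//; apply: contrapT.
    rewrite ler_wpM2l ?dual_powR_ge0//; rewrite /H big_seq; apply: bigmax_le.
      by rewrite -(h3 Bt); apply: smax => //; exact: mem_head.
    by move=> z zzs; rewrite -h2//; apply: smax => //; rewrite inE zzs orbT.
  have mh : measurable_fun [set: T'] h by apply/measurable_EFinP; exact: measurable_int iv.
  apply: (@le_trans _ _ (\int[mu']_t (`|h t|)%:E)%E).
    apply: ae_ge0_le_integral => //.
    - by move=> t _; rewrite lee_fin mulr_ge0 ?dual_powR_ge0.
    - by apply/measurable_EFinP; exact: measurable_funM.
    - by apply/measurable_EFinP; exact: measurableT_comp.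
    by apply: filterS le1 => t /andP[_ hh] _; rewrite lee_fin; apply: le_trans hh (ler_norm _).
  rewrite le_eqVlt; apply/orP; left; apply/eqP; apply: ae_eq_integral => //.
  - by apply/measurable_EFinP; exact: measurableT_comp.
  - exact/measurable_EFinP.
  by apply: filterS le1 => t /andP[h1 h2] _; rewrite ger0_norm// (le_trans h1).
have [P0] := piece_inhabited mu' p.
(* One weight must serve all pieces: for finite [p] there is a single piece, and for infinite [p]
   the test weight is the zero function. *)
have twE P : test_weight p (C * c) (H P) = test_weight p (C * c) (H P0).
  have [pE|pN] := eqVneq p +oo%E; last by rewrite (piece_eq p1 pN P P0).
  have tw0 (h : T' -> R) : test_weight p (C * c) h = fun=> 0 by rewrite /test_weight pE.
  by rewrite !tw0.
exists (test_weight p (C * c) (H P0)); split; [by case: (HP P0)|by case: (HP P0)|].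
move=> P; have [_ _] := HP P; rewrite twE.
apply: filterS => w hw Pw z zs'; apply: le_trans hw.
have -> : re_part (rep (ut z) P w) = g P z w by rewrite /g /patch mem_set.
exact: (le_bigmax_seq 0 z xpredT (fun y => g P y w)).
Qed.

Lemma ut_sup_bound m (x : 'I_m -> E) (c e : R) : 0 < c -> 0 < e -> e < 1 ->
  Lpnorm (sup_abs x) <= c -> Lpnorm (sup_abs (ut \o x)) <= C * c / (1 - e).
Proof using C_gt0 L_lin L_le utL.
move=> c0 e0 e1 /(sup_abs_leP _ c0)[W [wW W1 hW]].
have e1' : 0 < 1 - e by rewrite subr_gt0.
have [Th [Th1 Th2]] := @phase_grid R k e e0.
(* All rotations of the [x i] by grid phases share the weight [W], because these phases have modulus
   at most 1. *)
pose zs := [seq a *: x i | a <- Th, i <- enum 'I_m].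
have [|W' [wW' W'1 hW']] := @ut_family_bound zs W c c0 wW W1.
  move=> _ /allpairsP[[a i] [/= aTh _ ->]]; apply: (dom_scale (hW i)) => w.
  by rewrite ler_piMl ?Th1// mulr_ge0 ?powR_ge0 ?(ltW c0).
apply/sup_abs_leP; first by rewrite divr_gt0// mulr_gt0.
exists W'; split => // i P.
have hZ : {ae mu', forall w, forall a, a \in Th -> sval P w ->
    rep (ut (a *: x i)) P w = a * rep (ut (x i)) P w}.
  by apply: ae_all_seq => a _; rewrite utZ; exact: repZ.
apply: filterS2 hZ (hW' P) => w h1 h2 Pw.
have [a aTh ha] := Th2 (rep (ut (x i)) P w).
rewrite mulrAC ler_pdivlMr// mulrC; apply: le_trans ha _.
rewrite -h1//; apply: h2 => //.
by apply/allpairsP; exists (a, i); split => //=; rewrite mem_enum.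
Qed.

Lemma ut_regular_bound : regular_bound [set: E] ut C.
Proof using C_gt0 L_lin L_le utL.
split; first exact: ltW.
move=> m x _; rewrite -[X in Lpnorm X <= _]/(sup_abs (ut \o x)) -/(sup_abs x).
set N := Lpnorm (sup_abs x); set M := Lpnorm _.
have N0 : 0 <= N by exact: Lpnorm_ge0.
have M0 : 0 <= M by exact: Lpnorm_ge0.
have step c : 0 < c -> N <= c -> M <= C * c.
  move=> c0 Nc; apply/ler_addgt0Pr => e e0.
  have M1 : 0 < M + 1 by rewrite ltr_wpDl.
  (* This [t] is below 1 and satisfies [(M + 1) * t <= e], which absorbs the loss from the finite
     grid of phases. *)
  pose t := Num.min (2^-1) (e / (M + 1)).
  have t0 : 0 < t by rewrite lt_min divr_gt0// andbT invr_gt0.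
  have t1 : t < 1 by rewrite gt_min invf_lt1 ?ltr1n.
  have := ut_sup_bound c0 t0 t1 Nc; rewrite -/M ler_pdivlMr ?subr_gt0// mulrBr mulr1 lerBlDr.
  move=> /le_trans; apply; rewrite lerD2l.
  apply: (@le_trans _ _ ((M + 1) * t)); first by rewrite ler_wpM2r ?(ltW t0)// lerDl.
  by rewrite mulrC -ler_pdivlMr// ge_min lexx orbT.
apply/ler_addgt0Pr => e e0.
have eC : 0 < e / C by rewrite divr_gt0.
have := step (N + e / C) (ltr_wpDl N0 eC) _; rewrite lerDl (ltW eC) => /(_ isT).
by rewrite mulrDr mulrCA mulfV ?gt_eqF// mulr1.
Qed.

End OperatorBound.

Section RegularNorm.
Context {d d'} {T : measurableType d} {T' : measurableType d'} {R : realType} {k : scalar_kind}.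
Context {mu : {measure set T -> \bar R}} {mu' : {measure set T' -> \bar R}}.
Context {p : \bar R} {p1 : (1 <= p)%E}.
Local Notation K := (Defs.scalar R k).
Local Notation E := (Lp k mu p1).
Local Notation F := (Lp k mu' p1).

(** Each regular bound of [ut] on the whole space restricts to one of [u] on [S], so the norm cannot
    drop. *)
Lemma regular_norm_extension (S : set E) (u : E -> F) (ut : E -> F) :
  regular_on S u -> (forall x, S x -> ut x = u x) ->
  regular_bound [set: E] ut (regular_norm S u) ->
  regular_norm [set: E] ut = regular_norm S u.
Proof.
move=> ru utu utC; apply/eqP; rewrite eq_le; apply/andP; split.
  by apply: ge_inf => //; exists 0 => C [].
apply: lb_le_inf; first by exists (regular_norm S u).
move=> C [C0 hC]; apply: ge_inf; first by exists 0 => C' [].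
split => // m x Sx; have := hC m x (fun _ => I).
by under eq_bigr do rewrite utu//.
Qed.

Lemma regular_bound0 (S : set E) (u : E -> F) x : regular_bound S u 0 -> S x -> u x = 0.
Proof.
move=> [_ h] Sx; have := h 1%N (fun=> x) (fun=> Sx); rewrite mul0r.
rewrite -[X in Lpnorm X <= _]/(sup_abs (fun _ : 'I_1 => u x)) => h0.
apply: Lpnorm_eq0; apply/eqP; rewrite eq_le Lpnorm_ge0 andbT.
apply/ler_addgt0Pr => e e0; rewrite add0r; apply/Lpnorm_leP => //.
have /sup_abs_leP[//|W [wW W1 hW]] := le_trans h0 (ltW e0).
by exists W; split => //; exact: (hW ord0).
Qed.

Lemma regular_bound_zero : regular_bound [set: E] (fun=> 0 : F) 0.
Proof.
split => // m x _; rewrite mul0r.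
rewrite -[X in Lpnorm X <= _]/(sup_abs (fun _ : 'I_m => 0 : F)).
apply/ler_addgt0Pr => e e0; rewrite add0r; apply/sup_abs_leP => //.
exists (fun=> 0); split; first exact: weight0.
  by rewrite /Rintegral integral0.
move=> i A; apply: filterS (rep0 (k := k) (p1 := p1) A) => w h /h ->.
by rewrite modulus0 mulr_ge0 ?powR_ge0 ?(ltW e0).
Qed.

End RegularNorm.

Theorem theorem3 (R : realType) (k : scalar_kind) (p : \bar R) (p1 : (1 <= p)%E)
    (d d' : measure_display) (T : measurableType d) (T' : measurableType d')
    (mu : {measure set T -> \bar R}) (mu' : {measure set T' -> \bar R})
    (S : set (Lp k mu p1)) (S_subspace : subspace_of S) (S_closed : closed S)
    (u : Lp k mu p1 -> Lp k mu' p1) (u_regular : regular_on S u) :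
  exists ut : {linear Lp k mu p1 -> Lp k mu' p1},
    [/\ forall x, S x -> ut x = u x,
        regular_on [set: Lp k mu p1] ut
      & regular_norm [set: Lp k mu p1] ut = regular_norm S u].
Proof.
suff [ut [utlin utu utC]] : exists ut : Lp k mu p1 -> Lp k mu' p1,
    [/\ linear ut, forall x, S x -> ut x = u x
      & regular_bound [set: Lp k mu p1] ut (regular_norm S u)].
  exists (HB.pack_for {linear Lp k mu p1 -> Lp k mu' p1} ut
    (GRing.isLinear.Build _ _ _ _ ut utlin)).
  split => //=; last exact: regular_norm_extension.
  by split; [move=> a x y _ _; exact: utlin|exists (regular_norm S u)].
have uC := regular_normP u_regular; have [C_ge0 _] := uC.
have [u_lin _] := u_regular.
(* Weights can be scaled by a positive bound only. If the norm is 0, then [u] vanishes on [S] and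
   the zero operator extends it. *)
have [C0|C0] := eqVneq (regular_norm S u) 0.
  rewrite C0 in uC *; exists (fun=> 0); split.
  - by move=> a x y; rewrite scaler0 addr0.
  - by move=> x Sx; rewrite (regular_bound0 uC Sx).
  - exact: regular_bound_zero.
have C_gt0 : 0 < regular_norm S u by rewrite lt_neqAle eq_sym C0.
have [L [L_lin L_le L_van Lu]] := extension_functional S_subspace u_lin C_gt0 uC.
have [ut utL] := extension_operator C_gt0 L_lin L_le L_van.
exists ut; split.
- by move=> a x y; exact: (ut_lin L_lin utL).
- move=> x Sx; apply: pairing_inj => a B fB.
  have [S0 SP] := S_subspace.
  have Sax : S (a *: x) by rewrite -[_ *: _]addr0; exact: SP.
  by rewrite utL// Lu// (linear_onZ S_subspace u_lin).
- exact: (ut_regular_bound C_gt0 L_lin L_le utL).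
Qed.
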